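(* Let $m_0\ge2$ and let $\{\lambda_m\}_{m\ge m_0}$ be a sequence with $\lambda_m\in\mathcal P_m^+$ for all $m$, such that for every $m\ge m_0$ either $\lambda_{m+1}=\widetilde\phi_-(\lambda_m)$ or $\lambda_{m+1}=\widetilde\phi_+(\lambda_m)$, with $\widetilde\phi_+$ occurring only finitely many times. Then the limit $\lambda=\frac32\lim_{m\to\infty}5^m\lambda_m$ exists, and $\lambda\in\mathcal P^+$.
   Context: Let $q_0,q_1,q_2$ be the vertices of an equilateral triangle in the plane, $F_i x=\frac12(x+q_i)$, and let $\mathcal{SG}$ (Sierpinski gasket) be the attractor of $\{F_0,F_1,F_2\}$. For a word $w=w_1\cdots w_n$ put $F_w=F_{w_1}\circ\cdots\circ F_{w_n}$. $V_0=\{q_0,q_1,q_2\}$, $V_m=\bigcup_{|w|=m}F_w(V_0)$; distinct $x,y\in V_m$ satisfy $x\sim_m y$ iff both lie in $F_w(V_0)$ for some word $w$ of length $m$. $L$ is the closed segment joining $q_1$ and $q_2$, $\partial\Omega=\{q_0\}\cup L$, $\Omega=\mathcal{SG}\setminus\partial\Omega$. For a word $w$, $R_w$ is the reflection symmetry of the cell $F_w(\mathcal{SG})$ fixing $F_wq_0$ and exchanging $F_wq_1,F_wq_2$. The set $\mathcal P^+$. Energy: $\mathcal{E}(u)=\lim_{m}(5/3)^m\sum_{x\sim_m y}(u(x)-u(y))^2$ (each edge once); $\mathcal F$ is the space of continuous functions on $\mathcal{SG}$ of finite energy; $\mathcal E(u,v)$ is the polarization; $\mu$ is the probability measure giving mass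 $3^{-m}$ to each $F_w(\mathcal{SG})$, $|w|=m$. An eigenvalue/eigenfunction of the Dirichlet Laplacian $-\Delta_D$ on $\Omega$ is $\lambda\in\mathbb R$ and nonzero $u\in\mathcal F_\Omega=\{v\in\mathcal F:v|_{\partial\Omega}=0\}$ with $\mathcal E(u,v)=\lambda\int_\Omega uv\,d\mu$ for all $v\in\mathcal F_\Omega$. It is symmetric primitive if $u\circ R_w=u$ on $F_w(\mathcal{SG})$ for every (possibly empty) word $w$ in $\{1,2\}$; $\mathcal P^+$ is the set of eigenvalues of symmetric primitive eigenfunctions. The sets $\mathcal P_m^+$. $V_m^\Omega=V_m\setminus L$; $\Omega_m$ is the graph on $V_m^\Omega$ with adjacency $\sim_m$; $\partial\Omega_m=\{q_0\}\cup\{F_wq_0:w\in\{1,2\}^m\}$. A Dirichlet eigenfunction of $-\Delta_m$ with eigenvalue $\lambda_m$ is a nonzero $u_m:V_m^\Omega\to\mathbb R$ vanishing on $\partial\Omega_m$ with $\sum_{y\sim_mx}(u_m(x)-u_m(y))=\lambda_mu_m(x)$ for $x\in V_m^\Omega\setminus\partial\Omega_m$. $\mathcal P_m^+$ is the set of Dirichlet eigenvalues having an eigenfunction with $u_m\circ R_w=u_m$ on $F_w(\mathcal{SG})\cap V_m^\Omega$ for every (possibly empty) word $w$ in $\{1,2\}$. The relations $\widetilde\phi_\pm$. For $m\ge2$, $\mathcal P_m^+$ consists of $r_m=2^m+2^{m-2}-2$ distinct numbers $\lambda_{m,1}<\cdots<\lambda_{m,r_m}$ in $(0,6)$, and $r_{m+1}=2r_m+2$.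 Define $\widetilde\phi_-(\lambda_{m,k})=\lambda_{m+1,k}$ and $\widetilde\phi_+(\lambda_{m,k})=\lambda_{m+1,2r_m+2-k}$ for $1\le k\le r_m$. (Equivalently, with $\phi_\pm(x)=\frac{5\pm\sqrt{25-4x}}2$: $\widetilde\phi_-(\lambda_{m,k})$ is the element of $\mathcal P_{m+1}^+$ between $\phi_-(\lambda_{m,k-1})$ and $\phi_-(\lambda_{m,k})$, and $\widetilde\phi_+(\lambda_{m,k})$ the one between $\phi_+(\lambda_{m,k})$ and $\phi_+(\lambda_{m,k-1})$, where for $k=1$ the missing endpoints are $0$ and $5$ respectively.)
   Formalization: P_m^+ is taken to require a symmetric eigenfunction that does not vanish near L; otherwise it contains extra values (6 at m=3, from a symmetric eigenfunction supported in F_0(SG)), contradicting the stated count r_m and inclusion in (0,6) on which the relations φ̃_± depend. *)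

(* Defs.v *)
From HB Require Import structures.
From mathcomp Require Import all_boot all_order all_algebra.
From mathcomp Require Import all_classical all_reals all_analysis.

Set Implicit Arguments.
Unset Strict Implicit.
Unset Printing Implicit Defensive.

Import Order.TTheory GRing.Theory Num.Theory.
Import numFieldNormedType.Exports.

Local Open Scope classical_set_scope.
Local Open Scope ring_scope.

Notation plane R := (R * R)%type.

Notation borel_plane R := (g_sigma_algebraType (@open (plane R))).

(* The product structure on R * R carries the sup norm, hence the explicit
   Euclidean scalar product. *)
Definition dotp (R : realType) (x y : plane R) : R := x.1 * y.1 + x.2 * y.2.

Definition equilateral (R : realType) (q : 'I_3 -> plane R) : Prop :=
  exists2 d : R, 0 < d &
    forall i j : 'I_3, i != j -> dotp (q i - q j) (q i - q j) = d.

Definition ifs (R : realType) (q : 'I_3 -> plane R) (i : 'I_3) (x : plane R)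
  : plane R := 2^-1 *: (x + q i).

Definition fword (R : realType) (q : 'I_3 -> plane R) (w : seq 'I_3)
  (x : plane R) : plane R := foldr (ifs q) x w.

Definition attractor (R : realType) (q : 'I_3 -> plane R) (K : set (plane R))
  : Prop :=
  [/\ compact K, K !=set0 & K = \bigcup_(i in [set: 'I_3]) (ifs q i @` K)].

Definition cell (R : realType) (q : 'I_3 -> plane R) (SG : set (plane R))
  (w : seq 'I_3) : set (plane R) := fword q w @` SG.

Definition word12 (w : seq 'I_3) : bool := 0 \notin w.

Definition segL (R : realType) (q : 'I_3 -> plane R) : set (plane R) :=
  [set (1 - t) *: q 1 + t *: q 2 | t in `[0%R, 1%R]%classic].

Definition bdOmega (R : realType) (q : 'I_3 -> plane R) : set (plane R) :=
  [set q 0] `|` segL q.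

Definition Omega (R : realType) (q : 'I_3 -> plane R) (SG : set (plane R))
  : set (plane R) := SG `\` bdOmega q.

(* Orthogonal reflection in the line through F_w q_0 perpendicular to
   F_w q_2 - F_w q_1; for equilateral q it fixes F_w q_0, exchanges F_w q_1 and
   F_w q_2, and maps the cell of w onto itself. *)
Definition reflw (R : realType) (q : 'I_3 -> plane R) (w : seq 'I_3)
  (x : plane R) : plane R :=
  let d := fword q w (q 2) - fword q w (q 1) in
  x - (2 * dotp (x - fword q w (q 0)) d / dotp d d) *: d.

Definition Vset (R : realType) (q : 'I_3 -> plane R) (m : nat)
  : set (plane R) :=
  \bigcup_(w in [set w : seq 'I_3 | size w = m]) (fword q w @` range q).

Definition adj (R : realType) (q : 'I_3 -> plane R) (m : nat) (x y : plane R)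
  : Prop :=
  x <> y /\ exists2 w : seq 'I_3, size w = m &
    (fword q w @` range q) x /\ (fword q w @` range q) y.

(* The sum runs over ordered pairs, so that 1/2 counts each edge once. *)
Definition energy_at (R : realType) (q : 'I_3 -> plane R) (m : nat)
  (u : plane R -> R) : R :=
  (5 / 3) ^+ m * (2^-1 *
    \sum_(e \in [set e : plane R * plane R | adj q m e.1 e.2])
      (u e.1 - u e.2) ^+ 2).

Definition energy (R : realType) (q : 'I_3 -> plane R) (u : plane R -> R)
  : \bar R := limn (fun m : nat => (energy_at q m u)%:E).

Definition energy_form (R : realType) (q : 'I_3 -> plane R)
  (u v : plane R -> R) : R :=
  4^-1 * (fine (energy q (u \+ v)) - fine (energy q (u \- v))).

(* Functions on SG are represented by functions on the plane, whose values
   outside SG are irrelevant. *)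
Definition finite_energy (R : realType) (q : 'I_3 -> plane R)
  (SG : set (plane R)) (u : plane R -> R) : Prop :=
  {within SG, continuous u} /\ (energy q u < +oo)%E.

Definition dirichlet_space (R : realType) (q : 'I_3 -> plane R)
  (SG : set (plane R)) (u : plane R -> R) : Prop :=
  finite_energy q SG u /\ (forall x, bdOmega q x -> u x = 0).

Definition self_similar (R : realType) (q : 'I_3 -> plane R)
  (SG : set (plane R)) (mu : probability (borel_plane R) R) : Prop :=
  forall w : seq 'I_3, mu (cell q SG w) = ((3 ^- size w)%:E)%E.

Definition eigenfunction (R : realType) (q : 'I_3 -> plane R)
  (SG : set (plane R)) (mu : probability (borel_plane R) R)
  (l : R) (u : plane R -> R) : Prop :=
  [/\ dirichlet_space q SG u,
      (exists2 x, SG x & u x != 0) &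
      forall v : plane R -> R, dirichlet_space q SG v ->
        energy_form q u v = l * \int[mu]_(x in Omega q SG) (u x * v x)].

Definition symmetric_primitive (R : realType) (q : 'I_3 -> plane R)
  (SG : set (plane R)) (u : plane R -> R) : Prop :=
  forall w : seq 'I_3, word12 w ->
    forall x, cell q SG w x -> u (reflw q w x) = u x.

Definition Pplus (R : realType) (q : 'I_3 -> plane R) (SG : set (plane R))
  (mu : probability (borel_plane R) R) : set R :=
  [set l | exists2 u : plane R -> R,
    eigenfunction q SG mu l u & symmetric_primitive q SG u].

Definition VOmega (R : realType) (q : 'I_3 -> plane R) (m : nat)
  : set (plane R) := Vset q m `\` segL q.

Definition bdOmega_at (R : realType) (q : 'I_3 -> plane R) (m : nat)
  : set (plane R) :=
  [set q 0] `|`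
  [set fword q w (q 0) | w in [set w : seq 'I_3 | size w = m /\ word12 w]].

Definition eigenfunction_at (R : realType) (q : 'I_3 -> plane R) (m : nat)
  (l : R) (u : plane R -> R) : Prop :=
  [/\ (exists2 x, VOmega q m x & u x != 0),
      (forall x, bdOmega_at q m x -> u x = 0) &
      forall x, (VOmega q m `\` bdOmega_at q m) x ->
        \sum_(y \in [set y | VOmega q m y /\ adj q m x y]) (u x - u y)
        = l * u x].

Definition symmetric_at (R : realType) (q : 'I_3 -> plane R)
  (SG : set (plane R)) (m : nat) (u : plane R -> R) : Prop :=
  forall w : seq 'I_3, word12 w ->
    forall x, (cell q SG w `&` VOmega q m) x -> u (reflw q w x) = u x.

(* u vanishes on a neighbourhood of L that is a union of cells of some level
   n < m (on the cells of level m meeting L it vanishes by the boundary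
   condition). *)
Definition localized_at (R : realType) (q : 'I_3 -> plane R)
  (SG : set (plane R)) (m : nat) (u : plane R -> R) : Prop :=
  exists2 n : nat, (n < m)%N &
    forall w : seq 'I_3, size w = n -> word12 w ->
      forall x, (cell q SG w `&` VOmega q m) x -> u x = 0.

(* Primitive eigenfunctions are the symmetric ones that are not localized.
   Without this restriction the set also contains the eigenvalues of symmetric
   localized eigenfunctions (the value 6 for m = 3; 3, 5 and 6 for m = 4), and
   then it neither lies in (0,6) nor has [rcount m] elements. *)
Definition Pplus_at (R : realType) (q : 'I_3 -> plane R) (SG : set (plane R))
  (m : nat) : set R :=
  [set l | exists u : plane R -> R,
    [/\ eigenfunction_at q m l u, symmetric_at q SG m u &
        ~ localized_at q SG m u]].

Definition rcount (m : nat) : nat := (2 ^ m + 2 ^ (m - 2) - 2)%N.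

(* x is lambda_{m,k}, the k-th smallest element (k >= 1) *)
Definition is_lambda (R : realType) (q : 'I_3 -> plane R)
  (SG : set (plane R)) (m k : nat) (x : R) : Prop :=
  Pplus_at q SG m x /\
  ([set y | Pplus_at q SG m y /\ y <= x] #= `I_k)%card.

(* phi_minus q SG m x y (resp. phi_plus) is y = phi~_-(x) (resp. phi~_+(x)),
   for x at level m and y at level m + 1. *)
Definition phi_minus (R : realType) (q : 'I_3 -> plane R)
  (SG : set (plane R)) (m : nat) (x y : R) : Prop :=
  exists2 k : nat, (1 <= k <= rcount m)%N &
    is_lambda q SG m k x /\ is_lambda q SG m.+1 k y.

Definition phi_plus (R : realType) (q : 'I_3 -> plane R)
  (SG : set (plane R)) (m : nat) (x y : R) : Prop :=
  exists2 k : nat, (1 <= k <= rcount m)%N &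
    is_lambda q SG m k x /\ is_lambda q SG m.+1 (2 * rcount m + 2 - k) y.

(* Main.v *)
Require Import Defs.
From HB Require Import structures.
From mathcomp Require Import all_boot all_order all_algebra.
From mathcomp Require Import all_classical all_reals all_analysis.
From mathcomp Require Import ring lra complex spectral.

Set Implicit Arguments.
Unset Strict Implicit.
Unset Printing Implicit Defensive.

Import Order.TTheory GRing.Theory Num.Theory.
Import numFieldNormedType.Exports.

Local Open Scope classical_set_scope.
Local Open Scope ring_scope.

(* Existence of the limit.  On a minus step [lam_(m+1) <= phi_- (lam_m)]: writing
   the indicator of [{F_w q_0 : |w| = m - 1}] as a sum of symmetric eigenfunctions
   of [-Delta_m], one solves [(-Delta_m - y(5-y)) u = 0] with value 1 on the
   vertices [F_w q_0], [|w| = m], and extends [u] to level [m + 1] by spectral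
   decimation; the extension is an eigenfunction for [y] as soon as one rational
   equation in [y] holds, and this equation has a root between consecutive values
   of [phi_-] on [P_m^+].  Counting then compares the k-th elements, and
   [lam_m >= lam_(m+1) (5 - lam_(m+1))] makes [5^m (lam_m + lam_m^2 / 4)] decrease.

   The limit is an eigenvalue.  Let [u_m] be an eigenfunction for [lam_m],
   normalised in the mean square over cells.  Its energy is [5^m lam_m / 2], hence
   bounded, so the [u_m] are equicontinuous and converge along an ultrafilter.  In
   Green's formula for [u_m] against a test function [v], the vertices next to [L]
   contribute an error controlled by the oscillation of the means of [v] over
   [F_w q_0], [w] in [{1,2}^n], which is square summable against the energy of [v];
   the weak equation therefore passes to the limit. *)

(** The root between consecutive values of [phi_-] is not explicit, so a minus step yields only an
    inequality, and convergence has to come from a corrected monotone sequence. The reflections act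
    transitively on the layer [{F_w q_0 : |w| = m - 1}], [w] in [{1,2}], so a symmetric function has
    a single value [a] there. An eigenfunction is non-localized exactly when [a != 0], that is, when
    it is not orthogonal to the indicator of the layer. Hence [P_m^+] consists of the eigenvalues
    occurring in the decomposition of this indicator, and each component has [a > 0]; this
    positivity fixes the signs that force the roots to interlace. The boundary term of Green's
    formula is critical. It is [(10/3)^m a b], with [b] the mean of the test function over the next
    layer, and both [a^2] and [b^2] are [O((3/10)^m)]: the powers cancel exactly, and only the
    improvement of the second bound to [o((3/10)^m)] makes the term vanish. An ultrafilter produces
    the limit at all points of the gasket at once, without a diagonal subsequence. *)

Lemma ord3_ind (P : 'I_3 -> Prop) : P 0 -> P 1 -> P 2 -> forall i, P i.
Proof.
move=> P0 P1 P2 [[|[|[|k]]] hk] //.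
- by have -> : Ordinal hk = 0 :> 'I_3 by apply: val_inj.
- by have -> : Ordinal hk = 1 :> 'I_3 by apply: val_inj.
- by have -> : Ordinal hk = 2 :> 'I_3 by apply: val_inj.
Qed.

Lemma sum3 (V : nmodType) (F : 'I_3 -> V) : \sum_i F i = F 0 + F 1 + F 2.
Proof.
rewrite !big_ord_recl big_ord0 addr0 addrA.
by congr (F _ + F _ + F _); apply: val_inj.
Qed.

(** * Barycentric coordinates and the intersection pattern of the cells *)

Definition crs (R : realType) (x y : plane R) : R := x.1 * y.2 - x.2 * y.1.

(** Ratio of signed areas. Indices are computed modulo 3, so [j + 1] and [j + 2] are the other two
    vertices in cyclic order. *)
Definition bary (R : realType) (q : 'I_3 -> plane R) (j : 'I_3) (x : plane R) : R :=
  crs (q (j + 1) - x) (q (j + 2) - x) / crs (q 1 - q 0) (q 2 - q 0).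

Definition tri (R : realType) (q : 'I_3 -> plane R) : set (plane R) :=
  [set x | forall j, 0 <= bary q j x].

Section Geometry.
Variables (R : realType) (q : 'I_3 -> plane R).
Hypothesis hq : equilateral q.

Lemma area_neq0 : crs (q 1 - q 0) (q 2 - q 0) != 0.
Proof.
case: hq => d d0 H.
have := H 0 1 isT; have := H 0 2 isT; have := H 1 2 isT.
rewrite /dotp /crs /=.
case: (q 0) => a b; case: (q 1) => a1 b1; case: (q 2) => a2 b2 /= h1 h2 h3.
apply/eqP => h.
(* Lagrange's identity: with side vectors [a], [b] of squared length [d], four times the squared
   cross product is [4 d^2 - (2 a.b)^2], and the third side gives [2 a.b = d]. *)
have : 3 * d ^+ 2 = 0; last by apply/eqP; rewrite mulf_neq0 ?expf_neq0 ?gt_eqF.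
have e : 4 * (((a1 - a) * (b2 - b) - (b1 - b) * (a2 - a)) ^+ 2) = 0 by rewrite h expr0n mulr0.
rewrite -[RHS]e; move: h1 h2 h3; clear; move=> h1 h2 h3.
have hd : 2 * ((a1 - a) * (a2 - a) + (b1 - b) * (b2 - b)) = d.
  by lra.
have -> : 4 * ((a1 - a) * (b2 - b) - (b1 - b) * (a2 - a)) ^+ 2 =
  4 * ((a - a1) * (a - a1) + (b - b1) * (b - b1)) * ((a - a2) * (a - a2) + (b - b2) * (b - b2))
  - (2 * ((a1 - a) * (a2 - a) + (b1 - b) * (b2 - b))) ^+ 2 by ring.
by rewrite hd h2 h3; ring.
Qed.

Lemma bary_q i j : bary q j (q i) = (i == j)%:R.
Proof.
have := area_neq0; rewrite /bary /crs.
have s21 : 2 + 1 = 0 :> 'I_3 by apply: val_inj.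
have s11 : 1 + 1 = 2 :> 'I_3 by apply: val_inj.
have s12 : 1 + 2 = 0 :> 'I_3 by apply: val_inj.
have s22 : 2 + 2 = 1 :> 'I_3 by apply: val_inj.
by elim/ord3_ind: i; elim/ord3_ind: j; rewrite ?add0r ?s21 ?s11 ?s12 ?s22 /= => h;
  rewrite ?eqxx //=; field; move: h; rewrite /=.
Qed.

Lemma bary_mid i x y : bary q i (2^-1 *: (x + y)) = (bary q i x + bary q i y) / 2.
Proof.
have := area_neq0; rewrite /bary /crs /=.
case: (q 0) => a b; case: (q 1) => a1 b1; case: (q 2) => a2 b2 /= h.
case: x => x x'; case: y => y y' /=; rewrite /GRing.scale /=.
by field.
Qed.

Lemma bary_ifs i j x : bary q j (ifs q i x) = (bary q j x + (i == j)%:R) / 2.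
Proof. by rewrite /ifs bary_mid bary_q. Qed.

Lemma baryE x : x = bary q 0 x *: q 0 + bary q 1 x *: q 1 + bary q 2 x *: q 2.
Proof.
have := area_neq0; rewrite /bary /crs.
have s21 : 2 + 1 = 0 :> 'I_3 by apply: val_inj.
have s11 : 1 + 1 = 2 :> 'I_3 by apply: val_inj.
have s12 : 1 + 2 = 0 :> 'I_3 by apply: val_inj.
have s22 : 2 + 2 = 1 :> 'I_3 by apply: val_inj.
rewrite ?add0r ?s21 ?s11 ?s12 ?s22.
case: (q 0) => a b; case: (q 1) => a1 b1; case: (q 2) => a2 b2 /= h.
case: x => x x' /=; rewrite /GRing.scale /=.
by rewrite [RHS]surjective_pairing; congr (_, _); rewrite /= /GRing.scale /=; field.
Qed.

Lemma bary_inj x y : (forall j, bary q j x = bary q j y) -> x = y.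
Proof. by move=> h; rewrite (baryE x) (baryE y) !h. Qed.

Lemma sum_bary x : bary q 0 x + bary q 1 x + bary q 2 x = 1.
Proof.
have := area_neq0; rewrite /bary /crs.
have s21 : 2 + 1 = 0 :> 'I_3 by apply: val_inj.
have s11 : 1 + 1 = 2 :> 'I_3 by apply: val_inj.
have s12 : 1 + 2 = 0 :> 'I_3 by apply: val_inj.
have s22 : 2 + 2 = 1 :> 'I_3 by apply: val_inj.
rewrite ?add0r ?s21 ?s11 ?s12 ?s22.
case: (q 0) => a b; case: (q 1) => a1 b1; case: (q 2) => a2 b2 /= h.
by case: x => x x' /=; field.
Qed.

Lemma ifs_inj i : injective (ifs q i).
Proof.
move=> x y /(congr1 (fun z => 2 *: z)); rewrite /ifs !scalerA divff ?pnatr_eq0 // !scale1r.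
by move/addIr.
Qed.

Lemma fword_inj w : injective (fword q w).
Proof. by elim: w => [|a w IH] x y //= /ifs_inj /IH. Qed.

Lemma fword_cat w w' x : fword q (w ++ w') x = fword q w (fword q w' x).
Proof. by rewrite /fword foldr_cat. Qed.

Lemma tri_q i : tri q (q i).
Proof. by move=> j; rewrite bary_q ler0n. Qed.

Lemma tri_ifs i x : tri q x -> tri q (ifs q i x).
Proof. by move=> h j; rewrite bary_ifs divr_ge0 ?addr_ge0 ?ler0n ?h. Qed.

Lemma tri_fword w x : tri q x -> tri q (fword q w x).
Proof. by move=> h; elim: w => //= a w; apply: tri_ifs. Qed.

Lemma bary_le1 j x : tri q x -> bary q j x <= 1.
Proof.
move=> h; have := sum_bary x; have := h 0; have := h 1; have := h 2.
by elim/ord3_ind: j; lra.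
Qed.

Lemma bary_eq1 j x : tri q x -> bary q j x = 1 -> x = q j.
Proof.
move=> h e; apply: bary_inj => i; rewrite bary_q.
have := sum_bary x; have := h 0; have := h 1; have := h 2; move: e.
by elim/ord3_ind: j; elim/ord3_ind: i => /=; rewrite ?eqxx /=; lra.
Qed.

Lemma ifs_qq a : ifs q a (q a) = q a.
Proof. by apply: bary_inj => j; rewrite bary_ifs bary_q; field. Qed.

Lemma ifs_qC a b : ifs q a (q b) = ifs q b (q a).
Proof. by rewrite /ifs addrC. Qed.

Lemma fword_nseq n a : fword q (nseq n a) (q a) = q a.
Proof. by elim: n => //= n ->; rewrite ifs_qq. Qed.

Lemma ifs_meet a b x y : a != b -> tri q x -> tri q y ->
  ifs q a x = ifs q b y -> x = q b /\ y = q a.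
Proof.
move=> ab hx hy e.
have ha := congr1 (bary q a) e; have hb := congr1 (bary q b) e.
move: ha hb; have ba : b != a by rewrite eq_sym.
rewrite !bary_ifs !eqxx (negbTE ab) (negbTE ba) /=.
move=> ha hb; have := bary_le1 b hx; have := bary_le1 a hy.
move: (hx a) (hy b) => h1 h2 h3 h4; clear e.
by split; apply: bary_eq1 => //; lra.
Qed.

Lemma ifs_corner a b x : tri q x -> ifs q a x = q b -> a = b /\ x = q b.
Proof.
move=> hx e; have := congr1 (bary q b) e.
rewrite bary_ifs bary_q eqxx; clear e; have := bary_le1 b hx.
case: (eqVneq a b) => [-> /= h1 h2|_ /= *]; last by exfalso; lra.
by split=> //; apply: bary_eq1 => //; lra.
Qed.

Lemma fword_corner w x b : tri q x -> fword q w x = q b -> x = q b.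
Proof.
move=> hx; elim: w => //= a w IH /ifs_corner [|_ //]; exact: tri_fword.
Qed.

(** Strip the common prefix. At the first differing letter the two triangles touch in one point
    ([ifs_meet]), which is a corner of the large triangle for the remaining words, and such a corner
    lies in a cell only as a corner of it ([fword_corner]). *)
Lemma cells_meet w w' x y : size w = size w' -> w != w' -> tri q x -> tri q y ->
  fword q w x = fword q w' y -> exists i j, [/\ i != j, x = q i & y = q j].
Proof.
elim: w w' => [|a w IH] [|b w'] //= [sz].
rewrite eqseq_cons negb_and => + hx hy.
case: (eqVneq a b) => [->|ab _] /=; first by move=> h /ifs_inj; apply: IH.
case/ifs_meet => //; try exact: tri_fword.
by move=> /fword_corner-> // /fword_corner-> //; exists b, a; rewrite eq_sym.
Qed.

Lemma cells_meet_uniq w w' x y x' y' : size w = size w' -> w != w' ->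
  tri q x -> tri q y -> tri q x' -> tri q y' ->
  fword q w x = fword q w' y -> fword q w x' = fword q w' y' -> x = x'.
Proof.
elim: w w' => [|a w IH] [|b w'] //= [sz].
rewrite eqseq_cons negb_and => + hx hy hx' hy'.
case: (eqVneq a b) => [->|ab _] /=; first by move=> h /ifs_inj ? /ifs_inj; apply: IH.
move=> h h'; apply: (@fword_inj w).
by case: (ifs_meet ab (tri_fword _ _) (tri_fword _ _) h) => // -> _;
  case: (ifs_meet ab (tri_fword _ _) (tri_fword _ _) h') => // -> _.
Qed.

End Geometry.

(** * Words, incidences of vertices with cells, and the graph Laplacian *)

Fixpoint words (n : nat) : seq (seq 'I_3) :=
  if n is k.+1 then [seq a :: w | a <- enum 'I_3, w <- words k] else [:: [::]].

Lemma sum_words0 (V : nmodType) (F : seq 'I_3 -> V) :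
  \sum_(w <- words 0) F w = F [::].
Proof. by rewrite /= big_seq1. Qed.

Lemma sum_wordsS (V : nmodType) n (F : seq 'I_3 -> V) :
  \sum_(w <- words n.+1) F w = \sum_a \sum_(w <- words n) F (a :: w).
Proof. by rewrite /= big_allpairs_dep big_enum. Qed.

Lemma sum_words_rcons (V : nmodType) n (F : seq 'I_3 -> V) :
  \sum_(w <- words n.+1) F w = \sum_(w <- words n) \sum_a F (rcons w a).
Proof.
elim: n F => [|n IH] F.
  rewrite sum_wordsS sum_words0; apply: eq_bigr => a _; exact: sum_words0.
rewrite sum_wordsS [RHS]sum_wordsS; apply: eq_bigr => a _; exact: IH.
Qed.

Lemma sum_words_cat (V : nmodType) n k (F : seq 'I_3 -> V) :
  \sum_(w <- words (n + k)) F w = \sum_(w <- words n) \sum_(v <- words k) F (w ++ v).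
Proof.
elim: n F => [|n IH] F; first by rewrite sum_words0.
by rewrite addSn !sum_wordsS; apply: eq_bigr => a _; rewrite IH.
Qed.

Lemma mem_words n w : (w \in words n) = (size w == n).
Proof.
elim: n w => [|n IH] w; first by rewrite inE size_eq0.
apply/allpairsP/eqP => [[[a v] /= [_ + ->]]|]; first by rewrite IH /= => /eqP->.
case: w => // a w [sz]; exists (a, w); split=> //=; first by rewrite mem_enum.
by rewrite IH sz.
Qed.

Lemma uniq_words n : uniq (words n).
Proof.
elim: n => //= n IH; apply: allpairs_uniq => //; first exact: enum_uniq.
by move=> [a w] [b v] _ _ /= [-> ->].
Qed.

Lemma size_words n : size (words n) = (3 ^ n)%N.
Proof. by elim: n => //= n IH; rewrite size_allpairs IH size_enum_ord expnS. Qed.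

Lemma eq_words (V : nmodType) n (F G : seq 'I_3 -> V) :
  (forall w, size w = n -> F w = G w) ->
  \sum_(w <- words n) F w = \sum_(w <- words n) G w.
Proof.
by move=> h; apply: eq_big_seq => w; rewrite mem_words => /eqP; apply: h.
Qed.

Definition pt (R : realType) (q : 'I_3 -> plane R) (w : seq 'I_3) (i : 'I_3) : plane R :=
  fword q w (q i).

Definition flux (R : realType) (q : 'I_3 -> plane R) (u : plane R -> R)
  (w : seq 'I_3) (i : 'I_3) : R := \sum_j (u (pt q w i) - u (pt q w j)).

(** Sum over the incidences [(w, i)] at the vertex [x]. Working with incidences avoids enumerating
    vertices or neighbours; [star q m (flux q u)] is [-Delta_m u] ([laplacianE]). *)
Definition star (R : realType) (q : 'I_3 -> plane R) (m : nat)
  (F : seq 'I_3 -> 'I_3 -> R) (x : plane R) : R :=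
  \sum_(w <- words m) \sum_i (pt q w i == x)%:R * F w i.

Section Incidence.
Variables (R : realType) (q : 'I_3 -> plane R).
Hypothesis hq : equilateral q.

Lemma q_inj : injective q.
Proof.
move=> i j e; have := bary_q hq i i; rewrite {1}e (bary_q hq) eqxx.
by case: (eqVneq j i) => // _ /eqP; rewrite eq_sym oner_eq0.
Qed.

Lemma pt_tri w i : tri q (pt q w i).
Proof. exact/tri_fword/tri_q. Qed.

Lemma pt_cons a w i : pt q (a :: w) i = ifs q a (pt q w i).
Proof. by []. Qed.

Lemma pt_cat w v i : pt q (w ++ v) i = fword q w (pt q v i).
Proof. exact: fword_cat. Qed.

Lemma pt_rcons w a i : pt q (rcons w a) i = fword q w (ifs q a (q i)).
Proof. by rewrite -cats1 pt_cat. Qed.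

Lemma pt_rcons_id w a : pt q (rcons w a) a = pt q w a.
Proof. by rewrite pt_rcons ifs_qq. Qed.

Lemma pt_rconsC w a b : pt q (rcons w a) b = pt q (rcons w b) a.
Proof. by rewrite !pt_rcons ifs_qC. Qed.

Lemma pt_inj w : injective (pt q w).
Proof. by move=> i j /fword_inj /q_inj. Qed.

(** A vertex is a corner of two cells of level [m], except [q_0], [q_1], [q_2], which are corners of
    one. For the vertex [F_a p], cells starting with [a] are counted at [p], and cells starting with
    [b != a] contribute one incidence exactly when [p = q b]. *)
Lemma star_count m w i : size w = m ->
  star q m (fun _ _ => 1) (pt q w i) + \sum_j (pt q w i == q j)%:R = 2.
Proof.
elim: m w i => [|m IH] w i.
  move/size0nil => ->; rewrite /star sum_words0 /pt /= -big_split /=.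
  rewrite (bigD1 i) //= eqxx big1 ?addr0 ?mulr1 // => j ji.
  by rewrite !(inj_eq q_inj) [i == j]eq_sym (negbTE ji) mul0r addr0.
case: w => // a w [sz]; rewrite pt_cons -(IH w i sz); set p := pt q w i.
have tp : tri q p by exact: pt_tri.
have -> : \sum_j (ifs q a p == q j)%:R = (p == q a)%:R :> R.
  rewrite (bigD1 a) //= big1 ?addr0 => [|j ja].
    congr (_%:R); congr nat_of_bool; apply/eqP/eqP => [/(ifs_corner hq tp) [] //|->].
    exact: ifs_qq.
  case: eqP => // /(ifs_corner hq tp) [e]; by rewrite e eqxx in ja.
rewrite [X in _ = _ + X](bigD1 a) //= [(p == q a)%:R + _]addrC addrA; congr (_ + _).
rewrite /star sum_wordsS (bigD1 a) //=; congr (_ + _).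
  apply: eq_bigr => v _; apply: eq_bigr => j _; congr (_%:R * _); congr nat_of_bool.
  by rewrite (inj_eq (@ifs_inj _ _ _)).
apply: eq_bigr => b ba.
transitivity (\sum_(v <- words m) \sum_j (p == q b)%:R * (pt q v j == q a)%:R : R).
  apply: eq_bigr => v _; apply: eq_bigr => j _; rewrite mulr1 -natrM mulnb.
  congr (_%:R); congr nat_of_bool; apply/eqP/andP => [e|[/eqP-> /eqP->]].
    by case: (ifs_meet hq ba (pt_tri v j) tp e) => -> ->.
  exact: ifs_qC.
case: (eqVneq p (q b)) => [pb|_]; last by rewrite big1 // => v _; rewrite big1 // => j _; rewrite mul0r.
(* The constant word exhibits [q a] as a vertex of level [m], so the induction hypothesis also
   counts its incidences. *)
have := IH (nseq m a) a (size_nseq _ _); rewrite /pt fword_nseq //.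
have -> : \sum_j (q a == q j)%:R = 1 :> R.
  by rewrite (bigD1 a) //= eqxx big1 ?addr0 // => j ja; rewrite (inj_eq q_inj) eq_sym (negbTE ja).
move=> e; have {e} : star q m (fun _ _ => 1) (q a) = 1 by lra.
move=> h; transitivity (star q m (fun _ _ => 1) (q a)); last exact: h.
by apply: eq_bigr => v _; apply: eq_bigr => j _; rewrite mulr1 mul1r.
Qed.

Definition edges m : seq (plane R * plane R) :=
  [seq (pt q w ij.1, pt q w ij.2) | w <- words m,
    ij <- [seq ij <- enum ({: 'I_3 * 'I_3}) | ij.1 != ij.2]].

Lemma sum_edges m (F : plane R * plane R -> R) :
  \sum_(e <- edges m) F e =
  \sum_(w <- words m) \sum_i \sum_(j | i != j) F (pt q w i, pt q w j).
Proof.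
rewrite big_allpairs_dep; apply: eq_bigr => w _.
by rewrite big_filter big_enum_cond pair_big_dep /=; apply: eq_bigl => -[].
Qed.

(** Distinct cells of one level share at most one point, so an edge determines its cell. *)
Lemma uniq_edges m : uniq (edges m).
Proof.
apply: allpairs_uniq; first exact: uniq_words.
  by rewrite filter_uniq // enum_uniq.
move=> [w [i j]] [v [k l]].
move=> /allpairsP [[w1 [i1 j1]] /= [h1 h2 [-> -> ->]]].
move=> /allpairsP [[w2 [i2 j2]] /= [h3 h4 [-> -> ->]]] /= [e1 e2].
rewrite !mem_filter !mem_words /= in h1 h2 h3 h4.
case/andP: h2 => h2 _.
have [ww|ww] := eqVneq w1 w2.
  by move: e1 e2; rewrite ww => /pt_inj -> /pt_inj ->.
have := cells_meet_uniq hq _ ww (tri_q hq _) (tri_q hq _) (tri_q hq _) (tri_q hq _) e1 e2.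
by rewrite (eqP h1) (eqP h3) => /(_ erefl) /q_inj h; rewrite h eqxx in h2.
Qed.

Lemma mem_edges m x y : (x, y) \in edges m <-> adj q m x y.
Proof.
split=> [/allpairsP [[w [i j]] /= []]|[xy [w sz [[_ [i _ <-] ex] [_ [j _ <-] ey]]]]].
  rewrite mem_words mem_filter /= => /eqP sz /andP [ij _] [-> ->]; split.
    by move/pt_inj=> e; rewrite e eqxx in ij.
  by exists w => //; split; [exists (q i) => //; exists i|exists (q j) => //; exists j].
apply/allpairsP; exists (w, (i, j)); rewrite mem_words sz mem_filter mem_enum /= andbT; split=> //.
  by apply/eqP => ij; apply: xy; rewrite -ex -ey ij.
by rewrite -ex -ey.
Qed.

Lemma energy_atE m u : energy_at q m u =
  (5 / 3) ^+ m * (2^-1 * \sum_(w <- words m) \sum_i \sum_j (u (pt q w i) - u (pt q w j)) ^+ 2).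
Proof.
rewrite /energy_at; congr (_ * (_ * _)).
have -> : [set e | adj q m e.1 e.2] = [set` edges m].
  by apply/seteqP; split=> -[x y] /mem_edges.
rewrite -fsbig_seq ?uniq_edges // sum_edges.
apply: eq_bigr => w _; apply: eq_bigr => i _.
rewrite [RHS](bigD1 i) //= subrr expr0n add0r.
by apply: eq_bigl => j; rewrite eq_sym.
Qed.

Lemma laplacianE m u x :
  \sum_(y \in [set y | adj q m x y]) (u x - u y) = star q m (flux q u) x.
Proof.
have -> : [set y | adj q m x y] = [set` [seq e.2 | e <- edges m & e.1 == x]].
  apply/seteqP; split=> y /=.
    by move/mem_edges=> h; apply/mapP; exists (x, y) => //; rewrite mem_filter eqxx.
  by case/mapP => -[a b]; rewrite mem_filter /= => /andP [/eqP -> /mem_edges h] ->.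
rewrite -fsbig_seq; last first.
  rewrite map_inj_in_uniq ?filter_uniq ?uniq_edges // => -[a b] [c d].
  by rewrite !mem_filter /= => /andP [/eqP-> _] /andP [/eqP-> _] ->.
rewrite big_map big_filter big_mkcond sum_edges /star.
apply: eq_bigr => w _; apply: eq_bigr => i _.
rewrite /flux; case: eqP => [<-|_] /=; last by rewrite mul0r big1.
rewrite mul1r [RHS](bigD1 i) //= subrr add0r.
by apply: eq_big => [j|j _]; rewrite 1?eq_sym.
Qed.

End Incidence.

(** * Interior vertices and the height above [L] *)

Definition inner (R : realType) (q : 'I_3 -> plane R) (m : nat) : set (plane R) :=
  VOmega q m `\` bdOmega_at q m.

Section Domain.
Variables (R : realType) (q : 'I_3 -> plane R).
Hypothesis hq : equilateral q.

Lemma word12_cons a w : word12 (a :: w) = (a != 0) && word12 w.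
Proof. by rewrite /word12 inE negb_or eq_sym. Qed.

Lemma word12_cat w v : word12 (w ++ v) = word12 w && word12 v.
Proof. by rewrite /word12 mem_cat negb_or. Qed.

Lemma word12_rcons w a : word12 (rcons w a) = word12 w && (a != 0).
Proof. by rewrite -cats1 word12_cat word12_cons andbT. Qed.

(** [bary q 0] is the height above [L], halved by [F_1] and [F_2]. Membership in [L], in the
    boundary layer and in the interior will all be decided by this height. *)
Lemma bary0_word12 w x : word12 w -> bary q 0 (fword q w x) = bary q 0 x / 2 ^+ size w.
Proof.
elim: w => [|a w IH]; first by rewrite expr0 divr1.
rewrite word12_cons => /andP [a0 w12] /=.
by rewrite (bary_ifs hq) IH // (negbTE a0) addr0 exprSr invfM mulrA.
Qed.

Lemma bary0_eq0 w x : tri q x ->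
  (bary q 0 (fword q w x) == 0) = word12 w && (bary q 0 x == 0).
Proof.
move=> hx; elim: w => [|a w IH] //=.
rewrite (bary_ifs hq) word12_cons mulf_eq0 invr_eq0 pnatr_eq0 orbF.
have := tri_fword hq w hx 0; case: (a == 0) => h /=; last by rewrite addr0.
by rewrite gt_eqF // ltr_wpDl.
Qed.

Lemma segLE x : segL q x <-> tri q x /\ bary q 0 x = 0.
Proof.
have b x1 y1 t j : bary q j ((1 - t) *: x1 + t *: y1) = (1 - t) * bary q j x1 + t * bary q j y1.
  have := area_neq0 hq; rewrite /bary /crs /=.
  case: (q 0) => a b; case: (q 1) => a1 b1; case: (q 2) => a2 b2 /= h.
  by case: x1 => x1 x'; case: y1 => y1 y' /=; rewrite /GRing.scale /=; field.
split=> [[t /=]|[h h0]].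
  rewrite in_itv /= => /andP [t0 t1] <-; split=> [j|]; rewrite b !(bary_q hq) /=.
    by rewrite addr_ge0 ?mulr_ge0 ?ler0n ?subr_ge0.
  by rewrite !mulr0 addr0.
have s := sum_bary hq x; exists (bary q 2 x).
  by rewrite /= in_itv /= h; have := h 1; lra.
rewrite [RHS](baryE hq) h0 scale0r add0r; congr (_ *: _ + _); lra.
Qed.

Lemma segL_pt w i : segL q (pt q w i) <-> word12 w && (i != 0).
Proof.
have <- : (bary q 0 (pt q w i) == 0) = word12 w && (i != 0).
  rewrite bary0_eq0 ?(bary_q hq) //; last exact: tri_q.
  by case: (eqVneq i 0) => _; rewrite ?oner_eq0 ?eqxx.
split=> [/segLE [_ ->]|/eqP h]; first exact: eqxx.
by apply/segLE; split=> //; exact: pt_tri.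
Qed.

Lemma Vset_pt m x : Vset q m x <-> exists w i, size w = m /\ x = pt q w i.
Proof.
split=> [[w sz [_ [i _ <-] <-]]|[w [i [sz ->]]]]; first by exists w, i.
by exists w => //; exists (q i) => //; exists i.
Qed.

Lemma VOmega_pt m w i : size w = m -> ~~ (word12 w && (i != 0)) -> VOmega q m (pt q w i).
Proof.
move=> sz h; split; first by apply/Vset_pt; exists w, i.
by move/segL_pt; apply/negP.
Qed.

Lemma VOmegaP m x : VOmega q m x ->
  exists w i, [/\ size w = m, x = pt q w i & ~~ (word12 w && (i != 0))].
Proof.
case=> /Vset_pt [w [i [sz ->]]] h; exists w, i; split=> //.
by apply/negP => h'; apply: h; apply/segL_pt.
Qed.

Lemma VsetW m n x : (m <= n)%N -> Vset q m x -> Vset q n x.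
Proof.
move=> mn /Vset_pt [w [i [sz ->]]]; apply/Vset_pt; exists (w ++ nseq (n - m) i), i.
by rewrite size_cat size_nseq sz subnKC // pt_cat /pt fword_nseq.
Qed.

Lemma VOmegaW m n x : (m <= n)%N -> VOmega q m x -> VOmega q n x.
Proof. by move=> mn [/(VsetW mn) ? ?]. Qed.

(** The corners of a cell with word in [{1,2}] lie in the boundary layer or on [L]. Consequently no
    neighbour of an interior vertex is on [L], and the graph Laplacian of [Omega_m] agrees there
    with that of [V_m]. *)
Lemma inner_word w i : inner q (size w) (pt q w i) -> ~~ word12 w.
Proof.
move=> [[_ hL] hb]; apply/negP => h; case: (eqVneq i 0) => [i0|i0].
  by apply: hb; right; exists w; rewrite // i0.
by apply: hL; apply/segL_pt; rewrite h.
Qed.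

Lemma corner_seg j : j != 0 -> segL q (q j).
Proof. by move=> h; have := (segL_pt [::] j).2; apply. Qed.

Lemma inner_corner m j : ~ inner q m (q j).
Proof.
case=> [[_ hL] hb]; case: (eqVneq j 0) => [j0|/corner_seg //].
by apply: hb; left; rewrite j0.
Qed.

Lemma inner_count m x : inner q m x -> star q m (fun _ _ => 1) x = 2.
Proof.
move=> h; have [/VOmegaP [w [i [sz xE _]]] _] := h.
have := star_count hq i sz; rewrite -xE big1 ?addr0 // => j _.
by case: eqP => // e; exfalso; apply: (@inner_corner m j); rewrite -e.
Qed.

Lemma star_mulr m F (c : R) x : star q m (fun w i => F w i * c) x = star q m F x * c.
Proof.
rewrite /star mulr_suml; apply: eq_bigr => w _; rewrite mulr_suml.
by apply: eq_bigr => i _; rewrite mulrA.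
Qed.

Lemma eq_star m F G (x : plane R) :
  (forall w i, size w = m -> pt q w i = x -> F w i = G w i) -> star q m F x = star q m G x.
Proof.
move=> h; apply: eq_words => w sz; apply: eq_bigr => i _.
by case: eqP => [/(h w i sz) -> //|_]; rewrite !mul0r.
Qed.

Lemma star_add m F G x :
  star q m (fun w i => F w i + G w i) x = star q m F x + star q m G x.
Proof.
rewrite /star -big_split; apply: eq_bigr => w _; rewrite -big_split.
by apply: eq_bigr => i _; rewrite mulrDr.
Qed.

Lemma star_const m (c : R) x : inner q m x -> star q m (fun _ _ => c) x = 2 * c.
Proof.
move=> h; rewrite -(inner_count h) -star_mulr.
by apply: eq_star => *; rewrite mul1r.
Qed.

Lemma inner_lap m u x : inner q m x ->
  \sum_(y \in [set y | VOmega q m y /\ adj q m x y]) (u x - u y) = star q m (flux q u) x.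
Proof.
move=> hx; rewrite -(laplacianE hq); apply: eq_fsbigl.
apply/seteqP; split=> y /= [] // xy [w sz [[_ [i _ <-] ex] [_ [j _ <-] ey]]].
split; last by split=> //; exists w => //; split; [exists (q i)|exists (q j)].
rewrite -ey; apply: VOmega_pt => //.
by move: hx; rewrite -ex -sz => /inner_word /negbTE ->.
Qed.

Lemma eigen_star m l u : eigenfunction_at q m l u ->
  forall x, inner q m x -> star q m (flux q u) x = l * u x.
Proof. by case=> _ _ h x hx; rewrite -inner_lap // h. Qed.

(** If the given representation of the vertex starts in another cell of the level of [w], the two
    cells share it as a corner, and the constant continuation keeps a corner as a vertex of every
    later level. *)
Lemma pt_level m w (x : plane R) : (size w <= m)%N -> tri q x ->
  Vset q m (fword q w x) ->
  exists v j, size v = (m - size w)%N /\ fword q w x = pt q (w ++ v) j.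
Proof.
move=> wm hx /Vset_pt [v [j [sz e]]].
have sz1 : size (take (size w) v) = size w by rewrite size_take sz; case: ltngtP wm.
have := e; rewrite -(cat_take_drop (size w) v) pt_cat.
have [-> e'|ne e'] := eqVneq (take (size w) v) w.
  by exists (drop (size w) v), j; rewrite size_drop sz pt_cat.
have [_ [k [_ _ xk]]] := cells_meet hq sz1 ne (pt_tri hq _ j) hx (esym e').
exists (nseq (m - size w) k), k; rewrite size_nseq pt_cat {1}/pt fword_nseq //.
by rewrite xk.
Qed.

Lemma bary0_ge m x : Vset q m x -> bary q 0 x != 0 -> 2 ^- m <= bary q 0 x.
Proof.
case/Vset_pt => w [i [<- ->]]; elim: w => [|a w IH].
  rewrite /pt (bary_q hq) expr0 invr1.
  by case: (i == 0); rewrite /= ?eqxx.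
rewrite pt_cons (bary_ifs hq) /= exprSr invfM => h.
rewrite ler_pM2r ?invr_gt0 ?ltr0n //.
have p0 := pt_tri hq w i 0.
case: (eqVneq a 0) h => [_ _|_ h] /=.
  by rewrite ler_wpDl //; rewrite invf_le1 ?exprn_gt0 // exprn_ege1 // ler1n.
rewrite addr0; apply: IH; apply: contra_neq h => ->.
by rewrite add0r mul0r.
Qed.

(** A vertex of [V_m] off [L] has height at least [2^-m], while the cell of [w] lies below [2^-|w|];
    this bounds [|w|] by [m] and so disposes of the arbitrarily long words allowed in
    [symmetric_at]. *)
Lemma cell_VOmega m w (x : plane R) : word12 w -> tri q x -> VOmega q m (fword q w x) ->
  exists v j, [/\ (size w + size v)%N = m, fword q w x = pt q (w ++ v) j &
    ~~ (word12 v && (j != 0))].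
Proof.
move=> w12 hx [hV hL].
have h0 : bary q 0 (fword q w x) != 0.
  by apply/eqP => h0; apply: hL; apply/segLE; split=> //; exact: tri_fword.
have wm : (size w <= m)%N.
  rewrite leqNgt; apply/negP => mw.
  have := bary0_ge hV h0; rewrite bary0_word12 //.
  apply/negP; rewrite -ltNge.
  apply: (@le_lt_trans _ _ (2 ^- size w)).
    by rewrite ler_piMl ?invr_ge0 ?exprn_ge0 // bary_le1.
  by rewrite ltf_pV2 ?posrE ?exprn_gt0 // ltr_eXn2l ?ltr1n.
have [v [j [sz e]]] := pt_level wm hx hV.
exists v, j; rewrite sz subnKC //; split=> //; apply/negP => h; apply: hL.
by rewrite e; apply/segL_pt; rewrite word12_cat w12.
Qed.

End Domain.

(** * The gasket and its reflections *)

Lemma geometric_small (R : realType) (t B e : R) : 0 <= t < 1 -> 0 < e ->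
  exists N, forall n, (N <= n)%N -> B * t ^+ n < e.
Proof.
move=> /andP [t0 t1] e0.
have h : B *: (t ^+ n) @[n --> \oo] --> B *: (0 : R).
  by apply: cvgZr; apply: cvg_expr; rewrite ger0_norm.
move: h; rewrite scaler0 => /cvgrPdist_lt /(_ e e0) [N _ h].
exists N => n Nn; have := h n Nn; rewrite sub0r normrN.
by apply: le_lt_trans; exact: ler_norm.
Qed.

Section Gasket.
Variables (R : realType) (q : 'I_3 -> plane R) (SG : set (plane R)).
Hypotheses (hq : equilateral q) (hSG : attractor q SG).

Lemma SG_ifs i x : SG x -> SG (ifs q i x).
Proof.
by case: hSG => _ _ e h; rewrite e; exists i => //; exists x.
Qed.

Lemma SG_fword w x : SG x -> SG (fword q w x).
Proof. by move=> h; elim: w => //= a w; exact: SG_ifs. Qed.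

Lemma SG_cell n x : SG x -> exists w y, [/\ size w = n, SG y & x = fword q w y].
Proof.
elim: n x => [|n IH] x hx; first by exists [::], x.
have : SG x by []. have [_ _ e] := hSG; rewrite {1}e => -[i _ [y hy <-]].
by have [w [z [sz hz ->]]] := IH y hy; exists (i :: w), z; rewrite /= sz.
Qed.

Lemma fwordB w x y : fword q w x - fword q w y = 2 ^- size w *: (x - y).
Proof.
elim: w => [|a w IH]; first by rewrite expr0 invr1 scale1r.
by rewrite /= /ifs -scalerBr opprD addrACA subrr addr0 IH scalerA exprS invfM.
Qed.

Lemma bary_fword_ge w j y : bary q j y / 2 ^+ size w <= bary q j (fword q w y).
Proof.
elim: w => [|a w IH]; first by rewrite expr0 divr1.
rewrite (bary_ifs hq) /= exprSr invfM mulrA ler_pM2r ?invr_gt0 //.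
by apply: le_trans IH _; rewrite lerDl.
Qed.

Lemma SG_bounded : exists2 C : R, 0 <= C & forall x, SG x -> `|x| <= C.
Proof.
have [hc _ _] := hSG; have [C [_ h]] := compact_bounded hc.
exists (`|C| + 1); first by rewrite addr_ge0.
by apply: h; rewrite ltr_pwDr // ler_norm.
Qed.

Lemma norm_crs (x y : plane R) : `|crs x y| <= 2 * (`|x| * `|y|).
Proof.
rewrite /crs mulr_natl mulr2n (le_trans (ler_normB _ _)) // !normrM.
by rewrite lerD // ler_pM // prod_normE le_max lexx ?orbT.
Qed.

Lemma bary_bounded : exists2 C : R, 0 <= C & forall x j, SG x -> `|bary q j x| <= C.
Proof.
have [C C0 h] := SG_bounded.
pose Q := `|q 0| + `|q 1| + `|q 2|.
have hQ j : `|q j| <= Q.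
  rewrite /Q; have := normr_ge0 (q 0); have := normr_ge0 (q 1); have := normr_ge0 (q 2).
  by elim/ord3_ind: j; lra.
have Q0 : 0 <= Q by exact: le_trans (hQ 0).
exists (2 * ((Q + C) * (Q + C)) * `|crs (q 1 - q 0) (q 2 - q 0)|^-1).
  by rewrite !mulr_ge0 ?addr_ge0 ?invr_ge0.
move=> x j hx; rewrite /bary normrM normfV ler_wpM2r ?invr_ge0 //.
apply: le_trans (norm_crs _ _) _; rewrite ler_pM2l // ler_pM //;
  by rewrite (le_trans (ler_normB _ _)) // lerD // ?hQ ?h.
Qed.

(** Writing [x = F_w y] with [|w| = n] gives [bary j x >= bary j y / 2^n], and [bary j] is bounded
    on the compact set [SG]; so no coordinate can be negative. *)
Lemma SG_tri x : SG x -> tri q x.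
Proof.
move=> hx j; rewrite leNgt; apply/negP => xj.
have [C C0 hC] := bary_bounded.
have t2 : 0 <= (2^-1 : R) < 1 by rewrite invr_ge0 ler0n invf_lt1 // ltr1n.
have xj' : 0 < - bary q j x by rewrite oppr_gt0.
have [n /(_ n (leqnn n))] := geometric_small C t2 xj'.
apply/negP; rewrite -leNgt.
have [w [y [sz hy ->]]] := SG_cell n hx.
rewrite lerNl; apply: le_trans (bary_fword_ge _ _ _).
rewrite sz exprVn -mulNr ler_wpM2r ?invr_ge0 ?exprn_ge0 //.
by have := hC y j hy; rewrite ler_norml => /andP [].
Qed.

Lemma SG_approx (C : R) x :
  (forall n, exists2 z, SG z & `|x - z| <= C * 2^-1 ^+ n) -> SG x.
Proof.
move=> h; have [hc _ _] := hSG.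
have cl : closed SG by apply: compact_closed => //; exact: norm_hausdorff.
apply: cl => B /nbhs_ballP [e /= e0 hB].
have t2 : 0 <= (2^-1 : R) < 1 by rewrite invr_ge0 ler0n invf_lt1 // ltr1n.
have [n /(_ n (leqnn n)) hn] := geometric_small C t2 e0.
have [z hz xz] := h n; exists z; split=> //; apply: hB.
by rewrite -ball_normE /=; exact: le_lt_trans hn.
Qed.

Lemma SG_q i : SG (q i).
Proof.
have [_ [y hy] _] := hSG.
apply: (@SG_approx `|q i - y|) => n; exists (fword q (nseq n i) y); first exact: SG_fword.
by rewrite -{1}(fword_nseq hq n i) fwordB size_nseq normrZ ger0_norm ?invr_ge0 ?exprn_ge0 // exprVn mulrC.
Qed.

Lemma SG_pt w i : SG (pt q w i).
Proof. exact/SG_fword/SG_q. Qed.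

Notation rfl := (reflw q [::]).

Lemma reflw_rfl x : rfl x = x - (bary q 2 x - bary q 1 x) *: (q 2 - q 1).
Proof.
rewrite /reflw /=; congr (_ - _ *: _).
have [d d0 H] := hq.
have h1 := H 0 1 isT; have h2 := H 0 2 isT; have h3 := H 1 2 isT.
have h31 := H 2 1 isT.
rewrite h31 {1}(baryE hq x).
have s := sum_bary hq x.
have -> : bary q 0 x = 1 - bary q 1 x - bary q 2 x by rewrite -s; ring.
move: (bary q 1 x) (bary q 2 x) => b1 b2.
apply: (@mulIf _ d); first by rewrite gt_eqF.
rewrite divfK ?gt_eqF //.
move: h1 h2 h3 h31; rewrite /dotp /=; clear.
case: (q 0) => x0 y0; case: (q 1) => x1 y1; case: (q 2) => x2 y2 /=.
rewrite /GRing.scale /= => h1 h2 h3 _.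
have -> : 2 * (((1 - b1 - b2) * x0 + b1 * x1 + b2 * x2 - x0) * (x2 - x1) +
   ((1 - b1 - b2) * y0 + b1 * y1 + b2 * y2 - y0) * (y2 - y1)) =
  b1 * (((x0 - x2) * (x0 - x2) + (y0 - y2) * (y0 - y2)) -
    ((x0 - x1) * (x0 - x1) + (y0 - y1) * (y0 - y1)) - ((x1 - x2) * (x1 - x2) + (y1 - y2) * (y1 - y2))) +
  b2 * (((x0 - x2) * (x0 - x2) + (y0 - y2) * (y0 - y2)) -
    ((x0 - x1) * (x0 - x1) + (y0 - y1) * (y0 - y1)) + ((x1 - x2) * (x1 - x2) + (y1 - y2) * (y1 - y2))) by ring.
by rewrite h1 h2 h3; ring.
Qed.

Lemma reflw_fword w x : reflw q w (fword q w x) = fword q w (rfl x).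
Proof.
rewrite /reflw /= !fwordB; set c := 2 ^- size w.
have c0 : c != 0 by rewrite invr_eq0 expf_neq0 // pnatr_eq0.
have e : 2 * dotp (c *: (x - q 0)) (c *: (q 2 - q 1)) / dotp (c *: (q 2 - q 1)) (c *: (q 2 - q 1))
   = 2 * dotp (x - q 0) (q 2 - q 1) / dotp (q 2 - q 1) (q 2 - q 1).
  have dz a b : dotp (c *: a) (c *: b) = (c * c) * dotp a b :> R.
    by rewrite /dotp /= /GRing.scale /=; ring.
  have [d d0 H] := hq.
  by rewrite !dz (H 2 1) // -mulrA -mulf_div divff ?mul1r ?mulrA // mulf_neq0.
rewrite e.
have -> y : fword q w (x - y) = fword q w x - c *: y.
  have /eqP := fwordB w (x - y) x; rewrite subr_eq => /eqP ->.
  by rewrite addrAC subrr add0r scalerN addrC.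
by rewrite !scalerA [_ * c]mulrC.
Qed.

(** Modulo 3, negation fixes 0 and exchanges 1 and 2. This lets the reflection act on letters and
    corners as negation. *)
Lemma bary_rfl j x : bary q j (rfl x) = bary q (- j) x.
Proof.
have n0 : - 0 = 0 :> 'I_3 by apply: val_inj.
have n1 : - 1 = 2 :> 'I_3 by apply: val_inj.
have n2 : - 2 = 1 :> 'I_3 by apply: val_inj.
have -> : bary q (- j) x =
    if j == 0 then bary q 0 x else if j == 1 then bary q 2 x else bary q 1 x.
  by elim/ord3_ind: j; rewrite ?n0 ?n1 ?n2.
rewrite reflw_rfl; have := baryE hq x; have := sum_bary hq x.
move: (bary q 0 x) (bary q 1 x) (bary q 2 x) => b0 b1 b2 s xE.
have := area_neq0 hq.
have s21 : 2 + 1 = 0 :> 'I_3 by apply: val_inj.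
have s11 : 1 + 1 = 2 :> 'I_3 by apply: val_inj.
have s12 : 1 + 2 = 0 :> 'I_3 by apply: val_inj.
have s22 : 2 + 2 = 1 :> 'I_3 by apply: val_inj.
rewrite {}xE /bary /crs.
have {s} -> : b0 = 1 - b1 - b2 by rewrite -s; ring.
elim/ord3_ind: j; rewrite ?add0r ?s21 ?s11 ?s12 ?s22 /=;
 case: (q 0) => x0 y0; case: (q 1) => x1 y1; case: (q 2) => x2 y2 /= h;
 rewrite /GRing.scale /=; by field.
Qed.

Lemma rflK : involutive rfl.
Proof. by move=> x; apply: (bary_inj hq) => j; rewrite !bary_rfl opprK. Qed.

Lemma rfl_q i : rfl (q i) = q (- i).
Proof.
apply: (bary_inj hq) => j; rewrite bary_rfl !(bary_q hq).
by rewrite eqr_oppLR.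
Qed.

Lemma rfl_ifs a x : rfl (ifs q a x) = ifs q (- a) (rfl x).
Proof.
apply: (bary_inj hq) => j; rewrite bary_rfl !(bary_ifs hq) bary_rfl.
by rewrite eqr_oppLR.
Qed.

Definition negw (w : seq 'I_3) : seq 'I_3 := [seq - a | a <- w].

Lemma size_negw w : size (negw w) = size w.
Proof. exact: size_map. Qed.

Lemma negwK : involutive negw.
Proof. by move=> w; rewrite /negw mapK //; exact: opprK. Qed.

Lemma word12_negw w : word12 (negw w) = word12 w.
Proof. by elim: w => //= a w IH; rewrite !word12_cons IH oppr_eq0. Qed.

Lemma rfl_fword w x : rfl (fword q w x) = fword q (negw w) (rfl x).
Proof. by elim: w => //= a w IH; rewrite rfl_ifs IH. Qed.

Lemma rfl_pt w i : rfl (pt q w i) = pt q (negw w) (- i).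
Proof. by rewrite rfl_fword rfl_q. Qed.

Lemma reflw_pt w v i : reflw q w (pt q (w ++ v) i) = pt q (w ++ negw v) (- i).
Proof. by rewrite pt_cat reflw_fword rfl_pt -pt_cat. Qed.

Lemma tri_rfl x : tri q x -> tri q (rfl x).
Proof. by move=> h j; rewrite bary_rfl. Qed.

Lemma tri_bounded : exists C : R, forall x, tri q x -> `|x| <= C.
Proof.
exists (`|q 0| + `|q 1| + `|q 2|) => x hx; rewrite {1}(baryE hq x).
have h j : `|bary q j x *: q j| <= `|q j|.
  by rewrite normrZ ger0_norm ?hx // ler_piMl // bary_le1.
by rewrite !(le_trans (ler_normD _ _)) ?lerD ?h // (le_trans (ler_normD _ _)) ?lerD ?h.
Qed.

(** The reflected point is a limit of vertices, because the reflection sends vertices to vertices,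
    and [SG] is closed. *)
Lemma SG_rfl x : SG x -> SG (rfl x).
Proof.
move=> hx; have [C hC] := tri_bounded.
apply: (@SG_approx (C + C)) => n.
have [w [y [sz hy ->]]] := SG_cell n hx.
exists (pt q (negw w) 0); first exact: SG_pt.
rewrite rfl_fword fwordB size_negw sz normrZ ger0_norm ?invr_ge0 ?exprn_ge0 // exprVn mulrC.
rewrite ler_wpM2r ?invr_ge0 ?exprn_ge0 // (le_trans (ler_normB _ _)) // lerD //.
  by apply/hC/tri_rfl/SG_tri.
exact/hC/tri_q.
Qed.

Lemma SG_corner w w' x y : size w = size w' -> SG x -> SG y ->
  fword q w x = fword q w' y -> w = w' \/ exists i j, fword q w x = pt q w i /\ pt q w i = pt q w' j.
Proof.
move=> sz /SG_tri hx /SG_tri hy e; have [->|ne] := eqVneq w w'; [by left|right].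
have [i [j [_ xi yj]]] := cells_meet hq sz ne hx hy e.
by exists i, j; rewrite /pt -xi -yj.
Qed.

End Gasket.

(** * Graph energies and their limit *)

Lemma discriminant (R : realType) (A B C : R) :
  (forall t, 0 <= A + 2 * t * B + t ^+ 2 * C) -> B ^+ 2 <= A * C.
Proof.
move=> h.
have A0 : 0 <= A by have := h 0; rewrite mulr0 !mul0r expr0n mul0r !addr0.
have [C0|C0] := ltP 0 C.
  have := h (- B / C).
  have -> : A + 2 * (- B / C) * B + (- B / C) ^+ 2 * C = (A * C - B ^+ 2) / C.
    by field; rewrite gt_eqF.
  by rewrite pmulr_lge0 ?invr_gt0 // subr_ge0.
have [B0|B0] := eqVneq B 0.
  have C0' : 0 <= C; last by rewrite B0 expr0n mulr_ge0.
  rewrite leNgt; apply/negP => C1.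
  have := h ((A + 1) / C - 1); rewrite B0 mulr0 addr0; apply/negP; rewrite -ltNge.
  have : (A + 1) / C <= 0 by rewrite mulr_ge0_le0 ?invr_le0 ?addr_ge0.
  have : (A + 1) / C * C = A + 1 by rewrite divfK // lt_eqF.
  set z := (A + 1) / C => e z0; nra.
exfalso; have := h (- (A + 1) / B); apply/negP; rewrite -ltNge -mulrA.
have : - (A + 1) / B * B = - (A + 1) by rewrite divfK.
set z := - (A + 1) / B => ->; have := sqr_ge0 z; nra.
Qed.

Section Energy.
Variables (R : realType) (q : 'I_3 -> plane R).
Hypothesis hq : equilateral q.

Definition cell_form (u v : plane R -> R) (w : seq 'I_3) : R :=
  2^-1 * \sum_i \sum_j (u (pt q w i) - u (pt q w j)) * (v (pt q w i) - v (pt q w j)).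

Definition form (m : nat) (u v : plane R -> R) : R :=
  (5 / 3) ^+ m * \sum_(w <- words m) cell_form u v w.

Lemma energy_at_form m u : energy_at q m u = form m u u.
Proof.
rewrite (energy_atE hq) /form; congr (_ * _); rewrite mulr_sumr.
by apply: eq_bigr => w _.
Qed.

Lemma cell_form_flux u v w : cell_form u v w = \sum_i v (pt q w i) * flux q u w i.
Proof.
by rewrite /cell_form /flux !sum3; field.
Qed.

Lemma cell_form_ge0 u w : 0 <= cell_form u u w.
Proof.
by rewrite mulr_ge0 ?invr_ge0 // sumr_ge0 // => i _; rewrite sumr_ge0 // => j _; rewrite -expr2 sqr_ge0.
Qed.

(** The factor [5/3] makes this an equality for the harmonic extension; deviating from it adds an
    explicit sum of squares. *)
Lemma cell_form_refine u w :
  cell_form u u w <= 5 / 3 * \sum_a cell_form u u (rcons w a).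
Proof.
rewrite /cell_form !sum3 !(pt_rcons_id hq).
rewrite !(pt_rconsC q w 1 0) !(pt_rconsC q w 2 0) !(pt_rconsC q w 2 1).
move: (u (pt q w 0)) (u (pt q w 1)) (u (pt q w 2)) (u (pt q (rcons w 0) 1))
  (u (pt q (rcons w 0) 2)) (u (pt q (rcons w 1) 2)) => x0 x1 x2 y01 y02 y12.
rewrite -subr_ge0.
(* Deviations from the harmonic extension, whose value at a midpoint weighs the two near corners by
   [2/5] and the far one by [1/5]. *)
pose z01 := y01 - (2 * x0 + 2 * x1 + x2) / 5.
pose z02 := y02 - (2 * x0 + 2 * x2 + x1) / 5.
pose z12 := y12 - (2 * x1 + 2 * x2 + x0) / 5.
have -> : y01 = z01 + (2 * x0 + 2 * x1 + x2) / 5 by rewrite /z01; ring.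
have -> : y02 = z02 + (2 * x0 + 2 * x2 + x1) / 5 by rewrite /z02; ring.
have -> : y12 = z12 + (2 * x1 + 2 * x2 + x0) / 5 by rewrite /z12; ring.
move: z01 z02 z12 => a b c.
rewrite [leRHS](_ : _ = 5 / 3 * (2 * (a ^+ 2 + b ^+ 2 + c ^+ 2) +
  (a - b) ^+ 2 + (a - c) ^+ 2 + (b - c) ^+ 2)); last by field.
by rewrite mulr_ge0 ?divr_ge0 // !addr_ge0 ?sqr_ge0 // mulr_ge0 // !addr_ge0 ?sqr_ge0.
Qed.

Lemma form_ge0 m u : 0 <= form m u u.
Proof. by rewrite mulr_ge0 ?exprn_ge0 ?divr_ge0 // sumr_ge0 // => w _; exact: cell_form_ge0. Qed.

Lemma form_incrS m u : form m u u <= form m.+1 u u.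
Proof.
rewrite /form exprSr -mulrA ler_wpM2l ?exprn_ge0 ?divr_ge0 //.
rewrite sum_words_rcons mulr_sumr ler_sum // => w _; exact: cell_form_refine.
Qed.

Lemma form_incr m n u : (m <= n)%N -> form m u u <= form n u u.
Proof.
by move/subnK <-; elim: (n - m)%N => // k /le_trans; apply; exact: form_incrS.
Qed.

Lemma form_quad m u v (t : R) :
  form m (fun x => u x + t * v x) (fun x => u x + t * v x) =
  form m u u + 2 * t * form m u v + t ^+ 2 * form m v v.
Proof.
have key (k : R) (F G H : seq 'I_3 -> R) : k * (\sum_(w <- words m) F w) +
    2 * t * (k * (\sum_(w <- words m) G w)) + t ^+ 2 * (k * (\sum_(w <- words m) H w)) =
    k * \sum_(w <- words m) (F w + 2 * t * G w + t ^+ 2 * H w).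
  by rewrite !big_split /= -!mulr_sumr; ring.
rewrite /form key; congr (_ * _); apply: eq_bigr => w _; rewrite /cell_form !sum3; ring.
Qed.

Lemma form_polar m u v : form m u v = 4^-1 * (form m (u \+ v) (u \+ v) - form m (u \- v) (u \- v)).
Proof.
have -> : u \+ v = fun x => u x + 1 * v x by apply/funext => x; rewrite mul1r.
have -> : u \- v = fun x => u x + (-1) * v x by apply/funext => x; rewrite mulN1r.
by rewrite !form_quad; field.
Qed.

(** The energy gained from level [m] to level [n] is itself a nonnegative quadratic form. The mixed
    form of a bounded-energy [u] thus changes little once the energy of [v] has nearly been
    reached. *)
Lemma form_CS m n u v : (m <= n)%N ->
  (form n u v - form m u v) ^+ 2 <= (form n u u - form m u u) * (form n v v - form m v v).
Proof.
move=> mn; apply: discriminant => t.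
have := form_incr (fun x => u x + t * v x) mn; rewrite !form_quad => h.
by rewrite -subr_ge0 in h; apply: le_trans h _; rewrite le_eqVlt; apply/orP; left; apply/eqP; ring.
Qed.

Lemma form_edge m u w i j : size w = m ->
  (u (pt q w i) - u (pt q w j)) ^+ 2 <= (3 / 5) ^+ m * form m u u.
Proof.
move=> sz; rewrite /form mulrA -exprMn (_ : 3 / 5 * (5 / 3) = 1) ?expr1n ?mul1r; last by field.
apply: (@le_trans _ _ (cell_form u u w)).
  rewrite /cell_form !sum3.
  elim/ord3_ind: i; elim/ord3_ind: j; move: (u (pt q w 0)) (u (pt q w 1)) (u (pt q w 2)) => a b c;
    have := sqr_ge0 (a - b); have := sqr_ge0 (a - c); have := sqr_ge0 (b - c); lra.
have wm : w \in words m by rewrite mem_words sz.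
rewrite (big_rem w wm) /= lerDl sumr_ge0 // => v _; exact: cell_form_ge0.
Qed.

Lemma energy_cvg u : (energy_at q m u)%:E @[m --> \oo] --> energy q u.
Proof.
apply: ereal_nondecreasing_is_cvgn => m n mn.
by rewrite lee_fin !energy_at_form form_incr.
Qed.

Lemma energy_ub u m : ((form m u u)%:E <= energy q u)%E.
Proof.
rewrite -energy_at_form.
have h : {homo (fun m => (energy_at q m u)%:E) : k n / (k <= n)%N >-> (k <= n)%E}.
  by move=> k n kn; rewrite lee_fin !energy_at_form form_incr.
rewrite /energy (cvg_lim _ (ereal_nondecreasing_cvgn h)) //.
by apply: ereal_sup_ubound; exists m.
Qed.

Lemma energy_bounded u : (energy q u < +oo)%E -> forall m, form m u u <= fine (energy q u).
Proof.
move=> h m; rewrite -lee_fin fineK ?energy_ub //.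
rewrite ge0_fin_numE //; apply: le_trans (energy_ub u 0).
by rewrite lee_fin form_ge0.
Qed.

Lemma energy_lt_pinfty u K : (forall m, form m u u <= K) -> (energy q u < +oo)%E.
Proof.
move=> h; apply: (@le_lt_trans _ _ K%:E); last exact: ltry.
apply: lime_le; first by apply/cvg_ex; eexists; exact: energy_cvg.
by apply: nearW => m; rewrite lee_fin energy_at_form.
Qed.

Lemma energy_fine_cvg u : (energy q u < +oo)%E -> form m u u @[m --> \oo] --> fine (energy q u).
Proof.
move=> h.
have fn : energy q u \is a fin_num.
  rewrite ge0_fin_numE //; apply: le_trans (energy_ub u 0).
  by rewrite lee_fin form_ge0.
under eq_fun do rewrite -energy_at_form.
have := @energy_cvg u; rewrite -{1}(fineK fn); exact: fine_cvg.
Qed.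

Lemma energy_formP u v : (energy q u < +oo)%E -> (energy q v < +oo)%E ->
  form m u v @[m --> \oo] --> energy_form q u v.
Proof.
move=> hu hv.
have bd t : (energy q (fun x => (u x + t * v x)%R) < +oo)%E.
  apply: (@energy_lt_pinfty _ (2 * fine (energy q u) + 2 * t ^+ 2 * fine (energy q v))) => m.
  (* Parallelogram law: the energies of [u + t v] and [u - t v] add up to the claimed bound, and the
     second is nonnegative. *)
  have := form_ge0 m (fun x => u x + (- t) * v x); rewrite !form_quad => h.
  have := energy_bounded hu m; have := energy_bounded hv m => h1 h2.
  have h3 : t ^+ 2 * form m v v <= t ^+ 2 * fine (energy q v) by rewrite ler_wpM2l ?sqr_ge0.
  rewrite sqrrN mulrN mulNr in h; clear hu hv.
  by move: (form m u u) (form m u v) (form m v v) (fine _) (fine _) h h1 h2 h3 => a b c d e; lra.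
have -> : (fun m => form m u v) = (fun m => 4^-1 * (form m (u \+ v) (u \+ v) - form m (u \- v) (u \- v))).
  by apply/funext => m; rewrite form_polar.
apply: cvgM; first exact: cvg_cst.
apply: cvgB; apply: energy_fine_cvg.
  by have := bd 1; congr (energy _ _ < _)%E; apply/funext => x; rewrite mul1r.
by have := bd (-1); congr (energy _ _ < _)%E; apply/funext => x; rewrite mulN1r.
Qed.

End Energy.

(** * Means over the layers approaching [L] *)

Lemma sqr_sum_le (R : realType) (I : Type) (s : seq I) (P : pred I) (F : I -> R) :
  (\sum_(i <- s | P i) F i) ^+ 2 <= (\sum_(i <- s | P i) F i ^+ 2) * (\sum_(i <- s | P i) 1).
Proof.
apply: discriminant => t.
have -> : \sum_(i <- s | P i) F i ^+ 2 + 2 * t * (\sum_(i <- s | P i) F i) +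
    t ^+ 2 * (\sum_(i <- s | P i) 1) = \sum_(i <- s | P i) (F i + t) ^+ 2.
  rewrite !mulr_sumr -!big_split /=; apply: eq_bigr => i _; ring.
by rewrite sumr_ge0 // => i _; exact: sqr_ge0.
Qed.

Lemma sum3_neq0 (V : nmodType) (F : 'I_3 -> V) : \sum_(i | i != 0) F i = F 1 + F 2.
Proof. by rewrite big_mkcond sum3 /= add0r. Qed.

Lemma sum_word12S (V : nmodType) n (F : seq 'I_3 -> V) :
  \sum_(w <- words n.+1 | word12 w) F w =
  \sum_(w <- words n | word12 w) \sum_(a | a != 0) F (rcons w a).
Proof.
rewrite big_mkcond sum_words_rcons [RHS]big_mkcond; apply: eq_bigr => w _.
rewrite -big_mkcond /=; case: ifP => hw.
  by apply: eq_bigl => a; rewrite word12_rcons hw.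
by rewrite big1 // => a; rewrite word12_rcons hw.
Qed.

Lemma count_word12 (R : realType) n : \sum_(w <- words n | word12 w) (1 : R) = 2 ^+ n.
Proof.
elim: n => [|n IH]; first by rewrite big_mkcond sum_words0 expr0.
rewrite sum_word12S exprSr -IH mulr_suml; apply: eq_bigr => w _.
by rewrite sum3_neq0; ring.
Qed.

Section Chain.
Variables (R : realType) (q : 'I_3 -> plane R).
Hypothesis hq : equilateral q.

(** The vertices [F_w q_0] with [w] in [{1,2}^m], recognised by their height alone ([bot_pt],
    [botP]). *)
Definition bot (m : nat) (x : plane R) : bool := bary q 0 x == 2 ^- m.

Lemma bot_pt w : word12 w -> bot (size w) (pt q w 0).
Proof. by move=> h; rewrite /bot /pt bary0_word12 // (bary_q hq) mul1r. Qed.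

Lemma bary0_nword12 w (x : plane R) : tri q x -> ~~ word12 w -> 2 ^- size w <= bary q 0 (fword q w x).
Proof.
move=> hx; elim: w => [|a w IH] //.
rewrite word12_cons negb_and negbK (bary_ifs hq) /= exprSr invfM => h.
rewrite ler_pM2r ?invr_gt0 //; have := tri_fword hq w hx 0.
case: (a == 0) h => /= [_ h0|h _].
  by rewrite ler_wpDl // invf_le1 ?exprn_gt0 // exprn_ege1 // ler1n.
by rewrite addr0 IH.
Qed.

(** [pt q (rcons v a) i] is the midpoint of the corners [a] and [i] of the cell of [v]; it has half
    the height of that cell when exactly one of the two corners is the top one. *)
Lemma botE v a i : bot (size v).+1 (pt q (rcons v a) i) = word12 v && ((a == 0) (+) (i == 0)).
Proof.
rewrite /bot pt_rcons; case: (boolP (word12 v)) => /= hv; last first.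
  rewrite gt_eqF //; apply: lt_le_trans (bary0_nword12 _ hv); last exact/(tri_ifs hq)/tri_q.
  by rewrite ltf_pV2 ?posrE ?exprn_gt0 // ltr_eXn2l ?ltr1n.
rewrite bary0_word12 // (bary_ifs hq) (bary_q hq) exprS invfM.
rewrite -subr_eq0 -mulrBl mulf_eq0 invr_eq0 expf_eq0 pnatr_eq0 andbF orbF.
rewrite -[X in _ - X]mul1r -mulrBl mulf_eq0 invr_eq0 pnatr_eq0 orbF.
case: (a == 0); case: (i == 0) => /=; rewrite ?addr0 ?add0r ?subrr ?eqxx //.
  by rewrite addrK oner_eq0.
by rewrite oppr_eq0 oner_eq0.
Qed.

Lemma botP m x : Vset q m.+1 x -> bot m.+1 x ->
  exists w, [/\ size w = m.+1, word12 w & x = pt q w 0].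
Proof.
case/Vset_pt => w [i []]; case/lastP: w => // v a; rewrite size_rcons => -[<-] ->.
rewrite botE => /andP [hv]; case: (eqVneq i 0) => [->|i0] /=.
  rewrite addbT => a0; exists (rcons v a); rewrite size_rcons word12_rcons hv a0.
  by split.
rewrite addbF => /eqP ->; exists (rcons v i); rewrite size_rcons word12_rcons hv i0.
by split=> //; exact: pt_rconsC.
Qed.

(** With this, being interior depends only on the height, hence is preserved by the reflections
    [R_w], [w] in [{1,2}]. *)
Lemma innerP m x : Vset q m.+1 x -> inner q m.+1 x <-> [/\ bary q 0 x != 0, bary q 0 x != 1 & ~~ bot m.+1 x].
Proof.
move=> hV; have tx : tri q x by case/Vset_pt: hV => w [i [_ ->]]; exact: pt_tri.
split=> [[[_ hL] hb]|[h0 h1 h2]].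
  split; first by apply/eqP => h; apply: hL; exact/segLE.
    by apply/eqP => h; apply: hb; left; exact: bary_eq1.
  apply/negP => /(botP hV) [w [sz hw xw]]; apply: hb; right; exists w => //.
split; first by split=> // /(segLE hq) [_ h]; rewrite h eqxx in h0.
case=> [/= h|[w [sz hw] xw]]; first by move/eqP: h1; apply; rewrite h (bary_q hq).
by move: h2; rewrite -xw -sz bot_pt.
Qed.

(** Weighting each incidence by the inverse of the number [c] of incidences at its vertex and
    exchanging the sums regroups the total vertex by vertex. *)
Lemma sum_star0 m F (g : plane R -> R) :
  (forall x, Vset q m x -> g x * star q m F x = 0) ->
  \sum_(w <- words m) \sum_i g (pt q w i) * F w i = 0.
Proof.
move=> h; pose c x := star q m (fun _ _ => 1) x.
have c0 w i : size w = m -> c (pt q w i) != 0.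
  move=> sz; rewrite gt_eqF // /c /star.
  have wm : w \in words m by rewrite mem_words sz.
  rewrite (big_rem w wm) /= (bigD1 i) //= eqxx mulr1 -addrA ltr_pwDl //.
  by rewrite addr_ge0 // sumr_ge0 // => *; rewrite ?sumr_ge0 // => *; rewrite mulr1 ler0n.
transitivity (\sum_(w <- words m) \sum_i \sum_(v <- words m) \sum_j
    (pt q v j == pt q w i)%:R * (g (pt q w i) / c (pt q w i) * F w i)).
  apply: eq_words => w sz; apply: eq_bigr => i _.
  transitivity (c (pt q w i) * (g (pt q w i) / c (pt q w i) * F w i)).
    by rewrite mulrA [c _ * _]mulrC divfK ?c0.
  rewrite mulr_suml; apply: eq_bigr => v _; rewrite mulr_suml; apply: eq_bigr => j _.
  by rewrite mulr1.
transitivity (\sum_(v <- words m) \sum_j \sum_(w <- words m) \sum_i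
    (pt q v j == pt q w i)%:R * (g (pt q w i) / c (pt q w i) * F w i)).
  under eq_bigr do rewrite exchange_big /=.
  rewrite exchange_big /=; apply: eq_bigr => v _.
  under eq_bigr do rewrite exchange_big /=.
  by rewrite exchange_big.
rewrite (eq_words (G := fun _ => 0)) ?big1 // => v sz; rewrite big1 // => j _.
transitivity ((c (pt q v j))^-1 * (g (pt q v j) * star q m F (pt q v j))).
  rewrite !mulr_sumr; apply: eq_bigr => w _; rewrite !mulr_sumr; apply: eq_bigr => i _.
  rewrite [pt q w i == _]eq_sym; case: eqP => [->|_]; last by rewrite !mul0r !mulr0.
  by rewrite !mul1r mulrA [_^-1 * _]mulrC.
by rewrite h ?mulr0 //; apply/Vset_pt; exists v, j.
Qed.

Definition gbar n (g : plane R -> R) : R := 2 ^- n * \sum_(w <- words n | word12 w) g (pt q w 0).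

(** Renormalised energy of the edges joining [F_w q_0] to the vertices [F_(w i) q_0] of the next
    layer: for [i] in [{1,2}], [pt q (rcons w 0) i] is [F_(w i) q_0]. *)
Definition chain n (g : plane R -> R) : R :=
  (5 / 3) ^+ n.+1 * \sum_(w <- words n | word12 w) \sum_(i | i != 0)
    (g (pt q w 0) - g (pt q (rcons w 0) i)) ^+ 2.

Definition form_off n (g : plane R -> R) : R :=
  (5 / 3) ^+ n * \sum_(w <- words n | ~~ word12 w) cell_form q g g w.

Lemma gbarS n g : gbar n.+1 g =
  2 ^- n.+1 * \sum_(w <- words n | word12 w) \sum_(i | i != 0) g (pt q (rcons w 0) i).
Proof.
rewrite /gbar sum_word12S; congr (_ * _); apply: eq_bigr => w _; apply: eq_bigr => i _.
by rewrite pt_rconsC.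
Qed.

(** Cauchy-Schwarz over the [2^(n+1)] edges between the two layers. The ratio [3/10] is [1/2], from
    averaging, times [3/5], the inverse of the energy scaling. *)
Lemma gbar_chain n g : (gbar n g - gbar n.+1 g) ^+ 2 <= (3 / 10) ^+ n.+1 * chain n g.
Proof.
have -> : gbar n g - gbar n.+1 g = 2 ^- n.+1 * \sum_(w <- words n | word12 w)
    \sum_(i | i != 0) (g (pt q w 0) - g (pt q (rcons w 0) i)).
  rewrite gbarS /gbar.
  have -> : 2 ^- n * \sum_(w <- words n | word12 w) g (pt q w 0) =
      2 ^- n.+1 * \sum_(w <- words n | word12 w) \sum_(i : 'I_3 | i != 0) g (pt q w 0).
    rewrite exprS invfM -mulrA !mulr_sumr; apply: eq_bigr => w _.
    by rewrite sum3_neq0; field; rewrite expf_neq0.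
  rewrite -mulrBr -sumrB; congr (_ * _); apply: eq_bigr => w _.
  by rewrite sumrB.
rewrite exprMn.
have := sqr_sum_le (words n) word12 (fun w => \sum_(i | i != 0) (g (pt q w 0) - g (pt q (rcons w 0) i))).
rewrite count_word12 => h.
apply: (@le_trans _ _ ((2 ^- n.+1) ^+ 2 * (2 ^+ n.+1 * \sum_(w <- words n | word12 w) \sum_(i | i != 0)
    (g (pt q w 0) - g (pt q (rcons w 0) i)) ^+ 2))).
  rewrite ler_wpM2l ?sqr_ge0 //; apply: le_trans h _.
  rewrite mulrC exprSr -mulrA ler_wpM2l ?exprn_ge0 // mulr_sumr ler_sum // => w _.
  rewrite !sum3_neq0; set x := _ - _; set y := _ - _.
  have := sqr_ge0 (x - y); nra.
rewrite /chain [leRHS]mulrA -exprMn [leLHS]mulrA.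
rewrite (_ : 3 / 10 * (5 / 3) = 2^-1 :> R); last by field.
rewrite (_ : 2 ^- n.+1 ^+ 2 * 2 ^+ n.+1 = 2^-1 ^+ n.+1 :> R) //.
by rewrite expr2 -mulrA mulVf ?mulr1 ?exprVn // expf_neq0.
Qed.

Lemma form_off_le n g : form_off n g <= form q n g g.
Proof.
rewrite ler_wpM2l ?exprn_ge0 ?divr_ge0 // [leRHS](bigID word12) /= lerDr sumr_ge0 // => w _.
exact: cell_form_ge0.
Qed.

(** The edges of [chain n] lie in cells [w 0] with [w] in [{1,2}^n]: these count in [form_off] at
    level [n + 1], whereas their parents do not at level [n]. The chain energies therefore telescope
    against a bounded quantity, which gives [chain_cvg0]. *)
Lemma form_off_chain n g : form_off n g + chain n g <= form_off n.+1 g.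
Proof.
rewrite /form_off /chain exprSr -!(mulrA _ (5 / 3)) -mulrDr ler_wpM2l ?exprn_ge0 ?divr_ge0 //.
rewrite [X in _ <= _ * X]big_mkcond sum_words_rcons mulr_sumr.
rewrite [X in X + _]big_mkcond [X in _ + X <= _]big_mkcond -big_split mulr_sumr /=.
rewrite ler_sum // => w _; case: (boolP (word12 w)) => hw /=.
  rewrite add0r ler_wpM2l ?divr_ge0 // sum3 !word12_rcons hw /= !addr0.
  rewrite /cell_form !sum3 sum3_neq0 !(pt_rcons_id hq).
  set a := g _; set b := g (pt q (rcons w 0) 1); set c := g _.
  have := sqr_ge0 (b - c); nra.
rewrite addr0; apply: le_trans (cell_form_refine hq g w) _.
by rewrite ler_wpM2l ?divr_ge0 // le_eqVlt; apply/orP; left; apply/eqP/eq_bigr => a _;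
  rewrite word12_rcons (negbTE hw).
Qed.

Lemma chain_ge0 n g : 0 <= chain n g.
Proof.
by rewrite mulr_ge0 ?exprn_ge0 ?divr_ge0 // sumr_ge0 // => w _; rewrite sumr_ge0 // => i _; exact: sqr_ge0.
Qed.

Lemma form_off_ge0 n g : 0 <= form_off n g.
Proof.
by rewrite mulr_ge0 ?exprn_ge0 ?divr_ge0 // sumr_ge0 // => w _; exact: cell_form_ge0.
Qed.

Lemma chain_le n g : chain n g <= form q n.+1 g g.
Proof.
apply: le_trans (form_off_le _ _); apply: le_trans (form_off_chain _ _).
by rewrite lerDr form_off_ge0.
Qed.

Lemma chain_cvg0 g K : (forall n, form q n g g <= K) -> chain n g @[n --> \oo] --> (0 : R).
Proof.
move=> hK.
have nd : nondecreasing_seq (fun n => form_off n g).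
  apply/nondecreasing_seqP => n; apply: le_trans (form_off_chain _ _).
  by rewrite lerDl chain_ge0.
have cv : cvgn (fun n => form_off n g).
  apply: nondecreasing_is_cvgn => //; exists K => _ [n _ <-].
  exact: le_trans (form_off_le _ _) _.
apply: (@squeeze_cvgr _ _ _ _ (fun=> 0) (fun n => form_off n.+1 g - form_off n g)).
- apply: nearW => n; rewrite chain_ge0 /= lerBrDl; exact: form_off_chain.
- exact: cvg_cst.
rewrite -(subrr (limn (fun n => form_off n g))); apply: cvgB => //.
by rewrite -(cvg_shiftS (fun n => form_off n g)) in cv *.
Qed.

End Chain.

(** * Eigenfunctions of the graph Laplacians *)

Definition restr (R : realType) (q : 'I_3 -> plane R) (m : nat) (u : plane R -> R)
  (x : plane R) : R := if `[< inner q m x >] then u x else 0.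

(* Eigenfunctions of [Delta_m], extended by zero off the interior vertices. *)
Definition deig (R : realType) (q : 'I_3 -> plane R) (m : nat) (l : R) (u : plane R -> R) : Prop :=
  (forall x, ~ inner q m x -> u x = 0) /\
  (forall x, inner q m x -> star q m (flux q u) x = l * u x).

(** Invariance under the reflections, read on words: by [reflw_pt], [R_w] sends [pt q (w ++ v) i] to
    the point on the left-hand side. *)
Definition symv (R : realType) (q : 'I_3 -> plane R) (m : nat) (u : plane R -> R) : Prop :=
  forall w v i, word12 w -> (size w + size v)%N = m ->
    u (pt q (w ++ negw v) (- i)) = u (pt q (w ++ v) i).

(** Vertices are counted once per incident cell, so the limit is three times the integral of [u v]
    ([mass_integral]). *)
Definition mass (R : realType) (q : 'I_3 -> plane R) (m : nat) (u v : plane R -> R) : R :=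
  3 ^- m * \sum_(w <- words m) \sum_i u (pt q w i) * v (pt q w i).

Section Discrete.
Variables (R : realType) (q : 'I_3 -> plane R).
Hypothesis hq : equilateral q.

Lemma restr_VOmega m u x : (forall x, bdOmega_at q m x -> u x = 0) ->
  VOmega q m x -> restr q m u x = u x.
Proof.
move=> hb hx; rewrite /restr; case: asboolP => // h.
by rewrite hb //; apply: contrapT => nb; apply: h.
Qed.

Lemma eq_star_flux m u v x : inner q m x ->
  (forall y, VOmega q m y -> u y = v y) -> star q m (flux q u) x = star q m (flux q v) x.
Proof.
move=> hx uv; apply: eq_star => w i sz xE; rewrite -xE -sz in hx.
have hw := inner_word hq hx.
by apply: eq_bigr => j _; rewrite !uv //; apply: VOmega_pt => //; rewrite (negbTE hw).
Qed.

Lemma deig_restr m l u : eigenfunction_at q m l u -> deig q m l (restr q m u).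
Proof.
move=> h; have [_ hb _] := h; split=> x hx; first by rewrite /restr; case: asboolP.
rewrite (@eq_star_flux _ _ u) //; last by move=> y; exact: restr_VOmega.
by rewrite (eigen_star hq h) // restr_VOmega //; case: hx.
Qed.

Lemma bary0_sym w v i : word12 w ->
  bary q 0 (pt q (w ++ negw v) (- i)) = bary q 0 (pt q (w ++ v) i).
Proof.
move=> hw; rewrite !pt_cat [LHS]bary0_word12 // [RHS]bary0_word12 // -(rfl_pt hq) (bary_rfl hq).
by rewrite oppr0.
Qed.

Lemma inner_sym m w v i : word12 w -> (size w + size v)%N = m.+1 ->
  inner q m.+1 (pt q (w ++ v) i) -> inner q m.+1 (pt q (w ++ negw v) (- i)).
Proof.
move=> hw sz; have hV v' j : size v' = size v -> Vset q m.+1 (pt q (w ++ v') j).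
  by move=> e; apply/Vset_pt; exists (w ++ v'), j; rewrite size_cat e.
move/(innerP hq (hV _ _ erefl)) => h; apply/innerP => //; first by apply: hV; rewrite size_negw.
by move: h; rewrite /bot bary0_sym.
Qed.

Lemma symv_restr (SG : set (plane R)) m u : attractor q SG ->
  (forall x, bdOmega_at q m.+1 x -> u x = 0) ->
  symmetric_at q SG m.+1 u -> symv q m.+1 (restr q m.+1 u).
Proof.
move=> hSG hb hs w v i hw sz; rewrite {2}/restr; case: asboolP => hi; last first.
  rewrite /restr; case: asboolP => // hi'; exfalso; apply: hi.
  by rewrite -(negwK v) -(opprK i); apply: inner_sym; rewrite ?size_negw.
rewrite restr_VOmega //; last by case: (inner_sym hw sz hi).
rewrite -(reflw_pt hq); apply: hs => //; split; last by case: hi.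
by rewrite pt_cat; exists (pt q v i) => //; exact: (SG_pt hq hSG).
Qed.

Section Eigen.
Variables (k : nat) (l : R) (u : plane R -> R).
Hypothesis hu : deig q k.+1 l u.

Lemma deig_word12 w i : size w = k.+1 -> word12 w -> u (pt q w i) = 0.
Proof.
move=> sz hw; apply: hu.1; rewrite -sz => /(inner_word hq).
by rewrite hw.
Qed.

Lemma deig_bdOmega x : bdOmega q x -> u x = 0.
Proof.
move=> hx; apply: hu.1 => -[[_ hL] hb]; case: hx => // hx.
by apply: hb; left.
Qed.

Lemma green_sum g : (forall x, bdOmega q x -> g x = 0) ->
  \sum_(w <- words k.+1) \sum_i g (pt q w i) * flux q u w i =
  l / 2 * (\sum_(w <- words k.+1) \sum_i u (pt q w i) * g (pt q w i)) -
  \sum_(v <- words k | word12 v) \sum_(i | i != 0) g (pt q (rcons v 0) i) * u (pt q v 0).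
Proof.
(* Half of the eigenvalue is charged to each of the two cells at an interior vertex, so that [H]
   sums to zero there. *)
move=> hg; pose H w i := flux q u w i - l / 2 * u (pt q w i).
(* [g1] drops the boundary layer, where [g] may be nonzero but the eigenvalue equation does not
   hold; [h2] computes the contribution of that layer. *)
pose g1 x := if bot q k.+1 x then 0 else g x.
have h1 : \sum_(w <- words k.+1) \sum_i g1 (pt q w i) * H w i = 0.
  apply: sum_star0 => // x hV; rewrite /g1; case: ifP => hb; first by rewrite mul0r.
  have [hi|hi] := pselect (inner q k.+1 x).
    rewrite /H star_add [X in _ + X](eq_star (G := fun _ _ => (- (l / 2) * u x))) => [|w i _ ->]; last by rewrite mulNr.
    rewrite star_const // hu.2 //.
    by rewrite (_ : l * u x + 2 * (- (l / 2) * u x) = 0) ?mulr0 //; field.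
  rewrite hg ?mul0r //; have tx : tri q x by case/Vset_pt: hV => w [i [_ ->]]; exact: pt_tri.
  have [b0|b0] := eqVneq (bary q 0 x) 0; first by right; apply/segLE.
  have [b1|b1] := eqVneq (bary q 0 x) 1; first by left; exact: bary_eq1.
  by exfalso; apply: hi; apply/innerP => //; rewrite b0 b1 hb.
have h2 : \sum_(w <- words k.+1) \sum_i (g (pt q w i) - g1 (pt q w i)) * H w i =
  - (\sum_(v <- words k | word12 v) \sum_(i | i != 0) g (pt q (rcons v 0) i) * u (pt q v 0)).
  rewrite sum_words_rcons [in RHS]big_mkcond -sumrN; apply: eq_words => v sz.
  rewrite /g1 !sum3 -sz !botE //; case: (boolP (word12 v)) => hv /=; rewrite ?subrr ?mul0r ?addr0 ?oppr0 //.
  have szr a : size (rcons v a) = k.+1 by rewrite size_rcons sz.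
  have z1 j : u (pt q (rcons v 1) j) = 0 by apply: deig_word12; rewrite ?word12_rcons ?hv.
  have z2 j : u (pt q (rcons v 2) j) = 0 by apply: deig_word12; rewrite ?word12_rcons ?hv.
  have z01 : u (pt q (rcons v 0) 1) = 0 by rewrite pt_rconsC.
  have z02 : u (pt q (rcons v 0) 2) = 0 by rewrite pt_rconsC.
  rewrite /H /flux !sum3 sum3_neq0 !z1 !z2 z01 z02 (pt_rcons_id hq).
  ring.
rewrite -h2 -[RHS]addr0 -[X in _ = _ + X]h1 mulr_sumr -!big_split /=; apply: eq_bigr => w _.
rewrite mulr_sumr -!big_split /=; apply: eq_bigr => i _; rewrite /H; ring.
Qed.

Hypothesis hsym : symv q k.+1 u.

Lemma symv_top w v : word12 w -> (size w + size v)%N = k ->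
  u (pt q (w ++ negw v) 0) = u (pt q (w ++ v) 0).
Proof.
move=> hw sz; have up y : pt q y 0 = pt q (y ++ [:: 0]) 0 by rewrite cats1 pt_rcons_id.
rewrite (up (w ++ negw v)) (up (w ++ v)) -!catA -[RHS](hsym 0 hw); last by rewrite size_cat addn1 addnS sz.
by rewrite /negw map_cat /= oppr0.
Qed.

(** Letters of [{1,2}] are equal or opposite, and the reflection in the cell of the common prefix
    negates the rest of the word; so words are matched letter by letter. *)
Lemma symv_const w v : size w = k -> size v = k -> word12 w -> word12 v ->
  u (pt q w 0) = u (pt q v 0).
Proof.
suff h n : forall x w v, size w = n -> size v = n -> (size x + n)%N = k ->
    word12 x -> word12 w -> word12 v -> u (pt q (x ++ w) 0) = u (pt q (x ++ v) 0).
  by move=> sw sv; exact: (h k [::] w v).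
elim: n => [|n IH] x [|a w'] [|b v'] //= [sw] [sv] sx hx.
rewrite !word12_cons => /andP [a0 hw] /andP [b0 hv].
have sx' c : (size (rcons x c) + n)%N = k by rewrite size_rcons addSn -addnS.
have ab : a = b \/ a = - b.
  by move: a0 b0; elim/ord3_ind: a; elim/ord3_ind: b => //= _ _; [left|right|right|left];
    apply: val_inj.
case: ab => [->|aE].
  by rewrite -!cat_rcons; apply: IH => //; rewrite word12_rcons hx.
rewrite -[LHS]symv_top //=; last by rewrite sw.
rewrite aE opprK -!cat_rcons; apply: IH => //; rewrite ?size_negw ?word12_negw //.
by rewrite word12_rcons hx.
Qed.

(** The common value on the layer just above the boundary layer ([atopE]); the word [1...1] is an
    arbitrary representative. *)
Definition atop : R := u (pt q (nseq k 1) 0).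

Lemma atopE v : size v = k -> word12 v -> u (pt q v 0) = atop.
Proof.
move=> sv hv; apply: symv_const => //; first by rewrite size_nseq.
by rewrite /word12 mem_nseq andbF.
Qed.

Lemma green g : (forall x, bdOmega q x -> g x = 0) ->
  form q k.+1 u g = 5 ^+ k.+1 * l / 2 * mass q k.+1 u g - (10 / 3) ^+ k.+1 * atop * gbar q k.+1 g.
Proof.
move=> hg; rewrite /form.
under eq_bigr do rewrite cell_form_flux.
rewrite green_sum // /mass gbarS.
have -> : \sum_(v <- words k | word12 v) \sum_(i | i != 0) g (pt q (rcons v 0) i) * u (pt q v 0) =
    atop * \sum_(v <- words k | word12 v) \sum_(i | i != 0) g (pt q (rcons v 0) i).
  rewrite mulr_sumr big_seq_cond [RHS]big_seq_cond; apply: eq_bigr => v.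
  rewrite mem_words => /andP [/eqP sv hv]; rewrite mulr_sumr; apply: eq_bigr => i _.
  by rewrite atopE // mulrC.
set A := \sum_(w <- _) _; set B := \sum_(w <- words k | _) _.
rewrite (_ : (10 / 3) ^+ k.+1 = (5 / 3) ^+ k.+1 * 2 ^+ k.+1 :> R); last first.
  by rewrite -exprMn; congr (_ ^+ _); field.
have e3 : (3 : R) ^+ k.+1 != 0 by rewrite expf_neq0.
have e2 : (2 : R) ^+ k.+1 != 0 by rewrite expf_neq0.
rewrite expr_div_n.
by move: e2 e3; set x := 2 ^+ k.+1; set y := 3 ^+ k.+1 => e2 e3; field; rewrite e2.
Qed.

Lemma form_deig : form q k.+1 u u = 5 ^+ k.+1 * l / 2 * mass q k.+1 u u.
Proof.
rewrite green //; last exact: deig_bdOmega.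
rewrite (_ : gbar q k.+1 u = 0) ?mulr0 ?subr0 // /gbar big_seq_cond big1 ?mulr0 // => w.
by rewrite mem_words => /andP [/eqP sw hw]; rewrite deig_word12.
Qed.

(** [u] has mean [atop] over layer [k] and vanishes on layer [k + 1], so [atop] is a difference of
    consecutive layer means. *)
Lemma atop_le : atop ^+ 2 <= (3 / 10) ^+ k.+1 * form q k.+1 u u.
Proof.
have -> : atop = gbar q k u - gbar q k.+1 u.
  rewrite [gbar q k.+1 u](_ : _ = 0).
    rewrite subr0 /gbar big_seq_cond (eq_bigr (fun _ => atop * 1)).
      rewrite -mulr_sumr -big_seq_cond count_word12 mulrCA mulVf ?mulr1 // expf_neq0.
    by move=> w; rewrite mem_words mulr1 => /andP [/eqP sw hw]; rewrite atopE.
  rewrite /gbar big_seq_cond big1 ?mulr0 // => w.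
  by rewrite mem_words => /andP [/eqP sw hw]; rewrite deig_word12.
apply: le_trans (gbar_chain q k u) _.
by rewrite ler_wpM2l ?exprn_ge0 ?divr_ge0 // chain_le.
Qed.

End Eigen.

Lemma mass_gt0 m u x : Vset q m x -> u x != 0 -> 0 < mass q m u u.
Proof.
case/Vset_pt => w [i [sz ->]] u0; rewrite pmulr_rgt0 ?invr_gt0 ?exprn_gt0 //.
have wm : w \in words m by rewrite mem_words sz.
rewrite (big_rem w wm) /= ltr_pwDl //.
  rewrite (bigD1 i) //= ltr_pwDl //; first by rewrite -expr2 exprn_even_gt0.
  by rewrite sumr_ge0 // => j _; rewrite -expr2 sqr_ge0.
by rewrite sumr_ge0 // => v _; rewrite sumr_ge0 // => j _; rewrite -expr2 sqr_ge0.
Qed.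

Lemma cell_form_sqr u w : cell_form q u u w = 3 * (\sum_i u (pt q w i) * u (pt q w i)) - (\sum_i u (pt q w i)) ^+ 2.
Proof. by rewrite /cell_form !sum3; field. Qed.

End Discrete.

(** * Ultralimits of eigenfunctions *)

Section Oscillation.
Variables (R : realType) (q : 'I_3 -> plane R) (SG : set (plane R)).
Hypotheses (hq : equilateral q) (hSG : attractor q SG).

(* [4 / 5] replaces the sharp ratio [sqrt (3 / 5)]. *)
Lemma edge_osc (u : plane R -> R) (C : R) m w i j : 0 <= C -> form q m u u <= C ^+ 2 ->
  (size w <= m)%N -> `|u (pt q w i) - u (pt q w j)| <= C * (4 / 5) ^+ size w.
Proof.
move=> C0 hC wm.
rewrite -(ler_pXn2r (n := 2)) ?nnegrE ?normr_ge0 ?mulr_ge0 ?exprn_ge0 ?divr_ge0 //.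
rewrite real_normK ?num_real // exprMn.
apply: le_trans (form_edge q u i j erefl) _.
apply: (@le_trans _ _ ((3 / 5) ^+ size w * C ^+ 2)).
  rewrite ler_wpM2l ?exprn_ge0 ?divr_ge0 //.
  by apply: le_trans hC; exact: form_incr.
rewrite mulrC ler_wpM2l ?sqr_ge0 // -exprM mulnC exprM.
rewrite lerXn2r ?nnegrE ?sqr_ge0 ?divr_ge0 //; lra.
Qed.

(** Move from corner to corner while descending along [v]; [5] is the sum of the geometric series of
    ratio [4/5]. *)
Lemma cell_osc (u : plane R -> R) (C : R) m w v i j : 0 <= C -> form q m u u <= C ^+ 2 ->
  (size w + size v <= m)%N ->
  `|u (pt q (w ++ v) i) - u (pt q w j)| <= 5 * C * (4 / 5) ^+ size w.
Proof.
move=> C0 hC; elim: v w i j => [|a v IH] w i j wm.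
  rewrite cats0; rewrite addn0 in wm; apply: le_trans (edge_osc i j C0 hC wm) _.
  rewrite ler_wpM2r ?exprn_ge0 ?divr_ge0 //; lra.
rewrite -cat_rcons.
have h1 := IH (rcons w a) i a; have h2 := @edge_osc u C m w a j C0 hC (leq_trans (leq_addr _ _) wm).
rewrite size_rcons (pt_rcons_id hq) addSn -addnS in h1.
apply: le_trans (ler_distD (u (pt q w a)) _ _) _.
apply: le_trans (lerD (h1 wm) h2) _.
rewrite exprSr; move: ((4 / 5) ^+ size w) => t; lra.
Qed.

(** The cell of [w] and the cell of the same level containing that of [w'] share [x], so they
    coincide or have a common corner. The detour through this corner costs one more edge: [5 + 1],
    rounded up to [10]. *)
Lemma point_osc (u : plane R -> R) (C : R) m w w' j x : 0 <= C -> form q m u u <= C ^+ 2 ->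
  size w' = m -> (size w <= m)%N -> cell q SG w x -> cell q SG w' x ->
  `|u (pt q w' 0) - u (pt q w j)| <= 10 * C * (4 / 5) ^+ size w.
Proof.
move=> C0 hC sw' wm [y hy yx] [y' hy' yx'].
have t0 : 0 <= C * (4 / 5) ^+ size w by rewrite mulr_ge0 ?exprn_ge0 ?divr_ge0.
pose w1 := take (size w) w'; pose v := drop (size w) w'.
have sz1 : size w1 = size w by rewrite size_take sw'; case: ltngtP wm.
have hv : w' = w1 ++ v by rewrite cat_take_drop.
have szv : (size w1 + size v <= m)%N by rewrite -size_cat -hv sw'.
have e : fword q w y = fword q w1 (fword q v y') by rewrite yx -fword_cat -hv yx'.
have := SG_corner hq hSG (esym sz1) hy (SG_fword hSG v hy') e.
case=> [ww|[i' [j' [_ ij]]]].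
  have := cell_osc 0 j C0 hC szv; rewrite -hv -ww => h; apply: le_trans h _.
  by rewrite -!mulrA ler_wpM2r // ler_nat.
have h1 := cell_osc 0 j' C0 hC szv; have h2 := edge_osc i' j C0 hC wm.
rewrite -ij -hv sz1 in h1.
apply: le_trans (ler_distD (u (pt q w i')) _ _) _.
apply: le_trans (lerD h1 h2) _.
by move: t0; rewrite -!(mulrA _ C); move: (C * _) => t; lra.
Qed.

Lemma pt_bounded (u : plane R -> R) (C : R) m w i : 0 <= C -> form q m u u <= C ^+ 2 ->
  u (q 0) = 0 -> (size w <= m)%N -> `|u (pt q w i)| <= 5 * C.
Proof.
move=> C0 hC u0 wm; have := @cell_osc u C m [::] w i 0 C0 hC wm.
by rewrite (_ : pt q [::] 0 = q 0) // u0 subr0 expr0 mulr1.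
Qed.

Lemma mass_osc (F : plane R -> R) n k (d : R) :
  (forall w v i, size w = n -> size v = k -> `|F (pt q (w ++ v) i) - F (pt q w i)| <= d) ->
  `|3 ^- (n + k) * (\sum_(w <- words (n + k)) \sum_i F (pt q w i)) -
    3 ^- n * (\sum_(w <- words n) \sum_i F (pt q w i))| <= 3 * d.
Proof.
move=> h.
have e3 p : (3 : R) ^+ p != 0 by rewrite expf_neq0.
have -> : 3 ^- n * (\sum_(w <- words n) \sum_i F (pt q w i)) =
    3 ^- (n + k) * (\sum_(w <- words n) \sum_(v <- words k) \sum_i F (pt q w i)).
  rewrite exprD invfM -mulrA !mulr_sumr; apply: eq_bigr => w _.
  by rewrite big_const_seq count_predT size_words iter_addr_0 -(mulr_natl _ (3 ^ k)) natrX mulKf.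
rewrite sum_words_cat -mulrBr -sumrB normrM ger0_norm ?invr_ge0 ?exprn_ge0 //.
apply: (@le_trans _ _ (3 ^- (n + k) * (\sum_(w <- words n) \sum_(v <- words k) (3 * d)))).
  rewrite ler_wpM2l ?invr_ge0 ?exprn_ge0 // (le_trans (ler_norm_sum _ _ _)) //.
  rewrite big_seq [leRHS]big_seq ler_sum // => w; rewrite mem_words => /eqP sw.
  rewrite -sumrB (le_trans (ler_norm_sum _ _ _)) //.
  rewrite big_seq [leRHS]big_seq ler_sum // => v; rewrite mem_words => /eqP sv.
  rewrite -sumrB (le_trans (ler_norm_sum _ _ _)) // sum3.
  by have := h w v 0 sw sv; have := h w v 1 sw sv; have := h w v 2 sw sv; lra.
rewrite big_const_seq count_predT iter_addr_0 size_words.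
rewrite big_const_seq count_predT iter_addr_0 size_words.
by rewrite -mulrnA mulnC -expnD -(mulr_natl _ (3 ^ (n + k))) natrX mulKf.
Qed.

Lemma mass_prod_osc (u g : plane R -> R) (C D : R) n m : 0 <= C -> 0 <= D ->
  form q m u u <= C ^+ 2 -> form q m g g <= D ^+ 2 -> u (q 0) = 0 -> g (q 0) = 0 ->
  (n <= m)%N -> `|mass q m u g - mass q n u g| <= 150 * (C * D) * (4 / 5) ^+ n.
Proof.
move=> C0 D0 hC hD u0 g0 nm.
have -> : 150 * (C * D) * (4 / 5) ^+ n = 3 * (50 * (C * D) * (4 / 5) ^+ n) by ring.
rewrite -{1}(subnKC nm); apply: (@mass_osc (fun x => u x * g x)) => w v i sw sv.
have sm : (size w + size v <= m)%N by rewrite sw sv subnKC.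
have sm' : (size w <= m)%N by rewrite sw.
have h1 := cell_osc i i C0 hC sm; have h2 := cell_osc i i D0 hD sm.
have h3 := pt_bounded i C0 hC u0 sm'.
have h4 : `|g (pt q (w ++ v) i)| <= 5 * D by apply: pt_bounded hD g0 _ => //; rewrite size_cat.
set x := u _ in h1 *; set y := u (pt q w i) in h1 h3 *.
set x' := g _ in h2 h4 *; set y' := g (pt q w i) in h2 *.
have -> : x * x' - y * y' = (x - y) * x' + y * (x' - y') by ring.
apply: le_trans (ler_normD _ _) _; rewrite !normrM.
have := ler_pM (normr_ge0 _) (normr_ge0 _) h1 h4.
have := ler_pM (normr_ge0 _) (normr_ge0 _) h3 h2.
rewrite sw; move: ((4 / 5) ^+ n) => t; lra.
Qed.

Lemma segL_pt12 w i : word12 w -> i != 0 -> bdOmega q (pt q w i).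
Proof. by move=> hw i0; right; apply/(segL_pt hq); rewrite hw. Qed.

Lemma gbar_le (g : plane R -> R) (C : R) n : 0 <= C -> form q n g g <= C ^+ 2 ->
  (forall x, bdOmega q x -> g x = 0) -> `|gbar q n g| <= C * (4 / 5) ^+ n.
Proof.
move=> C0 hC g0; rewrite /gbar normrM ger0_norm ?invr_ge0 ?exprn_ge0 //.
rewrite ler_pdivrMl ?exprn_gt0 // -count_word12 mulr_suml.
apply: le_trans (ler_norm_sum _ _ _) _.
rewrite big_seq_cond [leRHS]big_seq_cond ler_sum // => w.
rewrite mem_words => /andP [/eqP sw hw]; rewrite mul1r -sw.
rewrite -{1}[g _]subr0 -(g0 (pt q w 1)); last exact: segL_pt12.
by apply: (edge_osc _ _ C0 hC); rewrite sw.
Qed.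

(** Bounded chain energies would give only [O((3/10)^n)]. They tend to zero, which improves this to
    [o((3/10)^n)], as the boundary term of Green's formula demands. *)
Lemma gbar_decay (g : plane R -> R) (C e : R) : 0 <= C -> (forall n, form q n g g <= C ^+ 2) ->
  (forall x, bdOmega q x -> g x = 0) -> 0 < e ->
  exists N, forall n, (N <= n)%N -> gbar q n g ^+ 2 <= e * (3 / 10) ^+ n.
Proof.
move=> C0 hC g0 e0; pose r : R := Num.sqrt (3 / 10).
have r0 : 0 <= r by exact: sqrtr_ge0.
have r2 : r ^+ 2 = 3 / 10 by rewrite sqr_sqrtr // divr_ge0.
have r23 : r <= 2 / 3.
  by rewrite -(ler_pXn2r (n := 2)) ?nnegrE ?divr_ge0 // r2; lra.
have d0 : 0 < e / 4 by rewrite divr_gt0.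
have /cvgrPdist_le /(_ _ d0) [N _ hN] := chain_cvg0 hq hC.
exists N => n Nn.
pose d := Num.sqrt (e / 4).
have d2 : d ^+ 2 = e / 4 by rewrite sqr_sqrtr // ltW.
have dd : 0 <= d by exact: sqrtr_ge0.
have step j : (n <= j)%N -> `|gbar q j g - gbar q j.+1 g| <= d * r ^+ j.+1.
  move=> nj; rewrite -(ler_pXn2r (n := 2)) ?nnegrE ?mulr_ge0 ?exprn_ge0 //.
  rewrite real_normK ?num_real // exprMn d2 -exprM mulnC exprM r2.
  apply: le_trans (gbar_chain q j g) _; rewrite mulrC ler_wpM2r ?exprn_ge0 ?divr_ge0 //.
  have := hN j (leq_trans Nn nj); rewrite sub0r normrN ger0_norm //.
  exact: chain_ge0.
(* The factor 2 absorbs the geometric series: [r / (1 - r) <= 2] because [r <= 2/3]. The choice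
   [d^2 = e / 4] turns [(2 d)^2] into [e]. *)
have tel k : `|gbar q n g| <= 2 * d * (r ^+ n - r ^+ (n + k)) + `|gbar q (n + k) g|.
  elim: k => [|k IH]; first by rewrite addn0 subrr mulr0 add0r.
  apply: le_trans IH _; rewrite addnS.
  have := step (n + k)%N (leq_addr _ _).
  have := ler_normD (gbar q (n + k) g - gbar q (n + k).+1 g) (gbar q (n + k).+1 g).
  rewrite subrK exprSr => h1 h2.
  have : 0 <= d * r ^+ (n + k) * (2 / 3 - r) by rewrite !mulr_ge0 ?exprn_ge0 // subr_ge0.
  move: (r ^+ (n + k)) h2 => t h2 h3; nra.
have : `|gbar q n g| <= 2 * d * r ^+ n.
  apply/ler_addgt0Pl => z z0.
  have t45 : 0 <= (4 / 5 : R) < 1 by rewrite divr_ge0 //= ltr_pdivrMr ?mul1r ?ltr_nat.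
  have [p hp] := geometric_small C t45 z0.
  apply: le_trans (tel p) _; rewrite addrC lerD //.
    apply: le_trans (gbar_le C0 (hC _) g0) _; apply/ltW/hp; exact: leq_addl.
  by rewrite ler_wpM2l ?mulr_ge0 // gerBl exprn_ge0.
rewrite -(ler_pXn2r (n := 2)) ?nnegrE ?mulr_ge0 ?exprn_ge0 //.
rewrite real_normK ?num_real // [(_ * r ^+ n) ^+ 2]exprMn [(2 * d) ^+ 2]exprMn d2 -exprM mulnC exprM r2.
by rewrite (_ : 2 ^+ 2 * (e / 4) = e) //; field.
Qed.

End Oscillation.

Lemma ultra_fmap (S T : Type) (f : S -> T) (F : set_system S) :
  UltraFilter F -> UltraFilter (f x @[x --> F]).
Proof.
move=> UF; split; first exact: fmap_proper_filter.
move=> G PG FG; apply/seteqP; split=> [A GA|]; last by [].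
have [//|FA] := in_ultra_setVsetC (f @^-1` A) UF.
have GA' : G (~` A) by apply: FG.
have : G set0 by rewrite -(setICr A); exact: filterI.
by move/filter_not_empty.
Qed.

Section UltraLimit.
Variables (R : realType) (q : 'I_3 -> plane R) (SG : set (plane R)).
Hypotheses (hq : equilateral q) (hSG : attractor q SG).
Variables (us : nat -> plane R -> R) (M : nat) (C : R).
Hypotheses (C0 : 0 <= C)
  (hC : forall m, (M <= m)%N -> form q m (us m) (us m) <= C ^+ 2)
  (h0 : forall m, (M <= m)%N -> us m (q 0) = 0).
Variable (U : set_system nat).
Context (UU : UltraFilter U).
Hypothesis Uoo : \oo `<=` U.

Let UP : ProperFilter U := @ultra_proper _ _ UU.
#[local] Existing Instance UP.

Lemma ultra_near (P : nat -> Prop) N : (forall m, (N <= m)%N -> P m) -> \forall m \near U, P m.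
Proof. by move=> h; apply: Uoo; exists N. Qed.

Lemma ultra_le (a : nat -> R) (L c : R) : a m @[m --> U] --> L ->
  (\forall m \near U, a m <= c) -> L <= c.
Proof. by move=> h1 h2; apply: (closed_cvg (fun x => x <= c)) h1 => //; exact: closed_le. Qed.

Lemma ultra_cvg (a : nat -> R) (B : R) N :
  (forall m, (N <= m)%N -> `|a m| <= B) -> a m @[m --> U] --> lim (a m @[m --> U]).
Proof.
move=> h; have := segment_compact (a := - B) (b := B); rewrite compact_ultra => hc.
have Ua : (a m @[m --> U]) `[- B, B]%classic.
  by apply: (ultra_near (N := N)) => m /h; rewrite /= in_itv /= ler_norml.
have UF : UltraFilter (a m @[m --> U]) by exact: ultra_fmap.
have [p [_ hp]] := hc _ UF Ua.
by rewrite (cvg_lim _ hp).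
Qed.

Lemma ultra_uniq (a b : nat -> R) (L L' : R) : a m @[m --> U] --> L -> b m @[m --> U] --> L' ->
  (\forall m \near U, a m = b m) -> L = L'.
Proof.
move=> h h' ab; apply: (cvg_unique (@norm_hausdorff _ _) h); apply: cvg_trans h'.
by apply: near_eq_cvg; apply: filterS ab => m ->.
Qed.

Definition wd (m : nat) (x : plane R) : seq 'I_3 :=
  xget [::] [set w | size w = m /\ cell q SG w x].

Lemma wdP m x : SG x -> size (wd m x) = m /\ cell q SG (wd m x) x.
Proof.
move=> hx; apply: (xgetPex [::] (P := [set w | size w = m /\ cell q SG w x])).
have [w [y [sw hy ->]]] := SG_cell hSG m hx; exists w; split=> //.
by exists y.
Qed.

(** [us m] is controlled only at vertices of level at most [m], so [x] is replaced by a corner of a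
    cell of level [m] containing it. The default value 0 off [SG] agrees with the boundary
    condition, which is imposed on a subset of the plane. *)
Definition ulim (x : plane R) : R :=
  if `[< SG x >] then lim (us m (pt q (wd m x) 0) @[m --> U]) else 0.

Lemma ulimP x : SG x -> us m (pt q (wd m x) 0) @[m --> U] --> ulim x.
Proof.
move=> hx; rewrite /ulim asboolT //; apply: (@ultra_cvg _ (5 * C) M) => m Mm.
by have [sw _] := wdP m hx; apply: (pt_bounded hq 0 C0 (hC Mm) (h0 Mm)); rewrite sw.
Qed.

Lemma ulim_pt w i : us m (pt q w i) @[m --> U] --> ulim (pt q w i).
Proof.
have hx := SG_pt hq hSG w i; set x := pt q w i.
have h : us m x - us m (pt q (wd m x) 0) @[m --> U] --> (0 : R).
  apply/cvgrPdist_lt => e e0.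
  have t45 : 0 <= (4 / 5 : R) < 1 by rewrite divr_ge0 //= ltr_pdivrMr ?mul1r ?ltr_nat.
  have [N hN] := geometric_small (10 * C) t45 e0.
  apply: (ultra_near (N := maxn (maxn M N) (size w))) => m; rewrite !geq_max => /andP [/andP [Mm Nm] wm].
  rewrite sub0r normrN distrC; apply: le_lt_trans (hN m Nm).
  have [sw hw] := wdP m hx; pose w' := w ++ nseq (m - size w) i.
  have xw' : x = pt q w' i by rewrite pt_cat /pt fword_nseq.
  have sw' : size w' = m by rewrite size_cat size_nseq subnKC.
  have hw' : cell q SG w' x by exists (q i); [exact: (SG_q hq hSG)|rewrite xw'].
  have wm' : (size w' <= m)%N by rewrite sw'.
  have := point_osc hq hSG i C0 (hC Mm) sw wm' hw' hw.
  by rewrite -xw' sw'.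
rewrite -[ulim x]add0r.
have -> : (fun m => us m x) = (fun m => (us m x - us m (pt q (wd m x) 0)) + us m (pt q (wd m x) 0)).
  by apply/funext => m; rewrite subrK.
by apply: cvgD => //; exact: ulimP.
Qed.

Lemma ulim_osc w j x : cell q SG w x -> `|ulim x - ulim (pt q w j)| <= 10 * C * (4 / 5) ^+ size w.
Proof.
move=> hwx; have hx : SG x by case: hwx => y hy <-; exact: SG_fword.
have h : `|us m (pt q (wd m x) 0) - us m (pt q w j)| @[m --> U] --> `|ulim x - ulim (pt q w j)|.
  by apply: cvg_norm; apply: cvgB; [exact: ulimP|exact: ulim_pt].
apply: ultra_le h _.
apply: (ultra_near (N := maxn M (size w))) => m; rewrite geq_max => /andP [Mm wm].
by have [sw hw] := wdP m hx; exact: (point_osc hq hSG j C0 (hC Mm) sw wm hwx hw).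
Qed.

Lemma sum_cvg (I : Type) (s : seq I) (F : I -> nat -> R) (L : I -> R) :
  (forall i, F i m @[m --> U] --> L i) ->
  (\sum_(i <- s) F i m) @[m --> U] --> \sum_(i <- s) L i.
Proof. by move=> h; apply: cvg_big => //; exact: add_continuous. Qed.

Lemma form_ulim n (v : nat -> plane R -> R) v' : (forall w i, v m (pt q w i) @[m --> U] --> v' (pt q w i)) ->
  form q n (us m) (v m) @[m --> U] --> form q n ulim v'.
Proof.
move=> h; apply: cvgM; first exact: cvg_cst.
apply: sum_cvg => w; apply: cvgM; first exact: cvg_cst.
apply: sum_cvg => i; apply: sum_cvg => j; apply: cvgM; apply: cvgB; try exact: h; exact: ulim_pt.
Qed.

Lemma mass_ulim n (v : nat -> plane R -> R) v' : (forall w i, v m (pt q w i) @[m --> U] --> v' (pt q w i)) ->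
  mass q n (us m) (v m) @[m --> U] --> mass q n ulim v'.
Proof.
move=> h; apply: cvgM; first exact: cvg_cst.
apply: sum_cvg => w; apply: sum_cvg => i; apply: cvgM; [exact: ulim_pt|exact: h].
Qed.

Lemma form_ulim_le n : form q n ulim ulim <= C ^+ 2.
Proof.
apply: ultra_le (@form_ulim n us _ (@ulim_pt)) _.
apply: (ultra_near (N := maxn M n)) => m; rewrite geq_max => /andP [Mm nm].
by apply: le_trans (hC Mm); exact: form_incr.
Qed.

Lemma ulim_q0 : ulim (q 0) = 0.
Proof.
apply: (@ultra_uniq _ (fun _ => 0) _ _ (@ulim_pt [::] 0) (cvg_cst _)).
by apply: (ultra_near (N := M)) => m /h0.
Qed.

Lemma ulim_segL : (forall m x, (M <= m)%N -> segL q x -> us m x = 0) ->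
  forall x, segL q x -> ulim x = 0.
Proof.
move=> hL x hx; have [hS|hS] := pselect (SG x); last by rewrite /ulim asboolF.
apply/eqP; rewrite -normr_le0; apply/ler_addgt0Pl => e e0; rewrite addr0.
have t45 : 0 <= (4 / 5 : R) < 1 by rewrite divr_ge0 //= ltr_pdivrMr ?mul1r ?ltr_nat.
have [N /(_ N (leqnn N)) hN] := geometric_small (10 * C) t45 e0.
have [w [y [sw hy xE]]] := SG_cell hSG N hS.
have hw : word12 w.
  have [_ /eqP] := (segLE hq x).1 hx; rewrite xE (bary0_eq0 hq w (SG_tri hq hSG hy)).
  by case/andP.
have hcell : cell q SG w x by exists y.
have := ulim_osc 1 hcell; rewrite sw.
have -> : ulim (pt q w 1) = 0.
  apply: (@ultra_uniq _ (fun _ => 0) _ _ (@ulim_pt w 1) (cvg_cst _)).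
  apply: (ultra_near (N := M)) => m Mm; apply: hL => //.
  by apply/segL_pt => //; rewrite hw.
rewrite subr0 => h; apply: le_trans h _; exact: ltW.
Qed.

Lemma ulim_sym : (forall m, (M <= m)%N -> symv q m (us m)) -> symmetric_primitive q SG ulim.
Proof.
move=> hs w hw x [y hy <-]; rewrite (reflw_fword hq).
apply/eqP; rewrite -subr_eq0 -normr_le0; apply/ler_addgt0Pl => e e0; rewrite addr0.
have t45 : 0 <= (4 / 5 : R) < 1 by rewrite divr_ge0 //= ltr_pdivrMr ?mul1r ?ltr_nat.
have [N /(_ _ (leq_addl _ _)) hN] := geometric_small (20 * C) t45 e0.
have [v [z [sv hz yE]]] := SG_cell hSG N hy.
have h1 : cell q SG (w ++ v) (fword q w y) by exists z; rewrite // fword_cat yE.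
have h2 : cell q SG (w ++ negw v) (fword q w (reflw q [::] y)).
  exists (reflw q [::] z); first exact: (SG_rfl hq hSG).
  by rewrite fword_cat -(rfl_fword hq) yE.
have e1 := ulim_osc 0 h1; have e2 := ulim_osc 0 h2.
have e3 : ulim (pt q (w ++ negw v) 0) = ulim (pt q (w ++ v) 0).
  apply: (ultra_uniq (@ulim_pt (w ++ negw v) 0) (@ulim_pt (w ++ v) 0)).
  apply: (ultra_near (N := maxn M (size w + size v))) => m; rewrite geq_max => /andP [Mm wm].
  (* [symv] concerns words of total length [m]; padding with zeros reaches this length without
     moving the top corner, and negation fixes 0. *)
  have ext v' :
      pt q (w ++ v') 0 = pt q (w ++ v' ++ nseq (m - (size w + size v)) 0) 0.
    by rewrite catA [RHS]pt_cat /pt fword_nseq.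
  rewrite (ext v) (ext (negw v)).
  rewrite -(hs m Mm w (v ++ nseq _ 0)) //; last first.
    by rewrite size_cat size_nseq addnA subnKC.
  by rewrite oppr0 /negw map_cat map_nseq oppr0.
rewrite !size_cat size_negw sv in e1 e2.
apply: (le_trans _ (ltW (hN (size w)))); rewrite e3 distrC in e2.
apply: le_trans (ler_distD (ulim (pt q (w ++ v) 0)) _ _) _.
rewrite distrC [X in _ + X]distrC.
apply: le_trans (lerD e2 e1) _; lra.
Qed.

Lemma fword_continuous w : continuous (fword q w).
Proof.
elim: w => [|a w IH] x; first exact: cvg_id.
rewrite /= /ifs; apply: cvgZr; apply: cvgD; [exact: IH|exact: cvg_cst].
Qed.

Lemma cell_closed w : closed (cell q SG w).
Proof.
apply: compact_closed; first exact: norm_hausdorff.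
have [hc _ _] := hSG; apply: continuous_compact => //.
by apply: continuous_subspaceT => x; exact: fword_continuous.
Qed.

Lemma ulim_continuous : {within SG, continuous ulim}.
Proof.
apply/subspace_continuousP => x hx; apply/cvgrPdist_lt => e e0.
have t45 : 0 <= (4 / 5 : R) < 1 by rewrite divr_ge0 //= ltr_pdivrMr ?mul1r ?ltr_nat.
have [n /(_ n (leqnn n)) hn] := geometric_small (20 * C) t45 e0.
(* The cells of level [n] that miss [x] form a closed set, so every point of [SG] close to [x] lies
   in a cell of level [n] containing [x]. *)
pose F := \bigcup_(w in [set` [seq w <- words n | ~~ `[< cell q SG w x >]]]) cell q SG w.
have cF : closed F.
  by apply: closed_bigcup => [|w _]; [exact: finite_seq|exact: cell_closed].
have nF : ~ F x.
  by move=> [w /=]; rewrite mem_filter => /andP [/asboolP].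
have oF : open (~` F) by exact: closed_openC.
have /= hN : \forall y \near x, ~ F y by apply: open_nbhs_nbhs.
rewrite near_withinE; apply: filterS hN => y yF hy.
have [w [z [sw hz yE]]] := SG_cell hSG n hy.
have wy : cell q SG w y by exists z.
have wx : cell q SG w x.
  apply: contrapT => h; apply: yF; exists w => //=.
  by rewrite mem_filter mem_words sw eqxx andbT; apply/asboolP.
have h1 := ulim_osc 0 wx; have h2 := ulim_osc 0 wy; rewrite sw in h1 h2.
apply: le_lt_trans hn; rewrite distrC in h2.
apply: le_trans (ler_distD (ulim (pt q w 0)) _ _) _.
apply: le_trans (lerD h1 h2) _; lra.
Qed.

End UltraLimit.

(** * Riemann sums for the self-similar measure *)

Section RiemannSums.
Variables (R : realType) (q : 'I_3 -> plane R) (SG : set (plane R))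
  (mu : probability (borel_plane R) R).
Hypotheses (hq : equilateral q) (hSG : attractor q SG) (hmu : self_similar q SG mu).

Notation meas A := (measurable (A : set (borel_plane R))).

Lemma closed_meas (A : set (plane R)) : closed A -> meas A.
Proof.
move=> cA; rewrite -[A]setCK; apply: measurableC.
by apply: sub_sigma_algebra; exact: closed_openC.
Qed.

Lemma SG_meas : meas SG.
Proof.
have -> : SG = cell q SG [::] by apply/seteqP; split=> [x hx|_ [x hx <-]] //; exists x.
by apply: closed_meas; exact: (cell_closed hSG).
Qed.

Lemma cell_meas w : meas (cell q SG w).
Proof. by apply: closed_meas; exact: (cell_closed hSG). Qed.

Variable f : plane R -> R.
Hypothesis cf : {within SG, continuous f}.

Lemma within_meas : measurable_fun (SG : set (borel_plane R)) f.
Proof.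
apply: (measurability _ (measurable_realfun.RGenOpens.measurableE R)).
move=> _ [_ [a [b ->] <-]].
have /continuousP cf' := cf.
have /open_subspaceP [V oV VD] : open (f @^-1` `]a, b[ : set (subspace SG)) by exact/cf'/interval_open.
rewrite setIC -VD; apply: measurableI; [exact: sub_sigma_algebra|exact: SG_meas].
Qed.

Hypothesis f0 : forall x, bdOmega q x -> f x = 0.
Variables (n : nat) (j : 'I_3) (d B : R).
Hypothesis hd : forall w x, size w = n -> cell q SG w x -> `|f x - f (pt q w j)| <= d.
Hypothesis hB : forall x, SG x -> `|f x| <= B.

Lemma SG_integrable (A : set (borel_plane R)) : measurable A -> A `<=` SG ->
  mu.-integrable A (EFin \o f).
Proof.
move=> mA AS; apply: measurable_bounded_integrable => //.
- by apply: (le_lt_trans (probability_le1 mu mA)); exact: ltry.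
- by apply: measurable_funS AS _; [exact: SG_meas|exact: within_meas].
- exists B; split; first exact: num_real.
  by move=> y By x Ax; apply: le_trans (ltW By); apply: hB; exact: AS.
Qed.

Lemma piece_integral (A : set (borel_plane R)) w : size w = n -> measurable A -> A `<=` cell q SG w ->
  `|\int[mu]_(x in A) f x - fine (mu A) * f (pt q w j)| <= d * fine (mu A).
Proof.
move=> sw mA Aw.
have AS : A `<=` SG by move=> x /Aw [y hy <-]; exact: SG_fword.
have muA : (mu A < +oo)%E by apply: (le_lt_trans (probability_le1 mu mA)); exact: ltry.
have ic (c : R) : mu.-integrable A (EFin \o (fun=> c)) by exact: finite_measure_integrable_cst.
rewrite mulrC -Rintegral_cst // -RintegralB //; last exact: SG_integrable.
apply: le_trans (le_normr_Rintegral _ _) _ => //.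
  apply: (@eq_integrable _ _ _ mu A _ ((EFin \o f) \- (EFin \o (fun=> f (pt q w j))))%E) => //.
  by apply: integrableB => //; exact: SG_integrable.
rewrite -(Rintegral_cst mu mA); apply: le_Rintegral => //.
  apply: (@eq_integrable _ _ _ mu A _ (abse \o ((EFin \o f) \- (EFin \o (fun=> f (pt q w j)))))%E) => //.
  by apply: integrable_abse; apply: integrableB => //; exact: SG_integrable.
by move=> x /Aw; exact: hd.
Qed.

Definition ucells (s : seq (seq 'I_3)) : set (borel_plane R) := \big[setU/set0]_(w <- s) cell q SG w.

Lemma ucells_meas s : measurable (ucells s).
Proof. by apply: bigsetU_measurable => w _; exact: cell_meas. Qed.

(** Cells overlap at vertices, and the measure of the overlaps is not computed. Removing from each
    cell those that follow it in the list makes the pieces disjoint, with weights [t w] of which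
    only an upper bound is recorded. *)
Lemma ucells_integral s : uniq s -> (forall w, w \in s -> size w = n) ->
  exists t : seq 'I_3 -> R, [/\ forall w, w \in s -> t w <= 3 ^- n,
    fine (mu (ucells s)) = \sum_(w <- s) t w &
    `|\int[mu]_(x in ucells s) f x - \sum_(w <- s) t w * f (pt q w j)| <= d * fine (mu (ucells s))].
Proof.
elim: s => [|w s IH].
  exists (fun=> 0); split=> //; rewrite /ucells !big_nil ?measure0 ?Rintegral_set0 //=.
  by rewrite subrr normr0 mulr0.
rewrite /= => /andP [ws us] hs.
have [|t [t1 t2 t3]] := IH us; first by move=> v vs; apply: hs; rewrite inE vs orbT.
have sw : size w = n by apply: hs; rewrite inE eqxx.
pose P : set (borel_plane R) := cell q SG w `\` ucells s.
have mP : measurable P by apply: measurableD; [exact: cell_meas|exact: ucells_meas].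
have fin (A : set (borel_plane R)) : measurable A -> mu A \is a fin_num by move=> mA; exact: fin_num_measure.
have PU : P `&` ucells s = set0 by rewrite /P setDE -setIA setICl setI0.
have eU : ucells (w :: s) = P `|` ucells s.
  rewrite {1}/ucells big_cons -/(ucells s) /P; apply/seteqP; split=> x.
    by case=> [wx|]; [have [?|?] := pselect (ucells s x); [right|left]|right].
  by case=> [[wx _]|]; [left|right].
have muE : fine (mu (ucells (w :: s))) = fine (mu P) + fine (mu (ucells s)).
  have h := measureU mu mP (ucells_meas s) PU.
  by rewrite eU [mu _]h fineD // fin //; exact: ucells_meas.
have tE v : v \in s -> (v == w) = false.
  by move=> vs; apply/negbTE; apply: contraNneq ws => <-.
exists (fun v => if v == w then fine (mu P) else t v); split.
- move=> v; rewrite inE; case: (eqVneq v w) => [_ _|_ /= vs]; last exact: t1.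
  rewrite -lee_fin fineK ?fin // -sw -hmu.
  by apply: le_measure; rewrite ?inE //; [exact: cell_meas|exact: subDsetl].
- rewrite big_cons eqxx muE t2; congr (_ + _); apply: eq_big_seq => v vs.
  by rewrite tE.
rewrite big_cons eqxx muE mulrDr.
have -> : \sum_(v <- s) (if v == w then fine (mu P) else t v) * f (pt q v j) =
  \sum_(v <- s) t v * f (pt q v j) by apply: eq_big_seq => v vs; rewrite tE.
have hP := piece_integral sw mP (@subDsetl _ _ _).
rewrite eU Rintegral_setU //; [|exact: ucells_meas| |by apply/eqP]; last first.
  apply: SG_integrable; first by rewrite -eU; exact: ucells_meas.
  move=> x; rewrite -eU /ucells -bigcup_seq => -[v _ [y hy <-]]; exact: SG_fword.
rewrite opprD addrACA; apply: le_trans (ler_normD _ _) _.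
by apply: lerD.
Qed.

Lemma riemann_sum : `|\int[mu]_(x in Omega q SG) f x - 3 ^- n * (\sum_(w <- words n) f (pt q w j))| <= d.
Proof.
have [t [t1 t2 t3]] := ucells_integral (uniq_words n) (fun w h => eqP (etrans (esym (mem_words n w)) h)).
have uE : ucells (words n) = SG.
  rewrite /ucells -bigcup_seq; apply/seteqP; split=> x.
    by move=> [v _ [y hy <-]]; exact: SG_fword.
  move=> hx; have [w [y [sw hy ->]]] := SG_cell hSG n hx.
  by exists w; [rewrite /= mem_words sw|exists y].
have mS : fine (mu SG) = 1.
  have := hmu [::]; rewrite (_ : cell q SG [::] = SG) => [->|]; first by rewrite expr0 invr1.
  by apply/seteqP; split=> [_ [x hx <-]|x hx] //; exists x.
(* The [3^n] weights are at most [3^-n] each and add up to the total mass 1, so each of them equals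
   [3^-n]. *)
have tE w : w \in words n -> t w = 3 ^- n.
  move=> hw; apply/eqP; rewrite eq_le t1 //=; rewrite leNgt; apply/negP => lt.
  move: t2; rewrite uE mS (big_rem w hw) /= => e.
  have : t w + \sum_(v <- rem w (words n)) t v < 3 ^- n + \sum_(v <- rem w (words n)) 3 ^- n.
    rewrite ltr_leD // big_seq [leRHS]big_seq ler_sum // => v /mem_rem; exact: t1.
  have : \sum_(v <- words n) (3 ^- n : R) = 1.
    rewrite big_const_seq count_predT iter_addr_0 size_words.
    by rewrite -(mulr_natl _ (3 ^ n)) natrX mulfV // expf_neq0.
  by rewrite (big_rem w hw) /= -e => ->; rewrite ltxx.
rewrite uE mS mulr1 in t3.
have -> : \int[mu]_(x in Omega q SG) f x = \int[mu]_(x in SG) f x.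
  rewrite Rintegral_mkcond [RHS]Rintegral_mkcond; apply: eq_Rintegral => x _.
  rewrite !patchE; case: (boolP (x \in SG)) => hx.
    case: ifPn => // hO; rewrite f0 //; apply: contrapT => hb; move/negP: hO; apply.
    by apply/mem_set; split=> //; exact/set_mem.
  by case: ifPn => // /set_mem [/mem_set hx']; rewrite hx' in hx.
rewrite (_ : 3 ^- n * _ = \sum_(w <- words n) t w * f (pt q w j)) //.
by rewrite mulr_sumr; apply: eq_big_seq => w hw; rewrite tE.
Qed.

End RiemannSums.

(** * Passage to the limit in the weak eigenvalue equation *)

Lemma four_fifths_lt1 (R : realType) : 0 <= (4 / 5 : R) < 1.
Proof. by rewrite divr_ge0 //= ltr_pdivrMr ?mul1r ?ltr_nat. Qed.

Lemma squeeze_geometric (R : realType) (a : nat -> R) (L B : R) :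
  (forall n, `|a n - L| <= B * (4 / 5) ^+ n) -> a n @[n --> \oo] --> L.
Proof.
move=> h; apply/cvgrPdist_lt => e e0; have [N hN] := geometric_small B (four_fifths_lt1 R) e0.
by exists N => // n /= Nn; rewrite distrC; exact: le_lt_trans (h n) (hN n Nn).
Qed.

Lemma sqr_ub (R : realType) (x : R) : 0 <= x -> x <= (x + 1) ^+ 2.
Proof. by move=> x0; nra. Qed.

Section Weak.
Variables (R : realType) (q : 'I_3 -> plane R) (SG : set (plane R))
  (mu : probability (borel_plane R) R).
Hypotheses (hq : equilateral q) (hSG : attractor q SG) (hmu : self_similar q SG mu).

Lemma cell_osc_closure (v : plane R -> R) (D : R) w j x : 0 <= D ->
  {within SG, continuous v} -> (forall n, form q n v v <= D ^+ 2) ->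
  cell q SG w x -> `|v x - v (pt q w j)| <= 5 * D * (4 / 5) ^+ size w.
Proof.
move=> D0 cv hD [y hy yx]; apply/ler_addgt0Pl => e e0.
have hx : SG x by rewrite -yx; exact: SG_fword.
have /subspace_continuousP /(_ x hx) /cvgrPdist_le /(_ e e0) := cv.
rewrite near_withinE => /nbhs_ballP [r /= r0 hr].
have [B hB] := tri_bounded hq.
have t2 : 0 <= (2^-1 : R) < 1 by rewrite invr_ge0 ler0n invf_lt1 // ltr1n.
have [k /(_ _ (leq_addl (size w) k)) hk] := geometric_small (B + B) t2 r0.
have [v' [z [sv hz yE]]] := SG_cell hSG k hy.
have hdist : `|v x - v (pt q (w ++ v') 0)| <= e.
  apply: hr; last exact: (SG_pt hq hSG).
  rewrite -ball_normE /=; apply: le_lt_trans hk.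
  rewrite -yx yE -fword_cat fwordB size_cat sv normrZ ger0_norm ?invr_ge0 ?exprn_ge0 //.
  rewrite exprVn mulrC ler_wpM2r ?invr_ge0 ?exprn_ge0 // (le_trans (ler_normB _ _)) //.
  by rewrite lerD // hB //; [exact: (SG_tri hq hSG)|exact: tri_q].
apply: le_trans (ler_distD (v (pt q (w ++ v') 0)) _ _) _.
apply: lerD => //; exact: (cell_osc hq 0 j D0 (hD (size w + size v')%N)).
Qed.

(** [mass] is the sum of three Riemann sums, one for each choice of corner in the cells; hence the
    factor 3. *)
Lemma mass_integral (u v : plane R -> R) (C D : R) : 0 <= C -> 0 <= D ->
  {within SG, continuous u} -> {within SG, continuous v} ->
  (forall n, form q n u u <= C ^+ 2) -> (forall n, form q n v v <= D ^+ 2) ->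
  (forall x, bdOmega q x -> u x = 0) -> (forall x, bdOmega q x -> v x = 0) ->
  mass q n u v @[n --> \oo] --> 3 * \int[mu]_(x in Omega q SG) (u x * v x).
Proof.
move=> C0 D0 cu cv hC hD u0 v0.
have c0 x : SG x -> cell q SG [::] x by move=> hx; exists x.
have bd g (B : R) : 0 <= B -> {within SG, continuous g} -> (forall n, form q n g g <= B ^+ 2) ->
    g (q 0) = 0 -> forall x, SG x -> `|g x| <= 5 * B.
  move=> B0 cg hB g0 x /c0 /(cell_osc_closure 0 B0 cg hB).
  by rewrite (_ : pt q [::] 0 = q 0) // g0 subr0 expr0 mulr1.
have q0 : bdOmega q (q 0) by left.
have bu := bd u C C0 cu hC (u0 _ q0); have bv := bd v D D0 cv hD (v0 _ q0).
apply: (@squeeze_geometric _ _ _ (3 * (50 * (C * D)))) => n.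
have cuv : {within SG, continuous (fun x => u x * v x)}.
  by move=> x; apply: cvgM; [exact: cu|exact: cv].
have key j : `|\int[mu]_(x in Omega q SG) (u x * v x) -
     3 ^- n * (\sum_(w <- words n) u (pt q w j) * v (pt q w j))| <= 50 * (C * D) * (4 / 5) ^+ n.
  apply: (riemann_sum hSG hmu cuv _ _ (B := (5 * C) * (5 * D))) => [x hx|w x sw hw|x hx].
  - by rewrite u0 // mul0r.
  - have hx : SG x by case: hw => y hy <-; exact: SG_fword.
    have h1 := cell_osc_closure j C0 cu hC hw; have h2 := cell_osc_closure j D0 cv hD hw.
    have h3 := bu _ (SG_pt hq hSG w j); have h4 := bv x hx.
    rewrite sw in h1 h2.
    have -> : u x * v x - u (pt q w j) * v (pt q w j) =
      (u x - u (pt q w j)) * v x + u (pt q w j) * (v x - v (pt q w j)) by ring.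
    apply: le_trans (ler_normD _ _) _; rewrite !normrM.
    have := ler_pM (normr_ge0 _) (normr_ge0 _) h1 h4.
    have := ler_pM (normr_ge0 _) (normr_ge0 _) h3 h2.
    move: ((4 / 5) ^+ n) => t; lra.
  by rewrite normrM ler_pM ?bu ?bv.
have -> : mass q n u v = \sum_j 3 ^- n * (\sum_(w <- words n) u (pt q w j) * v (pt q w j)).
  by rewrite /mass exchange_big /= mulr_sumr.
rewrite sum3; have := key 0; have := key 1; have := key 2.
set I := \int[mu]_(x in _) _; rewrite ![`|I - _|]distrC.
move: (_ * \sum_(w <- _) _) (_ * \sum_(w <- _) _) (_ * \sum_(w <- _) _) ((4 / 5) ^+ n) => a b c t h1 h2 h3.
have -> : a + b + c - 3 * I = (a - I) + (b - I) + (c - I) by ring.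
apply: le_trans (ler_normD _ _) _; apply: le_trans (lerD (ler_normD _ _) h1) _.
by move: h1 h2 h3; lra.
Qed.

Section LimitEigenvalue.
Variables (M : nat) (lam : nat -> R) (us : nat -> plane R -> R) (s : R).
Hypotheses (hdeig : forall m, (M <= m)%N -> deig q m.+1 (lam m.+1) (us m.+1))
  (hsym : forall m, (M <= m)%N -> symv q m.+1 (us m.+1))
  (hmass : forall m, (M <= m)%N -> mass q m.+1 (us m.+1) (us m.+1) = 1)
  (hlim : 5 ^+ m * lam m @[m --> \oo] --> s).

Lemma limit_eigenvalue : Pplus q SG mu (3 / 2 * s).
Proof.
have [K hK] : exists K : R, forall m, `|5 ^+ m * lam m| <= K.
  have /cvg_seq_bounded [K [_ hK]] : cvgn (fun m => 5 ^+ m * lam m) by apply/cvg_ex; exists s.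
  by exists (`|K| + 1) => m; apply: hK => //; rewrite ltr_pwDr // ler_norm.
have K0 : 0 <= K by apply: le_trans (hK 0%N).
pose C : R := K + 1; have C0 : 0 <= C by rewrite addr_ge0.
have KC : K <= C ^+ 2 by exact: sqr_ub.
have hC m : (M.+1 <= m)%N -> form q m (us m) (us m) <= C ^+ 2.
  case: m => // m Mm; rewrite (form_deig hq (hdeig Mm) (hsym Mm)) hmass // mulr1.
  have := hK m.+1; have := ler_norm (5 ^+ m.+1 * lam m.+1); move: KC K0.
  move: (C ^+ 2) (_ * lam _) => c z; lra.
have us0 m x : (M.+1 <= m)%N -> bdOmega q x -> us m x = 0.
  by case: m => // m Mm; exact: (deig_bdOmega (hdeig Mm)).
have h0 m : (M.+1 <= m)%N -> us m (q 0) = 0 by move=> Mm; apply: us0 => //; left.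
have [U [UU Uoo]] := @ultraFilterLemma nat \oo _.
pose u := ulim q SG us U.
have u0 x : bdOmega q x -> u x = 0.
  case=> [->|]; first exact: (ulim_q0 hq hSG C0 hC h0 UU Uoo).
  by apply: (ulim_segL hq hSG C0 hC h0 UU Uoo) => m y Mm hy; apply: us0 => //; right.
have cu : {within SG, continuous u} by exact: (ulim_continuous hq hSG C0 hC h0 UU Uoo).
have hCu n : form q n u u <= C ^+ 2 by exact: (form_ulim_le hq hSG C0 hC h0 UU Uoo).
have fu : (energy q u < +oo)%E by exact: (energy_lt_pinfty hq hCu).
have upt w i : us m (pt q w i) @[m --> U] --> u (pt q w i).
  exact: (ulim_pt hq hSG C0 hC h0 UU Uoo).
have UP : ProperFilter U := @ultra_proper _ _ UU.
have near N (P : nat -> Prop) : (forall m, (N <= m)%N -> P m) -> \forall m \near U, P m.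
  exact: (ultra_near Uoo).
exists u; last first.
  apply: (ulim_sym hq hSG C0 hC h0 UU Uoo) => -[//|m]; exact: hsym.
split; first by split.
  (* The limit is nonzero: at one fixed level [n] its mass differs by less than 1 from the mass 1 of
     the [us m]. *)
  have [n /(_ n (leqnn n)) hn] := geometric_small (150 * (C * C)) (four_fifths_lt1 R) (@ltr01 R).
  have hm : `|mass q n (us m) (us m) - 1| @[m --> U] --> `|mass q n u u - 1|.
    apply: cvg_norm; apply: cvgB; last exact: cvg_cst.
    exact: (mass_ulim hq hSG C0 hC h0 UU Uoo).
  have : `|mass q n u u - 1| <= 150 * (C * C) * (4 / 5) ^+ n.
    apply: (ultra_le UU hm); apply: (near (maxn M.+1 n)) => m; rewrite geq_max => /andP [Mm nm].
    have := mass_prod_osc hq C0 C0 (hC m Mm) (hC m Mm) (h0 m Mm) (h0 m Mm) nm.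
    by case: m Mm nm => // m Mm nm; rewrite hmass // distrC.
  move=> /le_lt_trans /(_ hn) h1; apply: contrapT => hz; move: h1.
  have z x : SG x -> u x = 0.
    by move=> hx; apply/eqP; apply: contrapT => /negP h; apply: hz; exists x.
  rewrite /mass big1 ?mulr0 ?sub0r ?normrN ?normr1 ?ltxx // => w _.
  by rewrite big1 // => i _; rewrite z ?mul0r //; exact: (SG_pt hq hSG).
move=> v [[cv fv] v0].
pose E := fine (energy q v); pose D := E + 1.
have hE n : form q n v v <= E by exact: energy_bounded.
have E0 : 0 <= E by apply: le_trans (hE 0%N); exact: form_ge0.
have D0 : 0 <= D by rewrite addr_ge0.
have hD n : form q n v v <= D ^+ 2 by apply: le_trans (hE n) _; exact: sqr_ub.
have vq0 : v (q 0) = 0 by apply: v0; left.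
(* Error at level [n], uniform in [m]: the energy of [v] not yet reached at level [n], and the error
   of the sampled mass. The index [m] runs along the ultrafilter first, which removes the boundary
   term; then [n] tends to infinity. *)
pose b n := Num.sqrt (C ^+ 2 * (E - form q n v v)) + K / 2 * (150 * (C * D) * (4 / 5) ^+ n).
have key n : `|form q n u v - s / 2 * mass q n u v| <= b n.
  apply/ler_addgt0Pr => e e0.
  have hx : `|form q n (us m) v - 5 ^+ m * lam m / 2 * mass q n (us m) v| @[m --> U] -->
      `|form q n u v - s / 2 * mass q n u v|.
    apply: cvg_norm; apply: cvgB.
      by apply: (form_ulim hq hSG C0 hC h0 UU Uoo (v := fun=> v)) => w i; exact: cvg_cst.
    apply: cvgM; last by apply: (mass_ulim hq hSG C0 hC h0 UU Uoo (v := fun=> v)) => w i; exact: cvg_cst.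
    apply: cvgMl; apply: cvg_trans hlim; exact: cvg_app.
  (* Chosen so that, after the powers of [10/3] and [3/10] cancel, the square of the boundary term
     is at most [C^2 e^2 / (C^2 + 1) <= e^2]. *)
  have e1 : 0 < e ^+ 2 / (C ^+ 2 + 1) by rewrite divr_gt0 ?exprn_gt0 // ltr_wpDl ?sqr_ge0.
  have [N hN] := gbar_decay hq D0 hD v0 e1.
  apply: (ultra_le UU hx); apply: (near (maxn (maxn M.+1 n) N)) => m.
  rewrite !geq_max => /andP [/andP [Mm nm] Nm].
  have h1 : `|form q n (us m) v - form q m (us m) v| <= Num.sqrt (C ^+ 2 * (E - form q n v v)).
    rewrite distrC -sqrtr_sqr ler_wsqrtr //; apply: le_trans (form_CS hq _ _ nm) _.
    rewrite ler_pM ?subr_ge0 ?form_incr //; last by rewrite lerB.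
    by rewrite lerBlDr (le_trans (hC m Mm)) // lerDl form_ge0.
  have h2 := mass_prod_osc hq C0 D0 (hC m Mm) (hD m) (h0 m Mm) vq0 nm.
  case: m Mm nm Nm h1 h2 => // m Mm nm Nm h1 h2.
  set err := (10 / 3) ^+ m.+1 * atop q m (us m.+1) * gbar q m.+1 v.
  have h3 : `|err| <= e.
    rewrite -(ler_pXn2r (n := 2)) ?nnegrE ?normr_ge0 ?(ltW e0) //.
    rewrite real_normK ?num_real // /err [(_ * gbar _ _ _) ^+ 2]exprMn [(_ * atop _ _ _) ^+ 2]exprMn.
    have h37 : 0 <= (3 / 10 : R) ^+ m.+1 by rewrite exprn_ge0 // divr_ge0.
    have a1 := le_trans (atop_le hq (hdeig Mm) (hsym Mm)) (ler_wpM2l h37 (hC m.+1 Mm)).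
    have a2 := hN m.+1 Nm.
    have s1 : 0 <= ((10 / 3) ^+ m.+1) ^+ 2 * atop q m (us m.+1) ^+ 2 by rewrite mulr_ge0 ?sqr_ge0.
    have a3 := ler_wpM2l (sqr_ge0 ((10 / 3) ^+ m.+1)) a1.
    apply: le_trans (ler_pM s1 (sqr_ge0 _) a3 a2) _.
    have xy : (10 / 3) ^+ m.+1 * (3 / 10) ^+ m.+1 = 1 :> R.
      by rewrite -exprMn (_ : 10 / 3 * (3 / 10) = 1) ?expr1n //; field.
    move: xy; set X := (10 / 3) ^+ m.+1; set Y := (3 / 10) ^+ m.+1 => xy.
    have -> : X ^+ 2 * (Y * C ^+ 2) * (e ^+ 2 / (C ^+ 2 + 1) * Y) =
      (X * Y) ^+ 2 * (C ^+ 2 * (e ^+ 2 / (C ^+ 2 + 1))) by ring.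
    rewrite xy expr1n mul1r mulrCA ler_piMr ?sqr_ge0 // ler_pdivrMr ?mul1r ?lerDl //.
    by rewrite ltr_wpDl ?sqr_ge0.
  have -> : form q n (us m.+1) v - 5 ^+ m.+1 * lam m.+1 / 2 * mass q n (us m.+1) v =
    (form q n (us m.+1) v - form q m.+1 (us m.+1) v) +
      5 ^+ m.+1 * lam m.+1 / 2 * (mass q m.+1 (us m.+1) v - mass q n (us m.+1) v) - err.
    by rewrite (green hq (hdeig Mm) (hsym Mm) v0) -/err; ring.
  apply: le_trans (ler_normB _ _) _; apply: lerD => //.
  apply: le_trans (ler_normD _ _) _; apply: lerD => //.
  rewrite normrM ler_pM // normrM normfV [`|2|]ger0_norm // ler_wpM2r ?invr_ge0 //; exact: hK.
have b0 : b n @[n --> \oo] --> (0 : R).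
  rewrite -[0]addr0; apply: cvgD.
    rewrite -sqrtr0; apply: continuous_cvg; first exact: sqrt_continuous.
    rewrite -(mulr0 (C ^+ 2)); apply: cvgM; first exact: cvg_cst.
    rewrite -(subrr E); apply: cvgB; first exact: cvg_cst.
    exact: energy_fine_cvg.
  rewrite -(mulr0 (K / 2)); apply: cvgM; first exact: cvg_cst.
  rewrite -(mulr0 (150 * (C * D))); apply: cvgM; first exact: cvg_cst.
  by apply: cvg_expr; have /andP [t0 t1] := four_fifths_lt1 R; rewrite ger0_norm.
have l1 : form q n u v - s / 2 * mass q n u v @[n --> \oo] -->
    energy_form q u v - s / 2 * (3 * \int[mu]_(x in Omega q SG) (u x * v x)).
  apply: cvgB; first exact: energy_formP.
  apply: cvgM; [exact: cvg_cst|exact: (mass_integral C0 D0 cu cv hCu hD u0 v0)].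
have l2 : form q n u v - s / 2 * mass q n u v @[n --> \oo] --> (0 : R).
  apply/cvgrPdist_le => e e0; have /cvgrPdist_le /(_ e e0) := b0.
  apply: filterS => n; rewrite !sub0r !normrN => h; apply: le_trans (key n) _.
  by apply: le_trans (ler_norm _) h.
have e : energy_form q u v - s / 2 * (3 * \int[mu]_(x in Omega q SG) (u x * v x)) = 0.
  exact: (cvg_unique (@norm_hausdorff _ _) l1 l2).
(* The factor [3/2] combines the [1/2] of Green's formula with the 3 of [mass_integral]. *)
move/eqP: e; rewrite subr_eq0 => /eqP ->; by field.
Qed.

End LimitEigenvalue.

End Weak.

(** * Spectral decomposition *)

Section Spectral.
Variable R : realType.

(** Diagonalise over the complex numbers, where the eigenvalues are real. The fold applies the
    factors [A - x] in turn; repeated eigenvalues are removed so that the roots are simple and their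
    differences can be inverted later. *)
Lemma symmetric_annihilated n (A : 'M[R]_n) : A^T = A ->
  exists2 xs : seq R, uniq xs & forall v : 'cV[R]_n, foldl (fun w x => A *m w - x *: w) v xs = 0.
Proof.
move=> hA; pose B : 'M[R[i]]_n := map_mx (real_complex R) A.
have hB : B \is hermsymmx.
  apply: realsym_hermsym; last first.
    by apply/mxOverP => i j; rewrite mxE; apply/complex_realP; exists (A i j).
  by apply/is_hermitianmxP; rewrite expr0 scale1r map_mx_id //; apply/matrixP => i j; rewrite !mxE -{1}hA mxE.
have Bsp := orthomx_spectralP (hermitian_normalmx hB).
set P := spectralmx B in Bsp; set D := spectral_diag B in Bsp.
have Pu : P \in unitmx by exact: spectral_unit.
have hD i : exists k, D 0 i = (real_complex R) k.
  by apply/complex_realP; have /mxOverP := hermitian_spectral_diag_real hB.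
have [d hd] := boolp.choice hD.
exists (undup [seq d i | i <- enum 'I_n]); first exact: undup_uniq.
set xs := undup _; move=> v.
have key ys (w : 'cV[R]_n) i :
    (P *m map_mx (real_complex R) (foldl (fun w x => A *m w - x *: w) w ys)) i 0 =
    (\prod_(x <- ys) (real_complex R) (d i - x)) * (P *m map_mx (real_complex R) w) i 0.
  elim: ys w => [|y ys IH] w /=; first by rewrite big_nil mul1r.
  rewrite IH big_cons [_ * \prod_(x <- ys) _]mulrC -mulrA; congr (_ * _).
  rewrite map_mxB map_mxM -/B map_mxZ mulmxBr -scalemxAr mulmxA Bsp.
  by rewrite !mulmxA mulmxV // mul1mx -mulmxA mul_diag_mx !mxE hd rmorphB mulrBl.
apply/matrixP => i j; rewrite ord1 [RHS]mxE; apply: complexI; rewrite rmorph0.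
set w := foldl _ _ _.
have Pw : P *m map_mx (real_complex R) w = 0.
  apply/matrixP => k l; rewrite ord1 key [RHS]mxE.
  have hk : d k \in xs by rewrite mem_undup; apply/mapP; exists k; rewrite ?mem_enum.
  by rewrite (big_rem _ hk) /= subrr rmorph0 !mul0r.
have : map_mx (real_complex R) w = 0 by rewrite -[LHS]mul1mx -(mulVmx Pu) -mulmxA Pw mulmx0.
by move/matrixP/(_ i 0); rewrite !mxE.
Qed.

(** Induction on the roots: decompose [(L - y) e], divide its component for [x] by [x - y], and what
    is left of [e] is an eigenvector for [y]. The predicate [K] stands for an invariant subspace,
    here given by support and symmetry. *)
Lemma eigen_decomposition (V : lmodType R) (L : V -> V) (K : V -> Prop) :
  (forall a u v, L (a *: u + v) = a *: L u + L v) ->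
  (forall a u v, K u -> K v -> K (a *: u + v)) -> (forall u, K u -> K (L u)) ->
  forall xs, uniq xs -> forall e, K e -> foldl (fun w x => L w - x *: w) e xs = 0 ->
  exists E : R -> V, (forall x, x \in xs -> K (E x) /\ L (E x) = x *: E x) /\
    e = \sum_(x <- xs) E x.
Proof.
move=> hL hK KL.
have KD u v : K u -> K v -> K (u + v) by rewrite -{2}(scale1r u); exact: hK.
have K0 u : K u -> K 0 by move=> h; have := hK (-1) _ _ h h; rewrite scaleN1r addNr.
have KZ a u : K u -> K (a *: u) by move=> h; rewrite -[_ *: _]addr0; apply: hK => //; exact: K0 h.
have L0 : L 0 = 0 by have := hL (-1) 0 0; rewrite !scaleN1r !addNr.
have LZ a u : L (a *: u) = a *: L u by rewrite -[a *: u]addr0 hL L0 addr0.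
have LD u v : L (u + v) = L u + L v by rewrite -{1}(scale1r u) hL scale1r.
have Lsum (s : seq R) (F : R -> V) : L (\sum_(x <- s) F x) = \sum_(x <- s) L (F x).
  by elim: s => [|y s IH]; rewrite ?big_nil ?big_cons ?LD ?IH.
elim=> [|y xs IH] /= => [_ e he ->|/andP [yxs us] e he h0].
  by exists (fun=> 0); rewrite big_nil.
have Ke' : K (L e - y *: e) by rewrite -scaleNr; apply: KD; [exact: KL|exact: KZ].
have [E [hE sE]] := IH us _ Ke' h0.
have nz x : x \in xs -> x - y != 0 by move=> hx; rewrite subr_eq0; apply: contraNneq yxs => <-.
pose F x := if x == y then e - \sum_(x <- xs) (x - y)^-1 *: E x else (x - y)^-1 *: E x.
have FE x : x \in xs -> F x = (x - y)^-1 *: E x.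
  by move=> hx; rewrite /F; case: eqP => // xy; rewrite -xy hx in yxs.
exists F; split; last first.
  rewrite big_cons {1}/F eqxx (eq_big_seq _ FE) subrK //.
have KS (s : seq R) : {subset s <= xs} -> K (\sum_(x <- s) (x - y)^-1 *: E x).
  elim: s => [|x s IHs] hs; first by rewrite big_nil; exact: K0 he.
  rewrite big_cons; apply: hK; first by apply: (hE x _).1; apply: hs; rewrite inE eqxx.
  by apply: IHs => z zs; apply: hs; rewrite inE zs orbT.
move=> x; rewrite inE => /orP [/eqP ->|hx]; last first.
  by rewrite FE //; have [k1 k2] := hE x hx; split; [exact: KZ|rewrite LZ k2 !scalerA mulrC].
rewrite /F eqxx; split.
  by rewrite -scaleN1r addrC; apply: hK => //; exact: KS.
have LS : L (\sum_(x <- xs) (x - y)^-1 *: E x) =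
    y *: (\sum_(x <- xs) (x - y)^-1 *: E x) + \sum_(x <- xs) E x.
  rewrite Lsum scaler_sumr -big_split /=; apply: eq_big_seq => z hz.
  rewrite LZ (hE z hz).2 !scalerA.
  have -> : (z - y)^-1 * z = y * (z - y)^-1 + 1 by field; exact: nz.
  by rewrite scalerDl scale1r.
have Le : L e = y *: e + \sum_(x <- xs) E x by rewrite -sE addrC subrK.
set S := \sum_(x <- xs) _ in LS *; have -> : e - S = -1 *: S + e by rewrite scaleN1r addrC.
by rewrite hL LS Le !scaleN1r opprD addrACA addNr addr0 scalerDr scalerN.
Qed.

End Spectral.

Section Kernel.
Variables (R : realType) (I : eqType) (X : seq I) (a : I -> I -> R).
Hypotheses (a_sym : forall x y, a x y = a y x).

Definition kop (u : I -> R) : I -> R :=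
  fun x => if x \in X then \sum_(y <- X) a x y * u y else 0.

Lemma kop_annihilated : exists2 xs : seq R, uniq xs &
  forall u : I -> R, (forall x, x \notin X -> u x = 0) ->
    foldl (fun w (l : R) => kop w - l *: w) u xs = 0.
Proof.
pose p i := tnth (in_tuple X) i.
have sA : (\matrix_(i, j) a (p i) (p j))^T = \matrix_(i, j) a (p i) (p j).
  by apply/matrixP => i j; rewrite !mxE a_sym.
have [xs us h] := symmetric_annihilated sA.
exists xs => // u hu; pose vec (w : I -> R) := \col_i w (p i).
have key ys w : vec (foldl (fun w (l : R) => kop w - l *: w) w ys) =
    foldl (fun z l => (\matrix_(i, j) a (p i) (p j)) *m z - l *: z) (vec w) ys.
  elim: ys w => //= y ys IH w; rewrite IH; congr foldl.
  apply/matrixP => i j; rewrite !mxE.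
  have -> : (kop w - y *: w) (p i) = kop w (p i) - y * w (p i) by [].
  rewrite /kop (mem_tnth i (in_tuple X)); congr (_ - _).
  by rewrite (big_tnth _ _ X); apply: eq_bigr => k _; rewrite !mxE.
have off ys w : (forall x, x \notin X -> w x = 0) ->
    forall x, x \notin X -> foldl (fun w (l : R) => kop w - l *: w) w ys x = 0.
  elim: ys w => //= y ys IH w hw; apply: IH => x hx.
  have -> : (kop w - y *: w) x = kop w x - y * w x by [].
  by rewrite /kop (negbTE hx) hw // mulr0 subrr.
apply/funext => x; case: (boolP (x \in X)) => hx; last exact: off.
have /tnthP [i ->] : x \in in_tuple X by [].
have /matrixP /(_ i 0) := key xs u; rewrite h !mxE; exact.
Qed.

Lemma kop_lin (c : R) (u v : I -> R) : kop (c *: u + v) = c *: kop u + kop v.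
Proof.
apply/funext => x; have -> : (c *: kop u + kop v) x = c * kop u x + kop v x by [].
rewrite /kop; case: ifP => _; last by rewrite mulr0 addr0.
rewrite mulr_sumr -big_split /=; apply: eq_bigr => y _.
have -> : (c *: u + v) y = c * u y + v y by [].
ring.
Qed.

Definition dot (u v : I -> R) : R := \sum_(x <- X) u x * v x.

Lemma kop_sym u v : dot (kop u) v = dot u (kop v).
Proof.
transitivity (\sum_(x <- X) \sum_(y <- X) a x y * u y * v x).
  by apply: eq_big_seq => x hx; rewrite /kop hx mulr_suml.
rewrite exchange_big /=; apply: eq_big_seq => y hy; rewrite /kop hy mulr_sumr.
by apply: eq_bigr => x _; rewrite a_sym; ring.
Qed.

End Kernel.

(** * The Dirichlet Laplacian on symmetric functions *)

Lemma sum_delta (R : realType) (I : eqType) (X : seq I) (u : I -> R) p : uniq X ->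
  (forall x, x \notin X -> u x = 0) -> \sum_(x <- X) (p == x)%:R * u x = u p.
Proof.
move=> uX hu; case: (boolP (p \in X)) => hp; last first.
  rewrite hu // big1_seq // => x /andP [_ hx].
  by case: eqP => [e|_]; rewrite ?mul0r // e hx in hp *.
rewrite (bigD1_seq p) //= eqxx mul1r big1 ?addr0 // => x; rewrite eq_sym => /negbTE ->.
by rewrite mul0r.
Qed.

Lemma sum_words_negw (V : nmodType) n (F : seq 'I_3 -> V) :
  \sum_(w <- words n) F (negw w) = \sum_(w <- words n) F w.
Proof.
elim: n F => [|n IH] F; first by rewrite !sum_words0.
rewrite !sum_wordsS [RHS](reindex_inj (@oppr_inj _)) /=.
by apply: eq_bigr => a _; rewrite -(IH (fun w => F (- a :: w))).
Qed.

Section Operator.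
Variables (R : realType) (q : 'I_3 -> plane R).
Hypothesis hq : equilateral q.

Lemma star_cell w n (F : seq 'I_3 -> 'I_3 -> R) x : tri q x -> (forall j, x != q j) ->
  star q (size w + n) F (fword q w x) = star q n (fun v => F (w ++ v)) x.
Proof.
move=> tx nx; rewrite /star sum_words_cat (bigD1_seq w) ?mem_words ?uniq_words //=.
rewrite [X in _ + X]big1_seq ?addr0 => [|w1].
  apply: eq_bigr => v _; apply: eq_bigr => i _.
  by rewrite pt_cat (inj_eq (@fword_inj _ _ _)).
rewrite mem_words => /andP [ne /eqP sw]; rewrite big1 // => v _; rewrite big1 // => i _.
case: eqP => [|_]; last by rewrite mul0r.
rewrite pt_cat => /(cells_meet hq sw ne (pt_tri hq v i) tx) [_ [j [_ _ xj]]].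
by have := nx j; rewrite xj eqxx.
Qed.

Lemma star_rfl n (F : seq 'I_3 -> 'I_3 -> R) x :
  star q n F (reflw q [::] x) = star q n (fun v i => F (negw v) (- i)) x.
Proof.
rewrite /star -(sum_words_negw n (fun v => \sum_i (pt q v i == reflw q [::] x)%:R * F v i)).
apply: eq_bigr => v _; rewrite (reindex_inj (@oppr_inj _)) /=; apply: eq_bigr => i _.
by rewrite -(rfl_pt hq) (inj_eq (can_inj (rflK hq))).
Qed.

Lemma star_sym w n (F : seq 'I_3 -> 'I_3 -> R) x : word12 w -> tri q x ->
  ~ segL q (fword q w x) ->
  (forall v i, size v = n -> F (w ++ negw v) (- i) = F (w ++ v) i) ->
  star q (size w + n) F (fword q w (reflw q [::] x)) = star q (size w + n) F (fword q w x).
Proof.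
move=> hw tx hL hF; have [->|x0] := eqVneq x (q 0); first by rewrite (rfl_q hq) oppr0.
have nx j : x != q j.
  have [->//|j0] := eqVneq j 0; apply/eqP => xj; apply: hL.
  by rewrite xj; apply/(segL_pt hq w j); rewrite hw.
have nx' j : reflw q [::] x != q j.
  by rewrite -(opprK j) -(rfl_q hq) (inj_eq (can_inj (rflK hq))).
rewrite !star_cell //; last exact: tri_rfl.
by rewrite star_rfl; apply: eq_star => v i sv _; exact: hF.
Qed.

Definition ilist m : seq (plane R) :=
  [seq p <- undup [seq pt q w i | w <- words m, i <- enum 'I_3] | `[< inner q m p >]].

Lemma mem_ilist m x : (x \in ilist m) <-> inner q m x.
Proof.
rewrite mem_filter mem_undup; split=> [/andP [/asboolP]|h] //.
apply/andP; split; first exact/asboolP.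
have [[/Vset_pt [w [i [sw ->]]] _] _] := h.
by apply/allpairsP; exists (w, i); rewrite mem_words sw mem_enum.
Qed.

Lemma uniq_ilist m : uniq (ilist m).
Proof. by rewrite filter_uniq ?undup_uniq. Qed.

Definition kern m (x y : plane R) : R := \sum_(w <- words m) \sum_i (pt q w i == x)%:R *
  \sum_j ((pt q w i == y)%:R - (pt q w j == y)%:R).

Lemma kern_sym m x y : kern m x y = kern m y x.
Proof.
have kE (a b : plane R) : kern m a b = \sum_(w <- words m) \sum_i \sum_(j : 'I_3) (pt q w i == a)%:R * (pt q w i == b)%:R
    - \sum_(w <- words m) \sum_i \sum_j (pt q w i == a)%:R * (pt q w j == b)%:R :> R.
  rewrite -sumrB; apply: eq_bigr => w _; rewrite -sumrB; apply: eq_bigr => i _.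
  by rewrite -sumrB mulr_sumr; apply: eq_bigr => j _; rewrite mulrBr.
rewrite !kE; congr (_ - _); apply: eq_bigr => w _.
  by apply: eq_bigr => i _; apply: eq_bigr => j _; exact: mulrC.
by rewrite exchange_big; apply: eq_bigr => i _; apply: eq_bigr => j _; exact: mulrC.
Qed.

Definition lap m := kop (ilist m) (kern m).

Lemma off_ilist m (u : plane R -> R) : (forall x, ~ inner q m x -> u x = 0) ->
  forall x, x \notin ilist m -> u x = 0.
Proof. by move=> h x /negP hx; apply: h => /mem_ilist. Qed.

Lemma lapE m u x : (forall x, ~ inner q m x -> u x = 0) -> inner q m x ->
  lap m u x = star q m (flux q u) x.
Proof.
move=> hu hx; rewrite /lap /kop (mem_ilist m x).2 // /kern /star.
have hu' := off_ilist hu.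
under eq_bigr do rewrite mulr_suml.
rewrite exchange_big /=; apply: eq_bigr => w _.
under eq_bigr do rewrite mulr_suml.
rewrite exchange_big /=; apply: eq_bigr => i _.
under eq_bigr do rewrite -mulrA mulr_suml.
rewrite -mulr_sumr; congr (_ * _); rewrite exchange_big /=; apply: eq_bigr => j _.
under eq_bigr do rewrite mulrBl.
by rewrite sumrB !sum_delta ?uniq_ilist.
Qed.

Lemma deig_lap m l u : deig q m l u <-> (forall x, ~ inner q m x -> u x = 0) /\ lap m u = l *: u.
Proof.
split=> -[h1 h2]; split=> //.
  apply/funext => x; have -> : (l *: u) x = l * u x by [].
  have [hx|hx] := pselect (inner q m x); first by rewrite lapE // h2.
  by rewrite h1 // mulr0 /lap /kop; case: ifP => // /mem_ilist /hx.
by move=> x hx; rewrite -lapE // h2.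
Qed.

Definition ssym m (u : plane R -> R) := (forall x, ~ inner q m x -> u x = 0) /\ symv q m u.

Lemma ssym_lin m a u v : ssym m u -> ssym m v -> ssym m (a *: u + v).
Proof.
have E x : (a *: u + v) x = a * u x + v x by [].
move=> [u0 us] [v0 vs]; split=> [x hx|w w' i hw sw]; rewrite !E.
  by rewrite u0 // v0 // mulr0 addr0.
by rewrite us // vs.
Qed.

(** The level [k] of the sum may be smaller than that of the function, so that both [lap]
    ([k = m + 1]) and [bote] ([k = m]) are covered. Words longer than [k], about which the symmetry
    of [F] says nothing, are left to the last hypothesis. *)
Lemma ssym_star m (F : seq 'I_3 -> 'I_3 -> R) (u : plane R -> R) k : (k <= m.+1)%N ->
  (forall x, inner q m.+1 x -> u x = star q k F x) -> (forall x, ~ inner q m.+1 x -> u x = 0) ->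
  (forall w v i, word12 w -> (size w + size v)%N = k -> F (w ++ negw v) (- i) = F (w ++ v) i) ->
  (forall w, word12 w -> (k < size w)%N -> forall x, tri q x -> inner q m.+1 (fword q w x) -> u (fword q w x) = 0) ->
  ssym m.+1 u.
Proof.
move=> km hu u0 hF hbig; split=> // w v i hw sw.
have [hx|hx] := pselect (inner q m.+1 (pt q (w ++ v) i)); last first.
  rewrite [RHS]u0 // u0 // => h; apply: hx.
  by rewrite -(negwK v) -(opprK i); apply: inner_sym; rewrite ?size_negw.
have hx' := inner_sym hq hw sw hx.
rewrite !pt_cat in hx hx' *.
have tv := pt_tri hq v i; have tv' := pt_tri hq (negw v) (- i).
have [wk|wk] := ltnP k (size w); first by rewrite !hbig.
rewrite !hu // -(rfl_pt hq) -(subnKC wk); apply: star_sym => //; first by case: hx => -[].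
by move=> v' i' sv'; apply: hF => //; rewrite sv' subnKC.
Qed.

Lemma ssym_lap m u : ssym m.+1 u -> ssym m.+1 (lap m.+1 u).
Proof.
move=> [u0 us]; apply: (@ssym_star m (flux q u) _ m.+1) => //.
- by move=> x hx; rewrite lapE.
- by move=> x hx; rewrite /lap /kop; case: ifP => // /mem_ilist /hx.
- move=> w v i hw sw; rewrite /flux (reindex_inj (@oppr_inj _)) /=.
  by apply: eq_bigr => j _; rewrite !us.
move=> w hw sw x tx hx; exfalso.
have [hV _] := hx; have [v [j [e _ _]]] := cell_VOmega hq hw tx hV.
by move: sw; rewrite -e ltnNge leq_addr.
Qed.

(** Indicator of [{F_v q_0 : v in {1,2}^k}]: of the incidences at such a vertex, only one has its
    word in [{1,2}^k] and corner 0. *)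
Definition bote k : plane R -> R := star q k (fun v i => (word12 v && (i == 0))%:R).

Lemma bot_inner k v : (0 < k)%N -> size v = k -> word12 v -> inner q k.+1 (pt q v 0).
Proof.
move=> k0 sv hv.
have hV : Vset q k.+1 (pt q v 0) by apply: (@VsetW _ _ hq k) => //; apply/Vset_pt; exists v, 0.
apply/innerP => //; rewrite /bot /pt bary0_word12 // (bary_q hq) eqxx mul1r sv.
split; first by rewrite invr_eq0 expf_neq0.
  by rewrite lt_eqF // invf_lt1 ?exprn_gt0 // exprn_egt1 ?ltr1n // -lt0n.
by rewrite gt_eqF // ltf_pV2 ?posrE ?exprn_gt0 // ltr_eXn2l ?ltr1n.
Qed.

Lemma bote_off k x : (0 < k)%N -> ~ inner q k.+1 x -> bote k x = 0.
Proof.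
move=> k0 hx; rewrite /bote /star big_seq big1 // => v; rewrite mem_words => /eqP sv.
rewrite big1 // => i _; case: eqP => [xE|_]; last by rewrite mul0r.
case: (boolP (word12 v)) => hv /=; last by rewrite mulr0.
case: eqP => [i0|_]; last by rewrite mulr0.
by exfalso; apply: hx; rewrite -xE i0; exact: bot_inner.
Qed.

Lemma ssym_bote k : (0 < k)%N -> ssym k.+1 (bote k).
Proof.
move=> k0; apply: (@ssym_star k (fun v i => (word12 v && (i == 0))%:R) _ k) => //.
- by move=> x hx; exact: bote_off.
- by move=> w v i hw sw; rewrite !word12_cat word12_negw oppr_eq0.
move=> w hw kw x tx hx; rewrite /bote /star big_seq big1 // => v; rewrite mem_words => /eqP sv.
rewrite big1 // => i _; case: eqP => [xE|_]; last by rewrite mul0r.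
case: (boolP (word12 v)) => hv /=; last by rewrite mulr0.
case: eqP => [i0|_]; last by rewrite mulr0.
exfalso; have := congr1 (bary q 0) xE; rewrite /pt i0 !bary0_word12 // (bary_q hq) eqxx mul1r sv.
apply/eqP; rewrite gt_eqF //; apply: (@le_lt_trans _ _ (2 ^- size w)).
  by rewrite ler_piMl ?invr_ge0 ?exprn_ge0 // bary_le1.
by rewrite ltf_pV2 ?posrE ?exprn_gt0 // ltr_eXn2l ?ltr1n.
Qed.

Lemma dot_bote k u : (0 < k)%N -> ssym k.+1 u ->
  dot (ilist k.+1) (bote k) u = 2 ^+ k * atop q k u.
Proof.
move=> k0 [u0 us]; rewrite /dot /bote /star.
have hu' := off_ilist u0.
under eq_bigr do rewrite mulr_suml.
rewrite exchange_big /= -count_word12 mulr_suml [RHS]big_mkcond /=.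
apply: eq_words => v sv; under eq_bigr do rewrite mulr_suml.
rewrite exchange_big /=.
transitivity (\sum_i (word12 v && (i == 0))%:R * u (pt q v i)).
  apply: eq_bigr => i _; under eq_bigr do rewrite mulrAC mulrC.
  by rewrite -mulr_sumr sum_delta ?uniq_ilist.
case: (boolP (word12 v)) => hv /=; last by rewrite big1 // => i _; rewrite mul0r.
by rewrite sum3 /= !mul0r !addr0 (atopE hq us).
Qed.

End Operator.

Section Spectrum.
Variables (R : realType) (q : 'I_3 -> plane R).
Hypothesis hq : equilateral q.

(** Components for different eigenvalues are orthogonal, so [2^k * atop (E l)], the scalar product
    of [bote] with [E l], is the squared norm of [E l] and is positive. An eigenfunction with any
    other eigenvalue is orthogonal to every component, hence to [bote], and has [atop] zero. *)
Lemma spectrum k : (0 < k)%N -> exists (xs : seq R) (E : R -> plane R -> R),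
  [/\ uniq xs,
    forall l, l \in xs -> [/\ deig q k.+1 l (E l), symv q k.+1 (E l) & 0 < atop q k (E l)],
    bote q k = \sum_(l <- xs) E l &
    forall l u, deig q k.+1 l u -> symv q k.+1 u -> atop q k u != 0 -> l \in xs].
Proof.
move=> k0; have he := ssym_bote hq k0.
have [xs0 us h0] := kop_annihilated (ilist q k.+1) (@kern_sym _ q k.+1).
have [E [hE sE]] := eigen_decomposition (@kop_lin _ _ _ _) (@ssym_lin _ q k.+1)
  (@ssym_lap _ _ hq k) us he (h0 _ (off_ilist he.1)).
pose xs := [seq l <- xs0 | E l != 0].
have sE' : bote q k = \sum_(l <- xs) E l.
  by rewrite sE big_filter [RHS]big_mkcond; apply: eq_bigr => l _; case: eqP.
have hdeig l : l \in xs -> deig q k.+1 l (E l).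
  rewrite mem_filter => /andP [_ hl]; apply/deig_lap => //.
  by have [[h1 _] h2] := hE l hl.
have hssym l : l \in xs -> ssym q k.+1 (E l).
  by rewrite mem_filter => /andP [_ /hE []].
pose d (u v : plane R -> R) : R := dot (ilist q k.+1) u v.
have dZ (c : R) (u v : plane R -> R) : d (c *: u) v = c * d u v.
  rewrite /d /dot mulr_sumr; apply: eq_bigr => x _.
  by rewrite mulrA.
have dC u v : d u v = d v u by apply: eq_bigr => x _; exact: mulrC.
have dsum v : d (bote q k) v = \sum_(l <- xs) d (E l) v.
  rewrite sE' /d /dot exchange_big /=; apply: eq_bigr => x _.
  rewrite -mulr_suml; congr (_ * _).
  by elim: (xs) => [|y s IH]; rewrite ?big_nil ?big_cons //= -IH.
have ortho l l' u : l \in xs -> deig q k.+1 l' u -> l != l' -> d (E l) u = 0.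
  move=> hl /deig_lap [_ hu] ll'; have /deig_lap [_ hEl] := hdeig l hl.
  have : d (lap q k.+1 (E l)) u = d (E l) (lap q k.+1 u).
    exact (kop_sym (ilist q k.+1) (@kern_sym _ q k.+1) (E l) u).
  rewrite hu hEl dZ (dC (E l) (l' *: u)) dZ (dC u) => /eqP.
  by rewrite -subr_eq0 -mulrBl mulf_eq0 subr_eq0 (negbTE ll') /= => /eqP.
exists xs, E; split=> //.
- by rewrite filter_uniq.
- move=> l hl; have [_ hs] := hssym l hl; split=> //; first exact: hdeig.
  have : 0 < d (bote q k) (E l).
    rewrite dsum (bigD1_seq l) ?filter_uniq //= big1_seq ?addr0 => [|l' /andP [ll' hl']]; last first.
      by apply: ortho ll' => //; exact: hdeig.
    have El0 : E l != 0 by move: hl; rewrite mem_filter => /andP [].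
    have sq0 x : 0 <= E l x * E l x by rewrite -expr2 sqr_ge0.
    rewrite lt_neqAle sumr_ge0 ?andbT // eq_sym; apply: contra_neq El0 => /eqP.
    rewrite psumr_eq0 // => /allP h; apply/funext => x.
    case: (boolP (x \in ilist q k.+1)) => hx; last exact: (off_ilist (hssym l hl).1).
    by have := h x hx; rewrite /= mulf_eq0 orbb => /eqP.
  by rewrite /d (dot_bote hq k0 (hssym l hl)) pmulr_rgt0 // exprn_gt0.
move=> l u hu hs ha; apply: contraNT ha => hl.
have : d (bote q k) u = 0.
  rewrite dsum big1_seq // => l' /andP [_ hl']; apply: (ortho _ _ _ hl' hu).
  by apply/eqP => e; rewrite -e hl' in hl.
rewrite /d (dot_bote hq k0) // => [/eqP|]; first by rewrite mulf_eq0 expf_eq0 pnatr_eq0 andbF.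
by split=> //; exact: hu.1.
Qed.

Variable SG : set (plane R).
Hypothesis hSG : attractor q SG.

Lemma Pplus_at_intro k l (u : plane R -> R) :
  (forall x, bdOmega_at q k.+1 x -> u x = 0) ->
  (forall x, inner q k.+1 x -> star q k.+1 (flux q u) x = l * u x) ->
  (forall w v i, word12 w -> (size w + size v)%N = k.+1 -> VOmega q k.+1 (pt q (w ++ v) i) ->
    u (pt q (w ++ negw v) (- i)) = u (pt q (w ++ v) i)) ->
  u (pt q (nseq k 1) 0) != 0 -> Pplus_at q SG k.+1 l.
Proof.
move=> hb he hs ha; exists u.
have n12 n : word12 (nseq n 1) by rewrite /word12 mem_nseq andbF.
have hV : VOmega q k.+1 (pt q (nseq k 1) 0).
  by apply: (VOmegaW hq (leqnSn k)); apply: VOmega_pt => //; rewrite ?size_nseq // andbF.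
split.
- split=> //; first by exists (pt q (nseq k 1) 0).
  by move=> x hx; rewrite (inner_lap hq) // he.
- move=> w hw x [[y hy <-] hx]; have [v [j [sw e _]]] := cell_VOmega hq hw (SG_tri hq hSG hy) hx.
  by rewrite e (reflw_pt hq); rewrite e in hx; exact: hs.
case=> n nk hl; move/eqP: ha; apply.
apply: (hl (nseq n 1)); rewrite ?size_nseq //; split=> //.
rewrite -(subnKC (_ : n <= k)%N) // nseqD pt_cat.
by exists (pt q (nseq (k - n) 1) 0) => //; exact: (SG_pt hq hSG).
Qed.

Lemma Pplus_at_deig k l : Pplus_at q SG k.+1 l <->
  exists u, [/\ deig q k.+1 l u, symv q k.+1 u & atop q k u != 0].
Proof.
split=> [[u [hu hs hl]]|[u [hu hs ha]]].
  have [_ hb _] := hu; exists (restr q k.+1 u); split; first exact: deig_restr.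
    exact: (symv_restr hq hSG).
  (* If [atop] is zero, [u] vanishes on the cells of level [k] along [L]: apart from its top, such a
     cell has only vertices of the boundary layer or on [L]. So [u] is localized with [n = k]. *)
  apply/eqP => a0; apply: hl; exists k => // w sw hw x [[y hy <-] hx].
  have [v [j [szv e hj]]] := cell_VOmega hq hw (SG_tri hq hSG hy) hx.
  rewrite -(restr_VOmega hb) // e; rewrite e in hx; have := szv; rewrite sw -[in RHS](addn1 k) => /addnI {szv}.
  case: v e hj hx => [|a [|]] // e hj hx _.
  have dr := deig_restr hq hu; have sr := symv_restr hq hSG hb hs.
  rewrite cats1; have [ja|ja] := eqVneq j a.
    rewrite ja (pt_rcons_id hq); move: hj; rewrite ja word12_cons andbT andbb negbK => /eqP ->.
    by rewrite (atopE hq sr).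
  have [a0'|a0'] := eqVneq a 0.
    by rewrite pt_rconsC (deig_word12 hq dr) ?size_rcons ?sw ?word12_rcons ?hw //= -a0' eq_sym eq_sym.
  by rewrite (deig_word12 hq dr) ?size_rcons ?sw ?word12_rcons ?hw.
apply: (@Pplus_at_intro k l u) => //.
- move=> x hx; apply: hu.1 => -[_]; exact.
- exact: hu.2.
by move=> w v i hw sw _; exact: hs.
Qed.

(** The energy of a cell is [3 * sum u^2 - (sum u)^2], so [l < 6] as soon as the three values of [u]
    on some cell have nonzero sum; on the cell [1...10] they are [atop], 0 and 0. *)
Lemma deig_bounds k l u : deig q k.+1 l u -> symv q k.+1 u -> atop q k u != 0 -> 0 <= l < 6.
Proof.
move=> hu hs ha.
pose S := \sum_(w <- words k.+1) \sum_i u (pt q w i) * u (pt q w i).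
have S0 : 0 < S.
  have hV : Vset q k.+1 (pt q (nseq k 1) 0).
    by apply: (VsetW hq (leqnSn k)); apply/Vset_pt; exists (nseq k 1), 0; rewrite size_nseq.
  by have := mass_gt0 hV ha; rewrite pmulr_rgt0 // invr_gt0 exprn_gt0.
have e : \sum_(w <- words k.+1) cell_form q u u w = l / 2 * S.
  have := form_deig hq hu hs; rewrite /form /mass -/S expr_div_n => h.
  apply: (@mulfI _ (5 ^+ k.+1 / 3 ^+ k.+1)); first by rewrite mulf_neq0 ?invr_neq0 // expf_neq0.
  by rewrite h; field; rewrite expf_neq0.
apply/andP; split.
  have : 0 <= l / 2 * S by rewrite -e sumr_ge0 // => w _; exact: cell_form_ge0.
  by rewrite pmulr_lge0 // pmulr_lge0 ?invr_gt0.
have : l / 2 * S < 3 * S.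
  rewrite -e; have -> : \sum_(w <- words k.+1) cell_form q u u w =
      3 * S - \sum_(w <- words k.+1) (\sum_i u (pt q w i)) ^+ 2.
    by rewrite /S mulr_sumr -sumrB; apply: eq_bigr => w _; rewrite cell_form_sqr.
  rewrite gtrDl oppr_lt0.
  have n12 : word12 (nseq k 1) by rewrite /word12 mem_nseq andbF.
  have sn : size (nseq k (1 : 'I_3)) = k by exact: size_nseq.
  have wm : rcons (nseq k 1) 0 \in words k.+1 by rewrite mem_words size_rcons sn.
  rewrite (big_rem _ wm) /= ltr_pwDl //; last by rewrite sumr_ge0 // => w _; exact: sqr_ge0.
  rewrite sum3 (pt_rcons_id hq) (pt_rconsC q _ 0 1) (pt_rconsC q _ 0 2).
  have z a j : a != 0 -> u (pt q (rcons (nseq k 1) a) j) = 0.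
    by move=> a0; rewrite (deig_word12 hq hu) ?size_rcons ?sn // word12_rcons n12.
  rewrite !z // !addr0.
  by rewrite (atopE hq hs) // exprn_even_gt0.
rewrite ltr_pM2r //; lra.
Qed.

End Spectrum.

(** * Spectral decimation *)

Section LevelUp.
Variables (R : realType) (q : 'I_3 -> plane R).
Hypothesis hq : equilateral q.
Variables (k : nat) (y : R) (u : plane R -> R).

(** Spectral decimation at the midpoint of the corners [a] and [i]: these enter with weight [4 - y]
    and the third corner with weight 2, written here as [2 - y] plus a sum over all three. *)
Definition decim (v : seq 'I_3) (a i : 'I_3) : R :=
  ((2 - y) * (u (pt q v a) + u (pt q v i)) + 2 * \sum_j u (pt q v j)) / ((2 - y) * (5 - y)).

(** Value seen from the incidence [(v a, i)]: an old vertex when [a = i], otherwise a midpoint. In a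
    cell along [L] the midpoints belong to the next boundary layer or to [L], hence the value 0. *)
Definition fine_val (w : seq 'I_3) (i : 'I_3) : R :=
  let v := take (size w).-1 w in let a := last 0 w in
  if a == i then u (pt q v a) else if word12 v then 0 else decim v a i.

(* Every point of [V_(k+2)] other than the corners has two incident cells,
   hence the factor [1/2]. *)
Definition refine (x : plane R) : R := 2^-1 * star q k.+2 fine_val x.

Lemma fine_val_rcons v a i : fine_val (rcons v a) i =
  if a == i then u (pt q v a) else if word12 v then 0 else decim v a i.
Proof. by rewrite /fine_val size_rcons last_rcons -cats1 take_size_cat. Qed.

Lemma decimC v a i : decim v a i = decim v i a.
Proof. by rewrite /decim [u (pt q v a) + _]addrC. Qed.

Lemma fine_val_pt w i w' i' : size w = k.+2 -> size w' = k.+2 ->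
  pt q w i = pt q w' i' -> fine_val w i = fine_val w' i'.
Proof.
case/lastP: w => // v a; case/lastP: w' => // v' a'; rewrite !size_rcons => -[sv] [sv'].
rewrite !fine_val_rcons !pt_rcons; have [<- /fword_inj|vv'] := eqVneq v v'.
  have [<- /ifs_inj /(q_inj hq) <- //|aa'] := eqVneq a a'.
  case/(ifs_meet hq aa' (tri_q hq _) (tri_q hq _)) => /(q_inj hq) -> /(q_inj hq) ->.
  by rewrite (negbTE aa') eq_sym (negbTE aa') decimC.
move=> e; have [j [j' [_ e1 e2]]] := cells_meet hq (etrans sv (esym sv')) vv'
  (tri_ifs hq _ (tri_q hq i)) (tri_ifs hq _ (tri_q hq i')) e.
have [aj /(q_inj hq) ij] := ifs_corner hq (tri_q hq _) e1.
have [aj' /(q_inj hq) ij'] := ifs_corner hq (tri_q hq _) e2.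
by move: e; rewrite e1 e2 aj aj' ij ij' !eqxx /pt => ->.
Qed.

Hypothesis u_corner : forall j, u (q j) = 0.

Lemma refine_pt w i : size w = k.+2 -> refine (pt q w i) = fine_val w i.
Proof.
move=> sw; have h : star q k.+2 fine_val (pt q w i) = star q k.+2 (fun _ _ => 1 * fine_val w i) (pt q w i).
  by apply: eq_star => w' i' sw' e; rewrite mul1r; apply: fine_val_pt.
rewrite /refine h star_mulr; have := star_count hq i sw.
have [[j xj]|nx] := pselect (exists j, pt q w i = q j); last first.
  rewrite big1 ?addr0 => [->|j _]; first by field.
  by case: eqP => // e; exfalso; apply: nx; exists j.
(* At [q_j] there is a single incidence and the factor [1/2] would be wrong, but the value is 0. *)
suff -> : fine_val w i = 0 by rewrite !mulr0.
have -> : fine_val w i = fine_val (rcons (nseq k.+1 j) j) j.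
  by apply: fine_val_pt; rewrite ?size_rcons ?size_nseq // (pt_rcons_id hq) xj /pt fword_nseq.
by rewrite fine_val_rcons eqxx /pt fword_nseq.
Qed.

Hypothesis y2 : y < 2.
Hypothesis u_bot : forall w, size w = k.+1 -> word12 w -> u (pt q w 0) = 1.
Hypothesis u_seg : forall w i, size w = k.+1 -> word12 w -> i != 0 -> u (pt q w i) = 0.
Hypothesis u_eig : forall x, inner q k.+1 x -> star q k.+1 (flux q u) x = y * (5 - y) * u x.
Variable a0 : R.
Hypothesis u_top : forall v, size v = k -> word12 v -> u (pt q v 0) = a0.

Let B x : R := \sum_(w <- words k.+1 | word12 w) (pt q w 0 == x)%:R.
Let F w i := flux q u w i - y * (5 - y) / 2 * u (pt q w i).
(** In a cell filled by spectral decimation, the quantity [flux - y/2 * value] of the extension at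
    an old corner is [c1] times the coarse quantity [F], and its sum at a new midpoint is zero. *)
Let c1 := (6 - y) / ((2 - y) * (5 - y)).

Lemma inner_level x : inner q k.+2 x -> Vset q k.+1 x -> ~ inner q k.+1 x -> bot q k.+1 x.
Proof.
move=> hx hV; have [hV' _] := hx; move/(innerP hq hV'.1): hx => [b0 b1 _] hn.
by apply: contrapT => /negP hb; apply: hn; apply/(innerP hq hV); split.
Qed.

(** On the boundary layer of level [k + 1], which is interior at level [k + 2], the two incidences
    contribute [2 - y (5 - y) / 2] and [1 - a0 - y (5 - y) / 2]. *)
Lemma star_coarse x : inner q k.+2 x -> star q k.+1 F x = B x * (3 - a0 - y * (5 - y)).
Proof.
move=> hx; have [hV|hV] := pselect (Vset q k.+1 x); last first.
  have nx w i : size w = k.+1 -> (pt q w i == x) = false.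
    by move=> sw; apply/eqP => e; apply: hV; apply/Vset_pt; exists w, i.
  rewrite /star big_seq big1 => [|w]; last first.
    by rewrite mem_words => /eqP sw; rewrite big1 // => i _; rewrite nx ?mul0r.
  rewrite /B big_seq_cond big1 ?mul0r // => w.
  by rewrite mem_words => /andP [/eqP sw _]; rewrite nx.
have [hi|hi] := pselect (inner q k.+1 x).
  rewrite /B big_seq_cond big1 ?mul0r => [|w]; last first.
    rewrite mem_words => /andP [/eqP sw hw]; case: eqP => // e.
    by move/(innerP hq hV): hi => [_ _]; rewrite -e -sw bot_pt.
  rewrite star_add [X in _ + X](eq_star (G := fun _ _ => - (y * (5 - y) / 2) * u x)) => [|w i _ ->]; last by rewrite mulNr.
  by rewrite star_const // u_eig //; field.
have hb := inner_level hx hV hi.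
rewrite /B sum_word12S mulr_suml [RHS]big_mkcond /star sum_words_rcons.
apply: eq_words => v sv.
have d b i : ~~ (word12 v && ((b == 0) (+) (i == 0))) -> (pt q (rcons v b) i == x) = false.
  by rewrite -(botE hq) sv => /negP h; apply/eqP => e; apply: h; rewrite e.
case: (boolP (word12 v)) => hv; last first.
  by rewrite big1 // => b _; rewrite big1 // => i _; rewrite d ?mul0r // (negbTE hv).
rewrite sum3_neq0 !sum3 (d 0 0) ?(d 1 1) ?(d 1 2) ?(d 2 1) ?(d 2 2) ?andbF //=.
have szr b : size (rcons v b) = k.+1 by rewrite size_rcons sv.
have wr b : b != 0 -> word12 (rcons v b) by move=> b0; rewrite word12_rcons hv.
have Fb b : b != 0 -> F (rcons v b) 0 = 2 - y * (5 - y) / 2.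
  move=> b0; rewrite /F /flux sum3 u_bot ?wr // !u_seg ?wr //.
  ring.
rewrite (Fb 1) // (Fb 2) //.
have F0 b : b != 0 -> F (rcons v 0) b = 1 - a0 - y * (5 - y) / 2.
  move=> b0; rewrite /F /flux sum3 (pt_rcons_id hq) u_top //.
  by rewrite !(pt_rconsC q v 0) !u_bot ?wr //; ring.
rewrite (F0 1) // (F0 2) // !(pt_rconsC q v 0); by field.
Qed.

(** Computed cell by cell. The correction comes from the cells along [L]: their midpoints carry 0
    rather than the decimation value, so the top corner gives [2 - y / 2] in place of [c1] times the
    coarse quantity. *)
Lemma star_refine x : inner q k.+2 x ->
  star q k.+2 (fun w i => flux q refine w i - y / 2 * refine (pt q w i)) x =
  c1 * star q k.+1 F x + B x * (2 - y / 2 - c1 * (2 - y * (5 - y) / 2)).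
Proof.
move=> hx; have y2' : 2 - y != 0 by rewrite subr_eq0 gt_eqF.
have y5' : 5 - y != 0 by rewrite subr_eq0 gt_eqF // (lt_trans y2) // ltr_nat.
rewrite /star sum_words_rcons mulr_sumr mulr_suml [X in _ + X]big_mkcond -big_split.
apply: eq_words => v sv /=.
have szr b : size (rcons v b) = k.+2 by rewrite size_rcons sv.
have rE b i : refine (pt q (rcons v b) i) = fine_val (rcons v b) i by exact: refine_pt.
have nx w i : size w = k.+2 -> word12 w -> (pt q w i == x) = false.
  move=> sw hw; apply/eqP => e; move: hx; rewrite -e -sw => /(inner_word hq).
  by rewrite hw.
rewrite /flux; case: (boolP (word12 v)) => hv.
  have wr b : b != 0 -> word12 (rcons v b) by move=> b0; rewrite word12_rcons hv.
  rewrite !sum3.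
  rewrite !(pt_rconsC q v 0 1) !(pt_rconsC q v 0 2) !(nx (rcons v 1)) ?(nx (rcons v 2)) ?wr //.
  have nv i : i != 0 -> (pt q v i == x) = false.
    by move=> i0; rewrite -(pt_rcons_id hq) nx ?wr.
  rewrite (nv 1) // (nv 2) // !rE !fine_val_rcons /= hv (u_bot sv hv).
  rewrite (pt_rcons_id hq) /F /flux sum3 (u_bot sv hv) !(u_seg sv hv) //.
  by field.
rewrite addr0 !sum3 !rE !fine_val_rcons /= (negbTE hv) !(pt_rcons_id hq).
rewrite !(pt_rconsC q v 1 0) !(pt_rconsC q v 2 0) !(pt_rconsC q v 2 1).
rewrite /decim /F /flux /c1 !sum3; by field; rewrite y2' y5'.
Qed.

(** What remains of the eigenvalue equation on the boundary layer of level [k + 1]. As [a0] depends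
    on [y], this is the rational equation for the new eigenvalue. *)
Hypothesis hG : c1 * (1 - y * (5 - y) / 2 - a0) + 2 - y / 2 = 0.

Lemma refine_eig x : inner q k.+2 x -> star q k.+2 (flux q refine) x = y * refine x.
Proof.
move=> hx; have := star_refine hx; rewrite star_coarse //.
rewrite star_add [X in _ + X](eq_star (G := fun _ _ => - (y / 2) * refine x)) => [|w i _ ->]; last by rewrite mulNr.
rewrite star_const // => h.
have : star q k.+2 (flux q refine) x - y * refine x =
  B x * (c1 * (1 - y * (5 - y) / 2 - a0) + 2 - y / 2).
  rewrite (_ : star _ _ _ _ - _ = star q k.+2 (flux q refine) x + 2 * (- (y / 2) * refine x)); last by field.
  by rewrite h; field.
by rewrite hG mulr0 => /eqP; rewrite subr_eq0 => /eqP.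
Qed.

Hypothesis u_sym : symv q k.+1 u.

Lemma fine_val_sym w v i : word12 w -> (size w + size v)%N = k.+2 ->
  fine_val (w ++ negw v) (- i) = fine_val (w ++ v) i.
Proof.
move=> hw; case/lastP: v => [|v a].
  rewrite !cats0 addn0; case/lastP: w hw => // w b; rewrite size_rcons word12_rcons => /andP [hw b0] [sw].
  by rewrite !fine_val_rcons hw u_seg // !if_same.
rewrite size_rcons addnS => -[sv].
rewrite /negw map_rcons -/(negw v) -!rcons_cat !fine_val_rcons eqr_opp.
rewrite !word12_cat word12_negw /decim !u_sym //.
rewrite (reindex_inj (@oppr_inj _)) /=.
by under eq_bigr do rewrite u_sym //.
Qed.

Lemma refine_Pplus (SG : set (plane R)) : attractor q SG -> Pplus_at q SG k.+2 y.
Proof.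
move=> hSG; have n12 n : word12 (nseq n 1) by rewrite /word12 mem_nseq andbF.
apply: (@Pplus_at_intro _ _ hq _ hSG k.+1 y refine) => //.
- move=> x [->|[w [sw hw] <-]].
    have -> : q 0 = pt q (rcons (nseq k.+1 0) 0) 0 by rewrite (pt_rcons_id hq) /pt fword_nseq.
    by rewrite refine_pt ?size_rcons ?size_nseq // fine_val_rcons eqxx /pt fword_nseq.
  rewrite -/(pt q w 0) refine_pt //; case/lastP: w sw hw => // v a; rewrite size_rcons => -[sv].
  by rewrite word12_rcons fine_val_rcons => /andP [-> /negbTE ->].
- exact: refine_eig.
- move=> w v i hw sw hV; rewrite !refine_pt ?size_cat ?size_negw //.
  exact: fine_val_sym.
rewrite -(pt_rcons_id hq) refine_pt ?size_rcons ?size_nseq // fine_val_rcons eqxx.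
by rewrite u_bot ?size_nseq ?oner_eq0.
Qed.

End LevelUp.

Section NextLevel.
Variables (R : realType) (q : 'I_3 -> plane R).
Hypothesis hq : equilateral q.

Lemma star_sum m (s : seq R) (c : R -> R) (F : R -> seq 'I_3 -> 'I_3 -> R) (x : plane R) :
  star q m (fun w i => \sum_(l <- s) c l * F l w i) x = \sum_(l <- s) c l * star q m (F l) x.
Proof.
elim: s => [|l s IH].
  by rewrite big_nil /star big1 // => w _; rewrite big1 // => i _; rewrite big_nil mulr0.
rewrite big_cons -IH [c l * _]mulrC -star_mulr -star_add.
by apply: eq_star => w i _ _; rewrite big_cons [c l * _]mulrC.
Qed.

Lemma star_bot k x : inner q k.+1 x ->
  star q k.+1 (flux q (fun z => (bot q k.+1 z)%:R)) x = - 2 * bote q k x.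
Proof.
move=> hx; rewrite /bote /star sum_words_rcons mulr_sumr; apply: eq_words => v sv.
have hV w i : size w = k.+1 -> Vset q k.+1 (pt q w i) by move=> sw; apply/Vset_pt; exists w, i.
have szr a : size (rcons v a) = k.+1 by rewrite size_rcons sv.
have bE a i : bot q k.+1 (pt q (rcons v a) i) = word12 v && ((a == 0) (+) (i == 0)).
  by rewrite -sv botE.
case: (boolP (word12 v)) => hv /=; last first.
  rewrite [RHS]mulr_sumr big1 ?[in RHS]big1 // => [i _|a _]; first by rewrite !mulr0.
  by rewrite big1 // => i _; rewrite /flux !sum3 !bE (negbTE hv) /= !subr0 !addr0 mulr0.
have nx a : a != 0 -> forall i, (pt q (rcons v a) i == x) = false.
  move=> a0 i; apply/eqP => e; move: hx; rewrite -e -(szr a) => /(inner_word hq).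
  by rewrite word12_rcons hv a0.
rewrite !sum3 !(pt_rconsC q v 0 1) !(pt_rconsC q v 0 2).
rewrite !(nx 1) // !(nx 2) // (pt_rcons_id hq) /flux !sum3 !bE hv /= !mul0r !mulr0 !addr0.
by ring.
Qed.

Variable SG : set (plane R).
Hypothesis hSG : attractor q SG.

Lemma next_level k : (0 < k)%N -> exists (xs : seq R) (kap : R -> R),
  [/\ uniq xs, forall l, l \in xs -> 0 < kap l,
    forall l, Pplus_at q SG k.+1 l <-> l \in xs,
    forall l, l \in xs -> 0 <= l < 6 &
    forall y : R, y < 2 -> y * (5 - y) \notin xs ->
      (6 - y) / ((2 - y) * (5 - y)) * (1 - y * (5 - y) / 2
        - \sum_(l <- xs) 2 / (l - y * (5 - y)) * kap l) + 2 - y / 2 = 0 ->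
      Pplus_at q SG k.+2 y].
Proof.
move=> k0; have [xs [E [us hE sE hxs]]] := spectrum hq k0.
exists xs, (fun l => atop q k (E l)); split=> //.
- by move=> l /hE [].
- move=> l; split=> [/(Pplus_at_deig hq hSG) [u [? ? ?]]|/hE [h1 h2 h3]]; first exact: (hxs l u).
  by apply/(Pplus_at_deig hq hSG); exists (E l); split=> //; rewrite gt_eqF.
- by move=> l /hE [h1 h2 h3]; apply: (deig_bounds hq h1 h2); rewrite gt_eqF.
move=> y y2; set lam := y * (5 - y) => hy hG.
(* On the interior, [-Delta - lam] maps the indicator of the boundary layer to [-2 * bote]; since
   [bote] is the sum of the [E l], these coefficients cancel it. *)
pose c l := 2 / (l - lam).
pose u x := \sum_(l <- xs) c l * E l x + (bot q k.+1 x)%:R.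
have Eoff l x : l \in xs -> ~ inner q k.+1 x -> E l x = 0 by move=> /hE [[h _] _ _]; exact: h.
have uoff x : ~ inner q k.+1 x -> u x = (bot q k.+1 x)%:R.
  by move=> hx; rewrite /u big1_seq ?add0r // => l /andP [_ hl]; rewrite Eoff // mulr0.
have nin w i : size w = k.+1 -> word12 w -> ~ inner q k.+1 (pt q w i).
  by move=> sw hw; rewrite -sw => /(inner_word hq); rewrite hw.
have hV w i : size w = k.+1 -> Vset q k.+1 (pt q w i) by move=> sw; apply/Vset_pt; exists w, i.
have corner j : u (q j) = 0.
  rewrite uoff; last exact: inner_corner.
  rewrite /bot (bary_q hq); case: (j == 0).
    by rewrite gt_eqF // invf_lt1 ?exprn_gt0 // exprn_egt1 // ltr1n.
  by rewrite lt_eqF // invr_gt0 exprn_gt0.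
apply: (@refine_Pplus _ _ hq k y u corner y2 _ _ _ (\sum_(l <- xs) c l * atop q k (E l)) _ hG _ _ hSG).
- by move=> w sw hw; rewrite uoff; [rewrite -sw (bot_pt hq)|exact: nin].
- move=> w i sw hw i0; rewrite uoff; last exact: nin.
  case/lastP: w sw hw => // v a; rewrite size_rcons => -[sv].
  by rewrite -sv (botE hq) word12_rcons (negbTE i0) => /andP [-> /negbTE ->].
- move=> x hx; rewrite (eq_star (G := fun w i => \sum_(l <- xs) c l * flux q (E l) w i
      + flux q (fun z => (bot q k.+1 z)%:R) w i)) => [|w i _ _]; last first.
    rewrite /flux; under [X in _ = X + _]eq_bigr do rewrite mulr_sumr.
    rewrite [X in _ = X + _]exchange_big -big_split; apply: eq_bigr => j _.
    rewrite /u opprD addrACA -sumrB; congr (_ + _); apply: eq_bigr => l _; by rewrite mulrBr.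
  rewrite star_add star_sum (star_bot hx) sE.
  have -> : (\sum_(l <- xs) E l) x = \sum_(l <- xs) E l x.
    by elim: (xs) => [|l s IH]; rewrite ?big_nil ?big_cons //= -IH.
  have -> : u x = \sum_(l <- xs) c l * E l x.
    by move/(innerP hq hx.1.1): hx => [_ _ /negbTE hb]; rewrite /u hb addr0.
  rewrite -/lam !mulr_sumr -big_split; apply: eq_big_seq => l hl.
  have [[_ h] _ _] := hE l hl; rewrite /= (h x hx) /c; field.
  by rewrite subr_eq0; apply: contraNneq hy => <-.
- move=> v sv hv; have hb : bot q k.+1 (pt q v 0) = false.
    by have := bot_inner hq k0 sv hv => /(innerP hq) h; case: (h _) => [|_ _ /negbTE //];
      apply: (VsetW hq (leqnSn k)); apply/Vset_pt; exists v, 0.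
  rewrite /u hb addr0; apply: eq_big_seq => l hl; have [_ h _] := hE l hl.
  by rewrite (atopE hq h).
move=> w v i hw sw; rewrite /u; congr (_ + _); last by rewrite /bot bary0_sym.
by apply: eq_big_seq => l hl; have [_ h _] := hE l hl; rewrite h.
Qed.

End NextLevel.

(** * Interlacing and counting *)

Section Interlacing.
Variable R : realType.

Definition phi (b : R) : R := (5 - Num.sqrt (25 - 4 * b)) / 2.

Lemma phiK (b : R) : b < 6 -> phi b * (5 - phi b) = b.
Proof.
move=> b6; have h : Num.sqrt (25 - 4 * b) ^+ 2 = 25 - 4 * b by rewrite sqr_sqrtr; lra.
transitivity ((25 - Num.sqrt (25 - 4 * b) ^+ 2) / 4); first by rewrite /phi; field.
by rewrite h; field.
Qed.

Lemma phi_lt2 (b : R) : b < 6 -> phi b < 2.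
Proof.
move=> b6; have : Num.sqrt 1 < Num.sqrt (25 - 4 * b) by rewrite ltr_sqrt; lra.
by rewrite sqrtr1 /phi; lra.
Qed.

Lemma phi_lt a b : a < b -> b < 6 -> phi a < phi b.
Proof.
move=> ab b6; have : Num.sqrt (25 - 4 * b) < Num.sqrt (25 - 4 * a) by rewrite ltr_sqrt; lra.
by rewrite /phi; lra.
Qed.

Lemma phi_le a b : a <= b -> b < 6 -> phi a <= phi b.
Proof. by rewrite le_eqVlt => /orP [/eqP ->|/phi_lt h] // /h /ltW. Qed.

Lemma seq_max (s : seq R) : s = [::] \/ exists2 a, a \in s & forall x, x \in s -> x <= a.
Proof.
elim: s => [|x s [->|[a ha h]]]; first by left.
  by right; exists x; rewrite ?inE // => z; rewrite inE => /eqP ->.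
right; have [xa|ax] := leP x a.
  by exists a => [|z]; rewrite inE ?ha ?orbT // => /orP [/eqP ->|/h].
exists x => [|z]; rewrite inE ?eqxx // => /orP [/eqP -> //|/h za].
by rewrite (le_trans za) // ltW.
Qed.

Variables (xs : seq R) (kap : R -> R).
Hypotheses (us : uniq xs) (kap0 : forall l, l \in xs -> 0 < kap l).
Hypothesis xs6 : forall l, l \in xs -> 0 <= l < 6.

Let P (z : R) := \prod_(l <- xs) (l - z).
Let P' (b z : R) := \prod_(l <- xs | l != b) (l - z).
Let S z := \sum_(l <- xs) 2 * kap l * P' l z.
Let f (y : R) := y * (5 - y).
(** The equation of [next_level] multiplied by [(2 - y) (5 - y) P (f y)]. It is polynomial in [y],
    so the intermediate value theorem applies on intervals ending at the poles [phi l]. *)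
Let Q (y : R) := (6 - y) * ((1 - f y / 2) * P (f y) - S (f y)) + (2 - y / 2) * ((2 - y) * (5 - y)) * P (f y).

Let Q_poly : exists p : {poly R}, forall y, p.[y] = Q y.
Proof.
have [F hF] : exists F : {poly R}, forall y, F.[y] = f y.
  by exists ('X * (5%:P - 'X)) => y; rewrite !hornerE.
have [PP hP] : exists PP : {poly R}, forall y, PP.[y] = P (f y).
  exists (\prod_(l <- xs) (l%:P - F)) => y.
  by rewrite horner_prod; apply: eq_bigr => l _; rewrite !hornerE hF.
have [PS hS] : exists PS : {poly R}, forall y, PS.[y] = S (f y).
  exists (\sum_(l <- xs) (2 * kap l)%:P * \prod_(l' <- xs | l' != l) (l'%:P - F)) => y.
  rewrite horner_sum; apply: eq_bigr => l _; rewrite hornerM hornerC horner_prod; congr (_ * _).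
  by apply: eq_bigr => l' _; rewrite !hornerE hF.
exists ((6%:P - 'X) * ((1 - F * (2^-1)%:P) * PP - PS) +
  (2%:P - 'X * (2^-1)%:P) * ((2%:P - 'X) * (5%:P - 'X)) * PP) => y.
by rewrite !hornerE hP hS hF /Q; congr (_ + _ * _); rewrite mulrA.
Qed.

Let P_split b z : b \in xs -> P z = (b - z) * P' b z.
Proof. by move=> hb; rewrite /P (bigD1_seq b). Qed.

Let S_at b : b \in xs -> S b = 2 * kap b * P' b b.
Proof.
move=> hb; rewrite /S (bigD1_seq b) //= big1 ?addr0 // => l lb.
suff /eqP -> : P' l b == 0 by rewrite mulr0.
rewrite prodf_seq_eq0; apply/hasP; exists b => //.
by rewrite eq_sym lb subrr eqxx.
Qed.

(** Only the term of [b] survives at its pole; as [kap b > 0], the sign is opposite to that of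
    [P' b b], and it alternates along the spectrum ([P'_opp]). *)
Let Q_at b : b \in xs -> Q (phi b) = - (6 - phi b) * (2 * kap b) * P' b b.
Proof.
move=> hb; have /andP [_ b6] := xs6 hb.
rewrite /Q /f phiK // S_at // (P_split _ hb) subrr; ring.
Qed.

Let P'_pos b z : (forall l, l \in xs -> l != b -> z < l) -> 0 < P' b z.
Proof.
move=> h; rewrite /P' big_seq_cond; apply: prodr_gt0 => l /andP [hl lb].
by rewrite subr_gt0 h.
Qed.

(** For every other [l], the factors [l - a] and [l - b] have the same sign; what remains is
    [(b - a) (a - b)]. *)
Let P'_opp a b : a \in xs -> b \in xs -> a < b ->
  (forall l, l \in xs -> l <= a \/ b <= l) -> P' a a * P' b b < 0.
Proof.
move=> ha hb ab h.
have -> : P' a a * P' b b = \prod_(l <- xs) ((if l != a then l - a else 1) * (if l != b then l - b else 1)).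
  by rewrite big_split -!big_mkcond.
rewrite (bigD1_seq a) //= eqxx lt_eqF //= mul1r big_mkcond (bigD1_seq b) //= gt_eqF //= eqxx mulr1.
rewrite pmulr_llt0; first by rewrite subr_lt0.
rewrite pmulr_rgt0 ?subr_gt0 // big_seq_cond; apply: prodr_gt0 => l /andP [hl lb].
case: eqVneq => // la; rewrite lb /=.
case: (h l hl) => [le|le].
  have l1 : l < a by rewrite lt_neqAle la.
  by rewrite nmulr_lgt0 subr_lt0 // (lt_trans l1).
have l1 : b < l by rewrite lt_neqAle eq_sym lb.
by rewrite mulr_gt0 // subr_gt0 // (lt_trans ab).
Qed.

Let eq_G y : y < 2 -> f y \notin xs -> Q y = 0 ->
  (6 - y) / ((2 - y) * (5 - y)) * (1 - f y / 2 - \sum_(l <- xs) 2 / (l - f y) * kap l) + 2 - y / 2 = 0.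
Proof.
move=> y2 hy hQ; have P0 : P (f y) != 0.
  rewrite /P prodf_seq_neq0; apply/allP => l hl /=; rewrite subr_eq0.
  by apply: contraNneq hy => <-.
have -> : \sum_(l <- xs) 2 / (l - f y) * kap l = S (f y) / P (f y).
  rewrite /S mulr_suml; apply: eq_big_seq => l hl.
  have l0 : l - f y != 0 by rewrite subr_eq0; apply: contraNneq hy => <-.
  have p0 : P' l (f y) != 0 by apply: contra_neq P0; rewrite (P_split _ hl) => ->; rewrite mulr0.
  by rewrite (P_split _ hl); field; rewrite l0 p0.
have y2' : 2 - y != 0 by rewrite subr_eq0 gt_eqF.
have y5' : 5 - y != 0 by rewrite subr_eq0 gt_eqF // (lt_trans y2) // ltr_nat.
apply: (@mulIf _ (P (f y) * ((2 - y) * (5 - y)))); first by rewrite !mulf_neq0.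
rewrite mul0r -[RHS]hQ /Q; by field; rewrite P0 y2' y5'.
Qed.

Let f_lt x y : x < y -> y < 2 -> f x < f y.
Proof.
move=> xy y2; rewrite -subr_gt0 /f (_ : _ - _ = (y - x) * (5 - x - y)); last by ring.
by rewrite mulr_gt0; lra.
Qed.

Let Q_ivt a b : a < b -> Q a * Q b < 0 -> exists2 y, a < y < b & Q y = 0.
Proof.
move=> ab hab; have [p hp] := Q_poly.
have [ha hb] : Q a != 0 /\ Q b != 0.
  by split; apply: contraTneq hab => ->; rewrite ?mul0r ?mulr0 ltxx.
have [z /andP [az zb] hz] : exists2 z, a <= z <= b & Q z = 0.
  have [Qa|Qa] := ltP 0 (Q a).
    have [||z hz /rootP] := @poly_ivt R (- p) a b; first exact: ltW.
      by rewrite !hornerN !hp oppr_le0 oppr_ge0 ltW //= ltW // -(pmulr_rlt0 _ Qa).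
    by rewrite hornerN hp => /eqP; rewrite oppr_eq0 => /eqP; exists z.
  have [||z hz /rootP] := @poly_ivt R p a b; first exact: ltW.
    by rewrite !hp Qa ltW // -(nmulr_rlt0 _ (_ : Q a < 0)) // lt_neqAle ha.
  by rewrite hp; exists z.
exists z => //; rewrite !lt_neqAle az zb !andbT.
by apply/andP; split; [apply: contra_neq ha => ->|apply: contra_neq hb => <-].
Qed.

Lemma interlace b : b \in xs -> exists y, [/\ y < phi b, forall a, a \in xs -> a < b -> phi a < y,
  y * (5 - y) \notin xs &
  (6 - y) / ((2 - y) * (5 - y)) * (1 - y * (5 - y) / 2
    - \sum_(l <- xs) 2 / (l - y * (5 - y)) * kap l) + 2 - y / 2 = 0].
Proof.
move=> hb; have /andP [b0 b6] := xs6 hb; have pb2 := phi_lt2 b6.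
have [s0|[a]] := seq_max [seq l <- xs | l < b].
  have nl l : l \in xs -> b <= l.
    move=> hl; rewrite leNgt; apply/negP => lb.
    by have := mem_filter (fun l => l < b) l xs; rewrite s0 lb hl.
  pose K := \sum_(l <- xs) 2 * kap l.
  have K0 : 0 <= K by rewrite /K big_seq sumr_ge0 // => l /kap0 h; rewrite mulr_ge0 // ltW.
  have Qb : Q (phi b) < 0.
    rewrite Q_at // !mulNr oppr_lt0 !mulr_gt0 ?kap0 //; first by lra.
    by apply: P'_pos => l hl lb; rewrite lt_neqAle eq_sym lb nl.
  (* For the smallest [b] the sign change is sought between [-N] and [phi b]. Here [f (- N) <= -6 N]
     makes every [l - f (- N)] at least 1, so that [S <= K P] at this point, and [1 - f (- N) / 2]
     exceeds [K]; hence [Q (- N) > 0]. *)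
  pose N := 1 + K.
  have fN : f (- N) <= - N * 6 by rewrite /f /N; nra.
  have hl l : l \in xs -> 1 <= l - f (- N) by move=> /nl; rewrite /N in fN *; lra.
  have PN : 0 < P (f (- N)).
    rewrite /P big_seq prodr_gt0 // => l /hl; exact: lt_le_trans.
  have SN : S (f (- N)) <= K * P (f (- N)).
    rewrite /S /K mulr_suml big_seq [leRHS]big_seq ler_sum // => l lxs.
    rewrite ler_wpM2l ?mulr_ge0 ?(ltW (kap0 lxs)) // (P_split _ lxs).
    rewrite ler_peMl ?hl // ltW //; have := PN; rewrite (P_split _ lxs) pmulr_rgt0 //.
    exact: lt_le_trans (hl l lxs).
  have QN : 0 < Q (- N).
    have h1 : K * P (f (- N)) <= (1 - f (- N) / 2) * P (f (- N)).
      rewrite ler_pM2r //; rewrite /N in fN *; lra.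
    rewrite /Q ltr_wpDl ?mulr_gt0 //; rewrite ?/N; try lra.
    by rewrite mulr_ge0 ?subr_ge0 ?(le_trans SN) //; lra.
  have Nb : - N < phi b.
    have := phi_le b0 b6; rewrite /phi mulr0 subr0 (_ : 25 = 5 ^+ 2 :> R); last by ring.
    by rewrite sqrtr_sqr ger0_norm // subrr mul0r /N; lra.
  have [|y /andP [Ny yb] hy] := Q_ivt Nb; first by rewrite pmulr_rlt0.
  have y2 : y < 2 by exact: lt_trans pb2.
  have fy : f y \notin xs.
    apply/negP => /nl; rewrite leNgt => /negP; apply.
    by rewrite -[ltRHS](phiK b6); exact: f_lt.
  exists y; split=> //; last exact: eq_G.
  by move=> a ha ab; have := nl a ha; rewrite leNgt ab.
rewrite mem_filter => /andP [ab ha] hmax.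
have nl l : l \in xs -> l <= a \/ b <= l.
  move=> hl; have [lb|] := ltP l b; last by right.
  by left; apply: hmax; rewrite mem_filter lb.
have a6 : a < 6 := lt_trans ab b6.
have pa2 := phi_lt2 a6.
have [||y /andP [ay yb] hy] := @Q_ivt (phi a) (phi b).
- exact: phi_lt.
- rewrite !Q_at //; have := P'_opp ha hb ab nl.
  have c1 : 0 < (6 - phi a) * (2 * kap a) * ((6 - phi b) * (2 * kap b)).
    by rewrite !mulr_gt0 ?kap0 //; lra.
  move=> h; rewrite (_ : _ * _ = (6 - phi a) * (2 * kap a) * ((6 - phi b) * (2 * kap b)) * (P' a a * P' b b)); last by ring.
  by rewrite pmulr_rlt0.
have y2 : y < 2 by exact: lt_trans pb2.
have fya : a < f y by rewrite -[ltLHS](phiK a6); exact: f_lt.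
have fyb : f y < b by rewrite -[ltRHS](phiK b6); exact: f_lt.
have fy : f y \notin xs.
  by apply/negP => /nl []; rewrite leNgt ?fya ?fyb.
exists y; split=> //; last exact: eq_G.
move=> a' ha' ab'; apply: le_lt_trans ay; apply: phi_le => //.
by case: (nl a' ha') => //; rewrite leNgt ab'.
Qed.

End Interlacing.

Lemma card_seq (T : pointedType) (s : seq T) : uniq s -> ([set` s] #= `I_(size s))%card.
Proof.
move=> us; have -> : [set` s] = [set nth point s i | i in `I_(size s)].
  apply/seteqP; split=> x /=; first by move=> hx; exists (index x s); rewrite ?nth_index ?index_mem.
  by case=> i hi <-; exact: mem_nth.
apply: inj_card_eq => i j; rewrite !inE /= => hi hj e.
by apply/eqP; rewrite -(nth_uniq point hi hj us) e.
Qed.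

Section Counting.
Variables (R : realType) (q : 'I_3 -> plane R) (SG : set (plane R)).
Hypotheses (hq : equilateral q) (hSG : attractor q SG).

Lemma Pplus_at_bounds k l : (0 < k)%N -> Pplus_at q SG k.+1 l -> 0 <= l < 6.
Proof. by move=> k0; have [xs [kap [_ _ hP h6 _]]] := next_level hq hSG k0; move/hP/h6. Qed.

(** Let [x] be the [j]-th element. The elements [b <= x] give [j] distinct roots below [phi x]; if
    [z] were larger than [phi x], these and [z] would be [j + 1] elements of the next set that are
    at most [z], whereas [z] is the [j]-th. *)
Lemma phi_minus_le k x z : (0 < k)%N -> phi_minus q SG k.+1 x z -> z <= phi x.
Proof.
move=> k0 [j _ [[hx cx] [hz cz]]]; rewrite leNgt; apply/negP => xz.
have [xs [kap [us kap0 hP h6 hnext]]] := next_level hq hSG k0.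
have x6 : x < 6 by move/hP/h6: hx => /andP [].
have [Y hY] : exists Y : R -> R, forall b, b \in xs -> [/\ Y b < phi b,
    forall a, a \in xs -> a < b -> phi a < Y b & Pplus_at q SG k.+2 (Y b)].
  have h b : exists y, b \in xs -> [/\ y < phi b,
      forall a, a \in xs -> a < b -> phi a < y & Pplus_at q SG k.+2 y].
    have [hb|hb] := boolP (b \in xs); last by exists 0.
    have [y [h1 h2 h3 h4]] := interlace us kap0 h6 hb; exists y => _; split=> //.
    apply: hnext => //; apply: lt_trans h1 (phi_lt2 _).
    by case/andP: (h6 b hb).
  by have [Y hY] := boolp.choice h; exists Y.
pose s := [seq b <- xs | b <= x].
have sj : size s = j.
  apply/(@card_eq_II _ _); apply: card_eq_trans cx; rewrite card_eq_sym.
  have -> : [set y | Pplus_at q SG k.+1 y /\ y <= x] = [set` s].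
    apply/seteqP; split=> y /=; first by case=> /hP hy yx; rewrite mem_filter yx.
    by rewrite mem_filter => /andP [yx /hP hy].
  by apply: card_seq; exact: filter_uniq.
have ub b : b \in s -> [/\ b \in xs, b <= x & phi b <= phi x].
  by rewrite mem_filter => /andP [bx hb]; split=> //; exact: phi_le.
have Yz b : b \in s -> Y b < z.
  by move=> /ub [hb _ h]; have [h1 _ _] := hY b hb; apply: lt_trans xz; exact: lt_le_trans h.
have Ymono a b : a \in s -> b \in s -> a < b -> Y a < Y b.
  move=> /ub [ha _ _] /ub [hb _ _] ab; have [h1 _ _] := hY a ha; have [_ h2 _] := hY b hb.
  exact: lt_trans (h2 a ha ab).
have ut : uniq (z :: map Y s).
  rewrite /= map_inj_in_uniq ?filter_uniq // ?andbT.
    by apply/mapP => -[b /Yz bz zb]; rewrite zb ltxx in bz.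
  move=> a b ha hb e; case: (ltgtP a b) => // ab.
    by have := Ymono a b ha hb ab; rewrite e ltxx.
  by have := Ymono b a hb ha ab; rewrite e ltxx.
have : (`I_(size (z :: map Y s)) #<= `I_j)%card.
  apply: (@card_le_trans _ _ _ [set` z :: map Y s]).
    by have := card_seq ut; rewrite card_eq_le => /andP [].
  apply: (@card_le_trans _ _ _ [set y | Pplus_at q SG k.+2 y /\ y <= z]).
    apply: subset_card_le => y /=; rewrite inE => /orP [/eqP -> //|/mapP [b hb ->]].
    have [hb' _ _] := ub b hb; have [_ _ h] := hY b hb'; split=> //.
    by rewrite ltW // Yz.
  by move: cz; rewrite card_eq_le => /andP [].
by rewrite card_le_II /= size_map sj ltnn.
Qed.

End Counting.

(* With [h x = x + x^2/4] and [x >= z (5 - z)], [z <= 2], one has [h x >= 5 h z],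
   so that [5^m h (x_m)] decreases. *)
Lemma renormalized_cvg (R : realType) (N : nat) (x : nat -> R) :
  (forall m, (N <= m)%N -> 0 <= x m < 6) ->
  (forall m, (N <= m)%N -> x m.+1 <= phi (x m)) ->
  cvgn (fun m => 5 ^+ m * x m).
Proof.
move=> hx hs; pose h (t : R) := t + t ^+ 2 / 4.
have step m : (N <= m)%N -> 5 * h (x m.+1) <= h (x m).
  move=> Nm; have /andP [x0 x6] := hx m Nm; have /andP [z0 _] := hx m.+1 (leqW Nm).
  have zp := hs m Nm; have p2 := phi_lt2 x6; have pK := phiK x6.
  have xz : x m.+1 * (5 - x m.+1) <= x m.
    rewrite -[leRHS]pK -subr_ge0 (_ : _ - _ = (phi (x m) - x m.+1) * (5 - phi (x m) - x m.+1)); last by ring.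
    by rewrite mulr_ge0 ?subr_ge0 //; lra.
  have z2 : x m.+1 < 2 by exact: le_lt_trans p2.
  move: xz x0 z0 z2; clear; rewrite /h; move: (x m) (x m.+1) => a z az a0 z0 z2.
  have zz : 0 <= z * (5 - z) by rewrite mulr_ge0 //; lra.
  have h1 : (z * (5 - z)) ^+ 2 <= a ^+ 2 by rewrite ler_sqr ?nnegrE.
  (* The difference [h (z (5 - z)) - 5 h z] is one quarter of this product. *)
  have h2 : 0 <= z ^+ 2 * ((2 - z) * (8 - z)) by rewrite mulr_ge0 ?sqr_ge0 // mulr_ge0 //; lra.
  by move: h1 h2 az; rewrite !expr2 => h1 h2 az; nra.
pose w k := 5 ^+ (k + N) * h (x (k + N)%N).
have h0 k : 0 <= h (x (k + N)%N).
  by have /andP [x0 _] := hx _ (leq_addl k N); rewrite /h addr_ge0 ?divr_ge0 ?sqr_ge0.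
have wS : nonincreasing_seq w.
  apply/nonincreasing_seqP => k; rewrite /w addSn exprSr -mulrA ler_wpM2l ?exprn_ge0 //.
  exact/step/leq_addl.
have w0 k : 0 <= w k by rewrite mulr_ge0 ?exprn_ge0.
have cw : cvgn w by apply: nonincreasing_is_cvgn => //; exists 0 => _ [k _ <-].
pose z k := 5 ^+ (k + N) * x (k + N)%N.
have z0 k : 0 <= z k by have /andP [x0 _] := hx _ (leq_addl k N); rewrite mulr_ge0 ?exprn_ge0.
(* The quadratic part of [h] contributes [z^2 / 4] divided by [5^(k + N)], negligible because [z] is
   bounded; so [z] converges with [w]. *)
have zw k : w k - z k = z k ^+ 2 * (4^-1 * 5^-1 ^+ N) * 5^-1 ^+ k.
  have e5 : (5 : R) ^+ (k + N) != 0 by rewrite expf_neq0.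
  rewrite /w /z /h -!mulrA -exprD [(N + k)%N]addnC exprVn.
  by move: e5; set e := _ ^+ (k + N) => e5; field.
have e0 k : 0 <= (5 : R)^-1 ^+ k by rewrite exprn_ge0 ?invr_ge0.
have c0 k : 0 <= z k ^+ 2 * (4^-1 * 5^-1 ^+ N) * 5^-1 ^+ k.
  by rewrite mulr_ge0 // mulr_ge0 ?sqr_ge0 // mulr_ge0 ?invr_ge0.
have zB k : z k <= w 0%N.
  by apply: le_trans (wS 0%N k (leq0n k)); rewrite -subr_ge0 zw; exact: c0.
have d0 : w k - z k @[k --> \oo] --> (0 : R).
  apply: (@squeeze_cvgr _ _ _ _ (fun=> 0) (fun k => w 0%N ^+ 2 * (4^-1 * 5^-1 ^+ N) * 5^-1 ^+ k)).
  - apply: nearW => k; rewrite zw c0 /= ler_wpM2r // ler_wpM2r ?ler_sqr ?nnegrE //.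
  - exact: cvg_cst.
  rewrite -[X in _ --> X](mulr0 (w 0%N ^+ 2 * (4^-1 * 5^-1 ^+ N))).
  apply: cvgM; first exact: cvg_cst.
  by apply: cvg_expr; rewrite ger0_norm ?invr_ge0 // invf_lt1 // ltr1n.
have hz : z k @[k --> \oo] --> limn w.
  rewrite -[limn w]subr0 (_ : z = fun k => w k - (w k - z k)); first exact: cvgB.
  by apply/funext => k; rewrite opprB addrC subrK.
by apply/cvg_ex; exists (limn w); rewrite -(cvg_shiftn N).
Qed.

(** * Normalisation of the eigenfunctions and conclusion *)

Section Scaling.
Variables (R : realType) (q : 'I_3 -> plane R).

Lemma deig_scale m l c u : deig q m l u -> deig q m l (fun x => c * u x).
Proof.
move=> [h1 h2]; split=> x hx; first by rewrite h1 ?mulr0.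
rewrite mulrCA -h2 // mulrC -star_mulr; apply: eq_star => w i _ _.
by rewrite /flux mulr_suml; apply: eq_bigr => j _; rewrite mulrBl ![_ * c]mulrC.
Qed.

Lemma mass_scale m c u : mass q m (fun x => c * u x) (fun x => c * u x) = c ^+ 2 * mass q m u u.
Proof.
rewrite /mass mulrCA; congr (_ * _); rewrite mulr_sumr; apply: eq_bigr => w _.
by rewrite mulr_sumr; apply: eq_bigr => i _; ring.
Qed.

End Scaling.

Lemma normalized_eigenfunction (R : realType) (q : 'I_3 -> plane R) (SG : set (plane R)) k l :
  equilateral q -> attractor q SG -> Pplus_at q SG k.+1 l ->
  exists u, [/\ deig q k.+1 l u, symv q k.+1 u & mass q k.+1 u u = 1].
Proof.
move=> hq hSG /(Pplus_at_deig hq hSG) [u [hu hs ha]].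
have hV : Vset q k.+1 (pt q (nseq k 1) 0).
  by apply: (VsetW hq (leqnSn k)); apply/Vset_pt; exists (nseq k 1), 0; rewrite size_nseq.
have m0 := mass_gt0 hV ha.
exists (fun x => (Num.sqrt (mass q k.+1 u u))^-1 * u x); split; first exact: deig_scale.
  by move=> w v i hw sw; rewrite hs.
by rewrite mass_scale exprVn sqr_sqrtr ?ltW // mulVf // gt_eqF.
Qed.

Unset Implicit Arguments.

Theorem theorem3p6 (R : realType) (q : 'I_3 -> plane R) (SG : set (plane R))
  (mu : probability (borel_plane R) R)
  (hq : equilateral q) (hSG : attractor q SG) (hmu : self_similar q SG mu)
  (m0 : nat) (hm0 : (2 <= m0)%N) (lam : nat -> R)
  (hlam : forall m : nat, (m0 <= m)%N -> Pplus_at q SG m (lam m))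
  (hstep : forall m : nat, (m0 <= m)%N ->
     phi_minus q SG m (lam m) (lam m.+1) \/ phi_plus q SG m (lam m) (lam m.+1))
  (hfin : finite_set
     [set m : nat | (m0 <= m)%N /\ phi_plus q SG m (lam m) (lam m.+1)]) :
  cvgn (fun m : nat => 5 ^+ m * lam m) /\
  Pplus q SG mu (3 / 2 * limn (fun m : nat => 5 ^+ m * lam m)).
Proof.
have [N hN] : exists N, forall m, (N <= m)%N -> (m0 <= m)%N ->
    ~ phi_plus q SG m (lam m) (lam m.+1).
  have [s hs] := (finite_seqP _).1 hfin; exists (\max_(i <- s) i).+1 => m Nm mm h.
  have ms : m \in s by have : [set` s] m by rewrite -hs.
  by move: Nm; rewrite ltnNge (@leq_bigmax_seq _ _ predT id).
pose M := maxn N m0.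
(* The results on level sets are stated at levels [k.+1] with [0 < k], which is where [m0 >= 2]
   enters. *)
have MP m : (M <= m)%N -> [/\ (m0 <= m)%N, (0 < m.-1)%N & m.-1.+1 = m].
  by rewrite geq_max => /andP [_ h]; split=> //; move: (leq_trans hm0 h); case: m {h} => [|[|m]].
have bd m : (M <= m)%N -> 0 <= lam m < 6.
  move=> /MP [mm m1 e]; have := hlam m mm; rewrite -{1}e => h.
  exact: (Pplus_at_bounds hq hSG m1).
have cv : cvgn (fun m => 5 ^+ m * lam m).
  apply: (@renormalized_cvg _ M) => // m Mm; have [mm m1 e] := MP m Mm.
  case: (hstep m mm) => [|/hN h]; last by exfalso; apply: h => //; move: Mm; rewrite geq_max => /andP [].
  by rewrite -{1}e; exact: phi_minus_le.
split=> //.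
have [us hus] : exists us : nat -> plane R -> R, forall m, (M <= m)%N ->
    [/\ deig q m.+1 (lam m.+1) (us m.+1), symv q m.+1 (us m.+1) & mass q m.+1 (us m.+1) (us m.+1) = 1].
  have h m : exists u, (M <= m)%N -> [/\ deig q m.+1 (lam m.+1) u, symv q m.+1 u & mass q m.+1 u u = 1].
    have [Mm|Mm] := boolP (M <= m)%N; last by exists (fun=> 0).
    have [mm _ _] := MP m Mm.
    by have [u hu] := normalized_eigenfunction hq hSG (hlam m.+1 (leqW mm)); exists u.
  by have [F hF] := boolp.choice h; exists (fun m => F m.-1).
by apply: (@limit_eigenvalue _ _ _ _ hq hSG hmu M lam us) => // m /hus [].
Qed.
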